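(* Let $d_1,\dots,d_{n-1}$ be positive integers, $q=d_1x_1^2+\cdots+d_{n-1}x_{n-1}^2$ (a positive definite quadratic form over $\mathbb{Z}$), and $\mathcal{O}=\left(\frac{-d_1,\dots,-d_{n-1}}{\mathbb{Z}}\right)=\operatorname{Clf}(\mathbb{Z}^{n-1},q)$, embedded in $\mathbb{C}_n$ by sending the $j$-th generator to $\sqrt{d_j}\,i_j$. Let $\varphi:\operatorname{PSL}_2(\mathbb{C}_n)\to \mathrm{O}_{1,n+1}(\mathbb{R})^{\circ}$ be the isomorphism obtained by letting $\operatorname{PSL}_2(\mathbb{C}_n)$ act on $\mathcal{H}^{n+1}$ by Möbius transformations and identifying the orientation-preserving isometries of $\mathcal{H}^{n+1}$ with $\mathrm{O}_{1,n+1}(\mathbb{R})^{\circ}$. Let $\Gamma=\operatorname{PSL}_2(\mathcal{O})\subset\operatorname{PSL}_2(\mathbb{C}_n)$. Then $\varphi(\Gamma)$ is an arithmetic subgroup of $\mathrm{O}_Q(\mathbb{R})$, where $Q=x^2-yz+q$.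
   Context: $\mathbb{C}_n$ is the real Clifford algebra $\mathbb{R}[i_1,\dots,i_{n-1}]$ with $i_a^2=-1$ and $i_ai_b=-i_bi_a$ ($a\ne b$); $V_n=\mathbb{R}+\mathbb{R}i_1+\cdots+\mathbb{R}i_{n-1}$ are its Clifford vectors, and $\mathbb{C}_n\subset\mathbb{C}_{n+1}$. Involutions: parity $x\mapsto x'$ ($i_a\mapsto -i_a$, algebra automorphism), transpose $x\mapsto x^*$ (anti-automorphism fixing each $i_a$), conjugation $\bar x=(x')^*$. For a Clifford algebra or order $C$ over a ring $R$, $\operatorname{SL}_2(C)$ is the set of matrices $\begin{pmatrix}a&b\\c&d\end{pmatrix}$ over $C$ with $ad^*-bc^*=1$, $ab^*=ba^*$, $cd^*=dc^*$, $a\bar a,b\bar b,c\bar c,d\bar d\in R$, $a\bar c,b\bar d\in\operatorname{Vec}(C)$, and for all Clifford vectors $x$: $ax\bar b+b\bar x\bar a,\ cx\bar d+d\bar x\bar c\in R$ and $ax\bar d+b\bar x\bar c\in\operatorname{Vec}(C)$. $\operatorname{PSL}_2=\operatorname{SL}_2/\{\pm1\}$. Hyperbolic space: $\mathcal{H}^{n+1}=\{x=x_0+x_1i_1+\cdots+x_ni_n\in V_{n+1}: x_n>0\}$ with metric $(dx_0^2+\cdots+dx_n^2)/x_n^2$; $g=\begin{pmatrix}a&b\\c&d\end{pmatrix}\in\operatorname{SL}_2(\mathbb{C}_n)$ acts by $x\mapsto(ax+b)(cx+d)^{-1}$. The form $Q$ on $\mathbb{R}^{n+2}$ is isometric to (up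 to sign) the standard form of signature $(1,n+1)$, and $\mathrm{O}_{1,n+1}(\mathbb{R})^{\circ}$ is regarded as a subgroup of $\mathrm{O}_Q(\mathbb{R})$ via such an identification. Arithmetic subgroups: for a semisimple Lie group $H$ and subgroup $\Gamma$, $\Gamma<H$ is arithmetic if one of the following holds: (1) there are $m$ and a closed $\mathbb{Z}$-subgroup scheme $G\subset\operatorname{SL}_m$ and an isomorphism of Lie groups $\phi:H\to G(\mathbb{R})$ with $\phi(\Gamma)=G(\mathbb{Z})$; (2) $\Gamma$ is commensurable with some $\Gamma'<H$ that is arithmetic; (3) $(\Gamma,H)\cong(\Gamma'\cap (H')^{\circ},(H')^\circ)$ for an arithmetic pair $(\Gamma',H')$; (4) $(\Gamma,H)\cong(\Gamma'/(\Gamma'\cap K'),H'/K')$ for an arithmetic pair $(\Gamma',H')$ and a compact normal subgroup $K'<H'$. *)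

(* Defs.v *)
From HB Require Import structures.
From mathcomp Require Import all_boot all_order all_algebra.
From mathcomp Require Import all_classical all_reals all_analysis.
From mathcomp Require mpoly.
From mathcomp Require Import ring lra.

Set Implicit Arguments.
Unset Strict Implicit.
Unset Printing Implicit Defensive.

Import Order.TTheory GRing.Theory Num.Theory.
Import numFieldNormedType.Exports.

Local Open Scope classical_set_scope.
Local Open Scope ring_scope.

(** * Diagonal Clifford algebras

  [clifford q] is the associative [A]-algebra with generators [e_j]
  ([j : 'I_m]) and relations [e_j ^ 2 = - q j], [e_i e_j = - e_j e_i], i.e.
  Clf(A^m, \sum_j q_j x_j ^ 2) with the convention w^2 = - q(w).  An element is
  its coordinate family on the basis [e_S = e_{s_1} ... e_{s_k}],
  [S = {s_1 < ... < s_k}], and [e_S e_T = cl_coef S T *: e_(S (+) T)].        *)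

Definition clifford (A : comNzRingType) (m : nat) (q : 'I_m -> A) : Type :=
  {ffun {set 'I_m} -> A^o}.

Section Clifford.
Variables (A : comNzRingType) (m : nat) (q : 'I_m -> A).

Definition symdiff (S T : {set 'I_m}) : {set 'I_m} :=
  [set j | (j \in S) (+) (j \in T)]%SET.

Definition cl_coef (S T : {set 'I_m}) : A :=
  (-1) ^+ #|[set p : 'I_m * 'I_m | [&& p.1 \in S, p.2 \in T & (p.2 < p.1)%N]]%SET|
  * \prod_(j in S :&: T) - q j.

HB.instance Definition _ := GRing.Lmodule.on (clifford q).

Implicit Types (x y z : clifford q) (S T U : {set 'I_m}).

Definition cl_basis S : clifford q := [ffun T => (T == S)%:R].

Definition cl_gen (j : 'I_m) : clifford q := cl_basis [set j]%SET.

Definition cl_mul x y : clifford q :=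
  [ffun U => \sum_S cl_coef S (symdiff S U) * (x S * y (symdiff S U))].

Fact symdiffK S : involutive (symdiff S).
Proof. by move=> T; apply/setP => j; rewrite !inE addKb. Qed.

Fact symdiffA S T U : symdiff S (symdiff T U) = symdiff (symdiff S T) U.
Proof. by apply/setP => j; rewrite !inE addbA. Qed.

Fact symdiffC S T : symdiff S T = symdiff T S.
Proof. by apply/setP => j; rewrite !inE addbC. Qed.

Fact symdiff0 S : symdiff finset.set0 S = S.
Proof. by apply/setP => j; rewrite !inE. Qed.

Fact symdiffs0 S : symdiff S finset.set0 = S.
Proof. by rewrite symdiffC symdiff0. Qed.

Fact symdiffss S : symdiff S S = finset.set0.
Proof. by apply/setP => j; rewrite !inE addbb. Qed.

Fact cl_coefE S T : cl_coef S T =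
  (\prod_(p : 'I_m * 'I_m | (p.2 < p.1)%N) (-1) ^+ ((p.1 \in S) && (p.2 \in T)))
  * \prod_j (if (j \in S) && (j \in T) then - q j else 1).
Proof.
rewrite /cl_coef; congr (_ * _).
- rewrite -prodr_const big_mkcond [RHS]big_mkcond; apply: eq_bigr => p _ /=.
  rewrite inE; case: (p.1 \in S) => /=; last by case: ifP.
  by case: (p.2 \in T) => /=; last by case: ifP.
- by rewrite big_mkcond; apply: eq_bigr => j _; rewrite inE.
Qed.

Fact cl_coefA S T U : cl_coef S T * cl_coef (symdiff S T) U =
  cl_coef T U * cl_coef S (symdiff T U).
Proof.
rewrite !cl_coefE mulrACA [RHS]mulrACA -!big_split /=; congr (_ * _).
- apply: eq_bigr => p _; rewrite !inE.
  case: (p.1 \in S); case: (p.1 \in T); case: (p.2 \in T); case: (p.2 \in U);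
  by rewrite /= ?expr0 ?expr1 ?mulr1 ?mul1r ?mulN1r ?opprK.
- apply: eq_bigr => j _; rewrite !inE.
  by case: (j \in S); case: (j \in T); case: (j \in U); rewrite /= ?mulr1 ?mul1r.
Qed.

Fact cl_coef0s S : cl_coef finset.set0 S = 1.
Proof.
rewrite cl_coefE !big1 ?mulr1 // => [j _|p _]; by rewrite !inE.
Qed.

Fact cl_coefs0 S : cl_coef S finset.set0 = 1.
Proof.
by rewrite cl_coefE !big1 ?mulr1 // => [j _|p _]; rewrite !inE andbF.
Qed.

Fact cl_mulA : associative cl_mul.
Proof.
move=> x y z; apply/ffunP => U; rewrite !ffunE.
under eq_bigr => S _ do rewrite !ffunE !mulr_sumr.
under [RHS]eq_bigr => V _ do rewrite !ffunE mulr_suml mulr_sumr.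
rewrite [RHS]exchange_big /=; apply: eq_bigr => S _.
rewrite [RHS](reindex_inj (can_inj (symdiffK S))) /=; apply: eq_bigr => T _.
rewrite symdiffK; set W := symdiff (symdiff S T) U.
have -> : symdiff T (symdiff S U) = W by rewrite symdiffA [symdiff T S]symdiffC.
have -> : symdiff S U = symdiff T W.
  by rewrite /W [symdiff S T]symdiffC -symdiffA symdiffK.
transitivity (cl_coef T W * cl_coef S (symdiff T W) * (x S * y T * z W)).
  move: (cl_coef T W) (cl_coef S _) => k1 k2.
  by rewrite [x S * _]mulrCA [k1 * k2]mulrC !mulrA.
rewrite -cl_coefA; move: (cl_coef S T) (cl_coef _ W) => k1 k2.
by rewrite [k1 * k2]mulrC !mulrA.
Qed.

Fact cl_basisE S T : cl_basis S T = (T == S)%:R.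
Proof. by rewrite ffunE. Qed.

Fact cl_mulbl S x : cl_mul (cl_basis S) x =
  [ffun U => cl_coef S (symdiff S U) * x (symdiff S U)].
Proof.
apply/ffunP => U; rewrite !ffunE (bigD1 S) //= big1 => [|T /negPf neTS].
  by rewrite cl_basisE eqxx mul1r addr0.
by rewrite cl_basisE neTS mul0r mulr0.
Qed.

Fact cl_mul1x : left_id (cl_basis finset.set0) cl_mul.
Proof.
by move=> x; rewrite cl_mulbl; apply/ffunP => U; rewrite ffunE symdiff0 cl_coef0s mul1r.
Qed.

Fact cl_mulx1 : right_id (cl_basis finset.set0) cl_mul.
Proof.
move=> x; apply/ffunP => U; rewrite !ffunE (bigD1 U) //= big1 => [|T neTU].
  by rewrite symdiffss cl_basisE eqxx mulr1 cl_coefs0 mul1r addr0.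
rewrite cl_basisE; case: eqP => [TU0|_]; last by rewrite !mulr0.
by case/eqP: neTU; rewrite -[T]symdiffs0 -TU0 symdiffK.
Qed.

Fact cl_mulDl : left_distributive cl_mul +%R.
Proof.
move=> x y z; apply/ffunP => U; rewrite !ffunE -big_split /=.
by apply: eq_bigr => S _; rewrite !ffunE mulrDl mulrDr.
Qed.

Fact cl_mulDr : right_distributive cl_mul +%R.
Proof.
move=> x y z; apply/ffunP => U; rewrite !ffunE -big_split /=.
by apply: eq_bigr => S _; rewrite !ffunE mulrDr mulrDr.
Qed.

Fact cl_1neq0 : cl_basis finset.set0 != 0.
Proof.
by apply/eqP => /ffunP /(_ finset.set0) /eqP; rewrite !ffunE eqxx oner_eq0.
Qed.

HB.instance Definition _ := GRing.Zmodule_isNzRing.Build (clifford q)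
  cl_mulA cl_mul1x cl_mulx1 cl_mulDl cl_mulDr cl_1neq0.

Fact cl_scaleAl (a : A) x y : a *: (x * y) = (a *: x) * y.
Proof.
apply/ffunP => U; rewrite !ffunE scaler_sumr; apply: eq_bigr => S _.
by rewrite !ffunE -scalerAl scalerAr.
Qed.

HB.instance Definition _ := GRing.Lmodule_isLalgebra.Build A (clifford q) cl_scaleAl.

Fact cl_scaleAr (a : A) x y : a *: (x * y) = x * (a *: y).
Proof.
apply/ffunP => U; rewrite !ffunE scaler_sumr; apply: eq_bigr => S _.
by rewrite !ffunE !scalerAr.
Qed.

HB.instance Definition _ := GRing.Lalgebra_isAlgebra.Build A (clifford q) cl_scaleAr.

Lemma cl_basisM S T :
  cl_basis S * cl_basis T = cl_coef S T *: cl_basis (symdiff S T).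
Proof.
rewrite [LHS]cl_mulbl; apply/ffunP => U; rewrite !ffunE.
have -> : (symdiff S U == T) = (U == symdiff S T).
  by apply/eqP/eqP => [<-|->]; rewrite symdiffK.
by case: eqP => [->|_]; rewrite ?symdiffK ?mulr0 ?scaler0.
Qed.

Lemma cl_basis_spanning x : x = \sum_S x S *: cl_basis S.
Proof.
apply/ffunP => U; rewrite sum_ffunE (bigD1 U) //= big1 => [|S neSU].
  by rewrite !ffunE eqxx addr0 [RHS]mulr1.
by rewrite !ffunE eq_sym (negPf neSU) scaler0.
Qed.

Lemma cl_gen_sqr j : cl_gen j * cl_gen j = (- q j)%:A.
Proof.
rewrite /cl_gen cl_basisM symdiffss; congr (_ *: _); rewrite /cl_coef.
rewrite finset.setIid big_set1 (_ : [set p | _]%SET = finset.set0) ?cards0 ?mul1r //.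
apply/setP => -[a b]; rewrite !inE /=; apply/negP => /and3P[/eqP-> /eqP->].
by rewrite ltnn.
Qed.

Lemma cl_gen_anti i j : i != j -> cl_gen i * cl_gen j = - (cl_gen j * cl_gen i).
Proof.
wlog lt_ij : i j / (i < j)%N => [IH ne_ij|ne_ij].
  have /orP[lt|lt] : (i < j)%N || (j < i)%N by rewrite -neq_ltn.
    exact: IH.
  by rewrite (IH j i) ?opprK // eq_sym.
rewrite /cl_gen !cl_basisM [symdiff [set j] _]symdiffC -scaleNr.
congr (_ *: _); rewrite /cl_coef.
have disj (a b : 'I_m) : a != b -> [set a]%SET :&: [set b]%SET = finset.set0.
  by move=> ne; apply/setP => k; rewrite !inE; case: eqP => // ->; rewrite (negPf ne).
have ne_ji : j != i by rewrite eq_sym.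
rewrite (disj i j) // (disj j i) // !big_set0 !mulr1.
rewrite (_ : [set p | _]%SET = finset.set0) ?cards0; last first.
  apply/setP => -[a b]; rewrite !inE /=; apply/negP => /and3P[/eqP-> /eqP->].
  by rewrite ltnNge ltnW.
rewrite (_ : [set p | _]%SET = [set (j, i)]%SET) ?cards1 ?expr1 ?opprK //.
apply/setP => -[a b]; rewrite !inE /= xpair_eqE; do 2![case: eqP => //= ->].
by rewrite lt_ij.
Qed.

(** The parity automorphism [x'] and the transpose anti-automorphism [x^*] act
  on [e_S], [k = #|S|], by the signs [(-1)^k] and [(-1)^(k (k - 1) / 2)].     *)

Definition cl_parity x : clifford q := [ffun S : {set 'I_m} => (-1) ^+ #|S| * x S].
Definition cl_transp x : clifford q := [ffun S : {set 'I_m} => (-1) ^+ 'C(#|S|, 2) * x S].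
Definition cl_conj x : clifford q := cl_transp (cl_parity x).

Fact sign_cardE S : (-1) ^+ #|S| = \prod_j (-1) ^+ (j \in S) :> A.
Proof.
by rewrite -prodr_const big_mkcond; apply: eq_bigr => j _; case: (j \in S).
Qed.

Lemma cl_parityM x y : cl_parity (x * y) = cl_parity x * cl_parity y.
Proof.
apply/ffunP => U; rewrite !ffunE mulr_sumr; apply: eq_bigr => S _.
rewrite !ffunE; have -> : (-1) ^+ #|U| = (-1) ^+ #|S| * (-1) ^+ #|symdiff S U| :> A.
  rewrite !sign_cardE -big_split; apply: eq_bigr => j _ /=; rewrite !inE.
  by case: (j \in S); case: (j \in U); rewrite /= ?mulr1 ?mul1r ?mulrNN ?mulr1.
have key (k1 k2 k3 a b : A) : k2 * k3 * (k1 * (a * b)) = k1 * ((k2 * a) * (k3 * b)).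
  by ring.
exact: key.
Qed.

Lemma cl_parity_gen j : cl_parity (cl_gen j) = - cl_gen j.
Proof.
apply/ffunP => U; rewrite !ffunE; case: eqP => [->|_]; last by rewrite mulr0 oppr0.
by rewrite cards1 expr1 mulr1.
Qed.

Fact card_inversions S :
  #|[set p : 'I_m * 'I_m | [&& p.1 \in S, p.2 \in S & (p.2 < p.1)%N]]%SET| =
  'C(#|S|, 2).
Proof.
set L := [set p | _]%SET; apply: (@double_inj); rewrite bin2 halfK.
pose G : {set 'I_m * 'I_m} :=
  [set p | [&& p.1 \in S, p.2 \in S & (p.1 < p.2)%N]]%SET.
pose D : {set 'I_m * 'I_m} := [set (j, j) | j in S]%SET.
have swapI : injective (fun p : 'I_m * 'I_m => (p.2, p.1)).
  by move=> [a b] [c e] [-> ->].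
have eqLG : #|L| = #|G|.
  rewrite -(card_imset _ swapI); apply: eq_card => -[a b]; rewrite !inE /=.
  apply/imsetP/and3P => [[[c e]]|[aS bS ab]].
    by rewrite inE /= => /and3P[? ? ?] [-> ->].
  by exists (b, a); rewrite // inE /= aS bS.
have cardD : #|D| = #|S| by rewrite card_imset // => a b [].
have : #|finset.setX S S| = (#|L| + #|G| + #|D|)%N.
  rewrite -[LHS](cardsID L) -(cardsID G (finset.setX S S :\: L)) addnA.
  congr (_ + _ + _)%N; apply: eq_card => -[a b]; rewrite !inE /=.
  - by case: (a \in S); case: (b \in S).
  - by case: (a \in S); case: (b \in S) => //=; case: ltngtP.
  - apply/idP/imsetP => [|[c cS [-> ->]]]; last by rewrite cS ltnn.
    case: (boolP (a \in S)) => aS; case: (boolP (b \in S)) => bS //=.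
    by case: ltngtP => // /val_inj <-; exists a.
rewrite cardsX -eqLG cardD addnn => e.
have -> : odd (#|S| * #|S|.-1) = false.
  by case: #|S| => //= k; rewrite oddM /= andNb.
by rewrite subn0 -subn1 mulnBr muln1 e addnK.
Qed.

Lemma cl_transpM x y : cl_transp (x * y) = cl_transp y * cl_transp x.
Proof.
apply/ffunP => U; rewrite !ffunE mulr_sumr (reindex_inj (can_inj (symdiffK U))) /=.
apply: eq_bigr => S _; rewrite !ffunE.
rewrite [symdiff U S]symdiffC; set T := symdiff S U.
have -> : symdiff T U = S by rewrite /T -symdiffA symdiffss symdiffs0.
have signE (V : {set 'I_m}) : (-1) ^+ 'C(#|V|, 2) = \prod_(p : 'I_m * 'I_m | (p.2 < p.1)%N)
    (-1) ^+ ((p.1 \in V) && (p.2 \in V)) :> A.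
  rewrite -card_inversions -prodr_const big_mkcond [RHS]big_mkcond.
  apply: eq_bigr => p _ /=; rewrite inE.
  by case: (p.1 \in V); case: (p.2 \in V); case: ifP.
have key : (-1) ^+ 'C(#|U|, 2) * cl_coef T S =
    (-1) ^+ 'C(#|S|, 2) * (-1) ^+ 'C(#|T|, 2) * cl_coef S T.
  have -> : U = symdiff S T by rewrite symdiffK.
  clearbody T; rewrite !signE !cl_coefE !mulrA -!big_split /=; congr (_ * _).
  - apply: eq_bigr => p _; rewrite !inE.
    case: (p.1 \in S); case: (p.1 \in T); case: (p.2 \in S); case: (p.2 \in T);
    by rewrite /= ?expr0 ?expr1 ?(mulr1, mul1r, mulrNN).
  - by apply: eq_bigr => j _; rewrite andbC.
have comm (k1 k2 k3 a b : A) : k2 * k3 * k1 * (a * b) = k1 * ((k2 * b) * (k3 * a)).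
  by ring.
by rewrite mulrA key; exact: comm.
Qed.

Lemma cl_transp_gen j : cl_transp (cl_gen j) = cl_gen j.
Proof.
apply/ffunP => U; rewrite !ffunE; case: eqP => [->|_]; last by rewrite mulr0.
by rewrite cards1 bin_small // mul1r.
Qed.

(** The Clifford vector [x_0 + x_1 e_1 + ... + x_m e_m].                      *)
Definition cl_vec (x : 'cV[A]_m.+1) : clifford q :=
  (x 0 0)%:A + \sum_(j < m) x (lift ord0 j) 0 *: cl_gen j.

Definition is_cl_scalar x : Prop := exists r : A, x = r%:A.
Definition is_cl_vec x : Prop := exists v, x = cl_vec v.

Definition SL2 : set 'M[clifford q]_2 := [set g |
  let a := g 0 0 in let b := g 0 1 in let c := g 1 0 in let d := g 1 1 in
  [/\ [/\ a * cl_transp d - b * cl_transp c = 1,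
          a * cl_transp b = b * cl_transp a
        & c * cl_transp d = d * cl_transp c],
      [/\ is_cl_scalar (a * cl_conj a), is_cl_scalar (b * cl_conj b),
          is_cl_scalar (c * cl_conj c) & is_cl_scalar (d * cl_conj d)],
      is_cl_vec (a * cl_conj c) /\ is_cl_vec (b * cl_conj d)
    & forall x, is_cl_vec x ->
      [/\ is_cl_scalar (a * x * cl_conj b + b * cl_conj x * cl_conj a),
          is_cl_scalar (c * x * cl_conj d + d * cl_conj x * cl_conj c)
        & is_cl_vec (a * x * cl_conj d + b * cl_conj x * cl_conj c)]]].

End Clifford.

(** The real Clifford algebra R[i_1, ..., i_m], i.e. C_{m+1}.                 *)
Notation real_clifford R m := (clifford (fun _ : 'I_m => 1%R : Real.sort R)).

(** The embedding C_{m+1} -> C_{m+2}, [i_j |-> i_j].                          *)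
Definition cl_widen (R : realType) (m : nat) (x : real_clifford R m) :
    real_clifford R m.+1 :=
  [ffun S : {set 'I_m.+1} =>
     if ord_max \in S then 0
     else x [set j | widen_ord (leqnSn m) j \in S]%SET].

Section Order.
Variables (R : realType) (m : nat) (d : 'I_m -> nat).

(** The ring embedding sending the [j]-th generator to [sqrt d_j i_j].        *)
Definition order_incl (x : clifford (fun j => (d j)%:Z)) : real_clifford R m :=
  [ffun S : {set 'I_m} => (x S)%:~R * \prod_(j in S) Num.sqrt (d j)%:R].

Lemma order_incl_gen j :
  order_incl (cl_gen _ j) = Num.sqrt (d j)%:R *: cl_gen _ j.
Proof.
apply/ffunP => S; rewrite !ffunE; case: eqP => [->|_]; last by rewrite mul0r scaler0.
by rewrite big_set1 mul1r [RHS]mulr1.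
Qed.

Lemma order_inclD x y : order_incl (x + y) = order_incl x + order_incl y.
Proof. by apply/ffunP => S; rewrite !ffunE rmorphD mulrDl. Qed.

Lemma order_incl1 : order_incl 1 = 1.
Proof.
apply/ffunP => S; rewrite !ffunE; case: eqP => [->|_]; last by rewrite mul0r.
by rewrite big_set0 mul1r.
Qed.

Lemma order_inclM x y : order_incl (x * y) = order_incl x * order_incl y.
Proof.
apply/ffunP => U; rewrite !ffunE rmorph_sum mulr_suml; apply: eq_bigr => S _ /=.
set T := symdiff S U; have -> : U = symdiff S T by rewrite symdiffK.
clearbody T; rewrite !ffunE intrM [X in _ * X * _]intrM.
pose r (V : {set 'I_m}) : R := \prod_j (if j \in V then Num.sqrt (d j)%:R else 1).
have rE (V : {set 'I_m}) : \prod_(j in V) Num.sqrt (d j)%:R = r V by rewrite big_mkcond.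
rewrite !rE.
have key : (cl_coef (fun j => (d j)%:Z) S T)%:~R * r (symdiff S T) =
    cl_coef (fun=> 1) S T * (r S * r T).
  rewrite !cl_coefE rmorphM !rmorph_prod /= -!mulrA -!big_split /=; congr (_ * _).
    by apply: eq_bigr => p _; rewrite rmorphXn /= rmorphN1.
  apply: eq_bigr => j _; rewrite !inE.
  case: (j \in S); case: (j \in T); rewrite /= ?mulr1 ?mul1r //.
  by rewrite rmorphN /= -expr2 sqr_sqrtr ?ler0n // mulN1r.
have perm (k k' rS rT rU a b : R) : k * rU = k' * (rS * rT) ->
    k * (a * b) * rU = k' * (a * rS * (b * rT)).
  by move=> e; rewrite mulrAC e; ring.
exact: (perm _ _ _ _ _ _ _ key).
Qed.

Lemma order_incl_inj : (forall j, (0 < d j)%N) -> injective order_incl.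
Proof.
move=> d_gt0 x y /ffunP exy; apply/ffunP => S; apply: (@intr_inj R).
have := exy S; rewrite !ffunE; apply: mulIf; apply/prodf_neq0 => j _.
by rewrite gt_eqF // sqrtr_gt0 ltr0n.
Qed.

End Order.

(** [k]-times continuously differentiable, resp. smooth, on the open set [D]. *)
Section Smooth.
Variables (R : realType) (V W : normedModType R).

Fixpoint class_C (k : nat) (D : set V) (f : V -> W) : Prop :=
  if k is k'.+1 then
    (forall x, D x -> differentiable f x) /\
    (forall v, class_C k' D (fun x => 'D_v f x))
  else forall x, D x -> {for x, continuous f}.

Definition smooth_on (D : set V) (f : V -> W) : Prop := forall k, class_C k D f.

End Smooth.

(** * Hyperbolic space *)

Section Hyperbolic.
Variables (R : realType) (n : nat).

(** The upper half-space: [x = (x_0, ..., x_n)] with [x_n > 0].               *)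
Definition upper_half : set 'cV[R]_n.+1 := [set x | 0 < x ord_max 0].

Definition sq_norm k (x : 'cV[R]_k) : R := \sum_i x i 0 ^+ 2.

(** The Riemannian metric (as a quadratic form on tangent vectors).           *)
Definition hyp_metric (x v : 'cV[R]_n.+1) : R := sq_norm v / x ord_max 0 ^+ 2.

Definition jacobian_mx (f : 'cV[R]_n.+1 -> 'cV[R]_n.+1) (x : 'cV[R]_n.+1) :
    'M[R]_n.+1 :=
  \matrix_(i, j) 'D_(delta_mx j 0) f x i 0.

Definition orientation_preserving_isometry
    (f : 'cV[R]_n.+1 -> 'cV[R]_n.+1) : Prop :=
  [/\ set_bij upper_half upper_half f,
      smooth_on upper_half f,
      forall x v, upper_half x -> hyp_metric (f x) ('D_v f x) = hyp_metric x v
    & forall x, upper_half x -> 0 < \det (jacobian_mx f x)].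

End Hyperbolic.

(** The standard form of signature (1, k) on R^{k+1}.                         *)
Definition lorentz (R : realType) (k : nat) (v : 'cV[R]_k.+1) : R :=
  v 0 0 ^+ 2 - \sum_(i < k) v (lift ord0 i) 0 ^+ 2.

(** The standard isometry of the upper half-space onto the hyperboloid
  [v_0^2 - v_1^2 - ... - v_{n+1}^2 = 1, v_0 > 0].                             *)
Definition to_hyperboloid (R : realType) (n : nat) (x : 'cV[R]_n.+1) :
    'cV[R]_n.+2 :=
  let t := x ord_max 0 in
  col_mx (const_mx ((sq_norm x + 1) / (2 * t)) : 'cV_1)
    (col_mx (const_mx ((sq_norm x - 1) / (2 * t)) : 'cV_1)
       (\col_(i < n) (x (widen_ord (leqnSn n) i) 0 / t))).

Section HyperboloidIsometry.
Variables (R : realType) (n : nat).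
Implicit Types x v : 'cV[R]_n.+1.

Fact to_hyperboloid0 x : to_hyperboloid x 0 0 = (sq_norm x + 1) / (2 * x ord_max 0).
Proof.
rewrite /to_hyperboloid (_ : 0 = lshift n.+1 (0 : 'I_1)); last exact: ord_inj.
by rewrite mxE (unsplitK (inl _)) mxE.
Qed.

Fact to_hyperboloid1 x :
  to_hyperboloid x (lift ord0 ord0) 0 = (sq_norm x - 1) / (2 * x ord_max 0).
Proof.
rewrite /to_hyperboloid (_ : lift ord0 ord0 = rshift 1 (lshift n (0 : 'I_1))).
  by rewrite mxE (unsplitK (inr _)) mxE (unsplitK (inl _)) mxE.
exact: ord_inj.
Qed.

Fact to_hyperboloid2 x i : to_hyperboloid x (lift ord0 (lift ord0 i)) 0 =
  x (widen_ord (leqnSn n) i) 0 / x ord_max 0.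
Proof.
rewrite /to_hyperboloid (_ : lift ord0 (lift ord0 i) = rshift 1 (rshift 1 i)).
  by rewrite mxE (unsplitK (inr _)) mxE (unsplitK (inr _)) mxE.
exact: ord_inj.
Qed.

Fact lorentzE (w : 'cV[R]_n.+2) : lorentz w = w 0 0 ^+ 2 -
  (w (lift ord0 ord0) 0 ^+ 2 + \sum_(i < n) w (lift ord0 (lift ord0 i)) 0 ^+ 2).
Proof. by rewrite /lorentz big_ord_recl. Qed.

Fact sq_normE x : sq_norm x =
  \sum_(i < n) x (widen_ord (leqnSn n) i) 0 ^+ 2 + x ord_max 0 ^+ 2.
Proof. by rewrite /sq_norm big_ord_recr. Qed.

Lemma to_hyperboloid_bij : set_bij (@upper_half R n)
  [set w : 'cV[R]_n.+2 | lorentz w = 1 /\ 0 < w 0 0] (@to_hyperboloid R n).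
Proof.
split.
- move=> x /= t_gt0; have t_neq0 := lt0r_neq0 t_gt0; split.
    rewrite lorentzE to_hyperboloid0 to_hyperboloid1.
    under eq_bigr do rewrite to_hyperboloid2 expr_div_n.
    by rewrite -mulr_suml sq_normE; move: (\sum_(i < n) _) => S; field.
  rewrite to_hyperboloid0 divr_gt0 ?mulr_gt0 // ltr_wpDl // sumr_ge0 // => i _.
  exact: sqr_ge0.
- move=> x y /set_mem /= x_gt0 /set_mem /= y_gt0 exy.
  have tx := lt0r_neq0 x_gt0; have ty := lt0r_neq0 y_gt0.
  have et : x ord_max 0 = y ord_max 0.
    have e0 : to_hyperboloid x 0 0 = to_hyperboloid y 0 0 by rewrite exy.
    have e1 : to_hyperboloid x (lift ord0 ord0) 0 =
              to_hyperboloid y (lift ord0 ord0) 0 by rewrite exy.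
    rewrite !to_hyperboloid0 in e0; rewrite !to_hyperboloid1 in e1.
    apply: invr_inj.
    transitivity ((sq_norm x + 1) / (2 * x ord_max 0) -
                  (sq_norm x - 1) / (2 * x ord_max 0)); first by field.
    by rewrite e0 e1; field.
  apply/matrixP => i j; rewrite (ord1 j); case: (unliftP ord_max i) => [k|] -> //.
  have -> : lift ord_max k = widen_ord (leqnSn n) k.
    by apply: ord_inj; rewrite /= /bump leqNgt ltn_ord.
  have : to_hyperboloid x (lift ord0 (lift ord0 k)) 0 =
         to_hyperboloid y (lift ord0 (lift ord0 k)) 0 by rewrite exy.
  by rewrite !to_hyperboloid2 et; apply: mulIf; rewrite invr_neq0.
- move=> w /= []; rewrite lorentzE.
  set S := \sum_(i < n) _; set a := w 0 0; set b := w (lift ord0 ord0) 0 => eJ a_gt0.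
  have S_ge0 : 0 <= S by apply: sumr_ge0 => i _; exact: sqr_ge0.
  have ab_gt0 : 0 < a - b.
    rewrite subr_gt0 ltNge; apply/negP => ab.
    have : a ^+ 2 <= b ^+ 2 by rewrite lerXn2r ?nnegrE ?(le_trans (ltW a_gt0)) // ltW.
    by move: eJ S_ge0; lra.
  have ab_neq0 := lt0r_neq0 ab_gt0.
  pose x : 'cV[R]_n.+1 := \col_i
    (if unlift ord_max i is Some k then w (lift ord0 (lift ord0 k)) 0 / (a - b)
     else (a - b)^-1).
  have xt : x ord_max 0 = (a - b)^-1 by rewrite mxE unlift_none.
  have xk k : x (widen_ord (leqnSn n) k) 0 = w (lift ord0 (lift ord0 k)) 0 / (a - b).
    rewrite mxE (_ : widen_ord _ k = lift ord_max k) ?liftK //.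
    by apply: ord_inj; rewrite /= /bump leqNgt ltn_ord.
  have xS : sq_norm x = (S + 1) / (a - b) ^+ 2.
    rewrite sq_normE xt; under eq_bigr do rewrite xk expr_div_n.
    by rewrite -mulr_suml -/S; field.
  have SE : S = a ^+ 2 - b ^+ 2 - 1 by move: eJ; lra.
  exists x; first by change (0 < x ord_max 0); rewrite xt invr_gt0.
  apply/matrixP => i j; rewrite (ord1 j).
  case: (unliftP ord0 i) => [k|] ->; last first.
    by rewrite to_hyperboloid0 xS xt SE -/a; field.
  case: (unliftP ord0 k) => [l|] ->; last first.
    by rewrite to_hyperboloid1 xS xt SE -/b; field.
  by rewrite to_hyperboloid2 xk xt invrK divfK.
Qed.

(** [to_hyperboloid] pulls the (negated) Lorentz form back to [hyp_metric].   *)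
Lemma to_hyperboloid_isometry x v : upper_half x ->
  - lorentz ('D_v (@to_hyperboloid R n) x) = hyp_metric x v.
Proof.
move=> /= t_gt0; have t_neq0 := lt0r_neq0 t_gt0.
set t := x ord_max 0 in t_gt0 t_neq0 *; set dt := v ord_max 0.
pose P := \sum_(i < n) x (widen_ord (leqnSn n) i) 0 * v (widen_ord (leqnSn n) i) 0.
pose p := P + t * dt.
have dcoord i : is_derive x v (fun y : 'cV[R]_n.+1 => y i 0) (v i 0).
  have did : derivable (@id 'cV[R]_n.+1) x v by exact: derivable_id.
  apply: DeriveDef; first exact: (derivable_mxP _ _ _).1 did i 0.
  by have := derive_mx did; rewrite derive_id => /matrixP/(_ i 0); rewrite mxE.
have dV : is_derive x v (fun y : 'cV[R]_n.+1 => (y ord_max 0)^-1) (- dt / t ^+ 2).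
  apply: DeriveDef; first by apply: derivableV => //; exact: ex_derive.
  by rewrite deriveV // derive_val /GRing.scale /= -/t -/dt; field.
have dN : is_derive x v (@sq_norm R n.+1) (2 * p).
  rewrite (_ : @sq_norm R n.+1 =
    \sum_(i < n.+1) (fun y : 'cV[R]_n.+1 => y i 0) ^+ 2); last first.
    by apply/funext => y; rewrite /sq_norm fct_sumE; apply: eq_bigr.
  apply: is_derive_eq; rewrite big_ord_recr /= mulrDr mulr_sumr.
  by congr (_ + _); [apply: eq_bigr => i _|]; rewrite expr1 mulrA.
have dh i : is_derive x v (fun y : 'cV[R]_n.+1 => to_hyperboloid y i 0)
    (match unlift ord0 i with
     | None => p / t - (sq_norm x + 1) * dt / (2 * t ^+ 2)
     | Some k => match unlift ord0 k with
        | None => p / t - (sq_norm x - 1) * dt / (2 * t ^+ 2)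
        | Some l => v (widen_ord (leqnSn n) l) 0 / t
                    - x (widen_ord (leqnSn n) l) 0 * dt / t ^+ 2
        end
     end).
  have dhalf (c : R) : is_derive x v
      (fun y : 'cV[R]_n.+1 => (sq_norm y + c) / (2 * y ord_max 0))
      (p / t - (sq_norm x + c) * dt / (2 * t ^+ 2)).
    rewrite (_ : (fun y => _) = (2^-1 : R) \*: ((@sq_norm R n.+1 + cst c) *
      (fun y : 'cV[R]_n.+1 => (y ord_max 0)^-1))); last first.
      apply/funext => y; rewrite invfM mulrCA; reflexivity.
    apply: is_derive_eq; rewrite /GRing.scale /= /cst /= addr0 -/t.
    by rewrite (_ : (@sq_norm R n.+1 + _) x = sq_norm x + c) //; field.
  case: unliftP => [k|] ->; last first.
    by under eq_fun do rewrite to_hyperboloid0.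
  case: unliftP => [l|] ->; last first.
    by under eq_fun do rewrite to_hyperboloid1.
  under eq_fun do rewrite to_hyperboloid2.
  rewrite (_ : (fun y => _) = (fun y : 'cV[R]_n.+1 => y (widen_ord (leqnSn n) l) 0) *
      (fun y : 'cV[R]_n.+1 => (y ord_max 0)^-1)) //.
  by apply: is_derive_eq; rewrite /GRing.scale /= -/t; field.
have dM : derivable (@to_hyperboloid R n) x v.
  by apply/derivable_mxP => i j; rewrite (ord1 j); exact: ex_derive.
have DE i : ('D_v (@to_hyperboloid R n) x) i 0 =
    'D_v (fun y : 'cV[R]_n.+1 => to_hyperboloid y i 0) x.
  by rewrite derive_mx // mxE.
rewrite lorentzE !DE !derive_val unlift_none liftK unlift_none.
under eq_bigr do rewrite DE derive_val !liftK.
set sx := sq_norm x; have sxE := sq_normE x.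
rewrite /hyp_metric (sq_normE v) -/t -/dt.
pose X := \sum_(i < n) x (widen_ord (leqnSn n) i) 0 ^+ 2.
pose V := \sum_(i < n) v (widen_ord (leqnSn n) i) 0 ^+ 2.
have -> : \sum_(i < n) (v (widen_ord (leqnSn n) i) 0 / t -
    x (widen_ord (leqnSn n) i) 0 * dt / t ^+ 2) ^+ 2 =
    V / t ^+ 2 - 2 * P * dt / t ^+ 3 + X * dt ^+ 2 / t ^+ 4.
  rewrite /V /P /X mulr_sumr !mulr_suml -sumrB -big_split /=.
  by apply: eq_bigr => i _; field.
rewrite -/V /sx sxE -/X -/t /p; field.
exact: t_neq0.
Qed.
End HyperboloidIsometry.

(** * The orthogonal group of a quadratic form *)

Section Orthogonal.
Variables (R : realType) (k : nat) (F : 'cV[R]_k -> R).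

Definition orthogonal_set : set 'M[R]_k :=
  [set A | A \in unitmx /\ forall v, F (A *m v) = F v].

Definition orthogonal_group : Type := set_type orthogonal_set.

HB.instance Definition _ := Topological.on orthogonal_group.
HB.instance Definition _ := SubType.on orthogonal_group.

Fact orthogonal_subproof1 : 1%:M \in orthogonal_set.
Proof. by apply/mem_set; split=> [|v]; rewrite ?unitmx1 ?mul1mx. Qed.

Fact orthogonal_subproofM (A B : orthogonal_group) :
  \val A *m \val B \in orthogonal_set.
Proof.
case: A B => [A /= /set_mem[uA FA]] [B /= /set_mem[uB FB]].
by apply/mem_set; split=> [|v]; rewrite ?unitmx_mul ?uA // -mulmxA FA FB.
Qed.

Fact orthogonal_subproofV (A : orthogonal_group) : invmx (\val A) \in orthogonal_set.
Proof.
case: A => [A /= /set_mem[uA FA]].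
by apply/mem_set; split=> [|v]; rewrite ?unitmx_inv // -FA mulKVmx.
Qed.

Definition orthogonal1 : orthogonal_group :=
  exist (fun M => M \in orthogonal_set) _ orthogonal_subproof1.
Definition orthogonalM A B : orthogonal_group :=
  exist (fun M => M \in orthogonal_set) _ (orthogonal_subproofM A B).
Definition orthogonalV A : orthogonal_group :=
  exist (fun M => M \in orthogonal_set) _ (orthogonal_subproofV A).

Fact orthogonalA : associative orthogonalM.
Proof. by move=> A B C; apply/val_inj/mulmxA. Qed.

Fact orthogonal1x : left_id orthogonal1 orthogonalM.
Proof. by move=> A; apply/val_inj/mul1mx. Qed.

Fact orthogonalx1 : right_id orthogonal1 orthogonalM.
Proof. by move=> A; apply/val_inj/mulmx1. Qed.

Fact orthogonalVx : left_inverse orthogonal1 orthogonalV orthogonalM.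
Proof. by move=> A; apply/val_inj/mulVmx; have /set_mem[] := valP A. Qed.

Fact orthogonalxV : right_inverse orthogonal1 orthogonalV orthogonalM.
Proof. by move=> A; apply/val_inj/mulmxV; have /set_mem[] := valP A. Qed.

HB.instance Definition _ := isGroup.Build orthogonal_group
  orthogonalA orthogonal1x orthogonalx1 orthogonalVx orthogonalxV.

End Orthogonal.

(** * Lie groups *)

(** Only the operations; their continuity is part of [is_lie_group].          *)
#[short(type="topGroupType")]
HB.structure Definition TopGroup := {G of Topological G & Group G}.

HB.instance Definition _ (R : realType) (k : nat) (F : 'cV[R]_k -> R) :=
  Group.on (orthogonal_group F).

Definition identity_component (G : topGroupType) : set G :=
  connected_component setT 1%g.

Definition is_subgroup (G : groupType) (N : set G) : Prop :=
  [/\ N 1%g, forall x y, N x -> N y -> N (x * y)%g & forall x, N x -> N (x^-1)%g].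

Definition is_normal_subgroup (G : groupType) (N : set G) : Prop :=
  is_subgroup N /\ forall x y, N x -> N (x ^ y)%g.

Section Lie.
Variable R : realType.

Record chart (G : topologicalType) (r : nat) := Chart {
  chart_dom : set G;
  chart_map : G -> 'rV[R]_r;
  chart_inv : 'rV[R]_r -> G;
  chart_dom_open : open chart_dom;
  chart_img_open : open (chart_map @` chart_dom);
  chart_mapK : forall x, chart_dom x -> chart_inv (chart_map x) = x;
  chart_map_cont : {within chart_dom, continuous chart_map};
  chart_inv_cont : {within chart_map @` chart_dom, continuous chart_inv}
}.

Definition smooth_atlas (G : topologicalType) r (At : set (chart G r)) : Prop :=
  (forall x, exists2 c, At c & chart_dom c x) /\
  (forall a b, At a -> At b ->
    smooth_on (chart_map a @` (chart_dom a `&` chart_dom b))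
      (chart_map b \o chart_inv a)).

(** A topological group carrying a smooth structure for which the operations
  are smooth.  Such a structure is unique and continuous homomorphisms are
  smooth for it, so that "isomorphism of Lie groups" below means isomorphism of
  topological groups.                                                         *)
Definition is_lie_group (G : topGroupType) : Prop :=
  [/\ hausdorff_space G, @second_countable G,
      continuous (fun p : G * G => (p.1 * p.2)%g),
      continuous (fun x : G => (x^-1)%g)
    & exists r (At : set (chart G r)),
      [/\ smooth_atlas At,
          forall a b c, At a -> At b -> At c ->
            let mul u := (chart_inv a (lsubmx u) * chart_inv b (rsubmx u))%g in
            smooth_on [set u : 'rV[R]_(r + r) |
                (chart_map a @` chart_dom a) (lsubmx u) /\
                (chart_map b @` chart_dom b) (rsubmx u) /\
                chart_dom c (mul u)]
              (chart_map c \o mul)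
        & forall a b, At a -> At b ->
            smooth_on (chart_map a @` (chart_dom a `&`
                [set x | chart_dom b (x^-1)%g]))
              (fun u => chart_map b ((chart_inv a u)^-1)%g)]].

Definition is_semisimple_lie_group (G : topGroupType) : Prop :=
  is_lie_group G /\
  forall N : set G, is_normal_subgroup N -> closed N -> connected N ->
    (forall x y, N x -> N y -> (x * y = y * x)%g) -> N = [set 1%g].

(** [f] is an isomorphism of topological groups of [G] onto the subset [S] of
  [X], with the multiplication [mul] and the subspace topology.               *)
Definition lie_iso_onto (G : topGroupType) (X : topologicalType)
    (mul : X -> X -> X) (f : G -> X) (S : set X) : Prop :=
  [/\ {morph f : x y / (x * y)%g >-> mul x y},
      range f = S,
      continuous f
    & exists2 f' : X -> G, cancel f f' & {within S, continuous f'}].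

(** * Arithmetic subgroups *)

Definition finite_index (G : groupType) (N H : set G) : Prop :=
  exists s : seq G, forall x, H x -> exists2 y, y \in s & N (y^-1 * x)%g.

Definition commensurable (G : groupType) (H K : set G) : Prop :=
  finite_index (H `&` K) H /\ finite_index (H `&` K) K.

(** The [A]-points of the closed subscheme of [SL_k] over Z cut out by the
  polynomials [I] in the matrix entries.                                      *)
Definition scheme_points k (I : set (mpoly.mpoly (k * k) int))
    (A : comNzRingType) : set 'M[A]_k :=
  [set g | \det g = 1 /\ forall p, I p ->
     mpoly.meval (fun l => mxvec g 0 l)
       (mpoly.map_mpoly (fun z : int => z%:~R : A) p) = 0].

(** A closed subscheme of [SL_k] is a subgroup scheme when its points in every
  commutative ring form a group.                                              *)
Definition is_subgroup_scheme k (I : set (mpoly.mpoly (k * k) int)) : Prop :=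
  forall A : comNzRingType,
    [/\ scheme_points I (1%:M : 'M[A]_k),
        forall g h : 'M[A]_k, scheme_points I g -> scheme_points I h ->
          scheme_points I (g *m h)
      & forall g : 'M[A]_k, scheme_points I g ->
          exists2 h, scheme_points I h & g *m h = 1%:M].

(** In the last clause [p] exhibits [G] as the quotient group [G' / K]: it
  induces an isomorphism [G' / K -> G] mapping the image of [Gam'] to [Gam].  *)
Inductive arithmetic_subgroup : forall G : topGroupType, set G -> Prop :=
| arithmetic_Zpoints (G : topGroupType) (Gam : set G) k
    (I : set (mpoly.mpoly (k * k) int)) (f : G -> 'M[R]_k) :
    is_semisimple_lie_group G ->
    is_subgroup_scheme I ->
    lie_iso_onto (X := 'M[R]_k) mulmx f (scheme_points I (A := R)) ->
    f @` Gam = map_mx intr @` scheme_points I (A := int) ->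
    arithmetic_subgroup Gam
| arithmetic_commensurable (G : topGroupType) (Gam Gam' : set G) :
    is_subgroup Gam ->
    arithmetic_subgroup Gam' ->
    commensurable Gam Gam' ->
    arithmetic_subgroup Gam
| arithmetic_component (G G' : topGroupType) (Gam : set G) (Gam' : set G')
    (f : G -> G') :
    is_semisimple_lie_group G ->
    arithmetic_subgroup Gam' ->
    lie_iso_onto (fun x y => x * y)%g f (@identity_component G') ->
    f @` Gam = Gam' `&` @identity_component G' ->
    arithmetic_subgroup Gam
| arithmetic_compact_quotient (G G' : topGroupType) (Gam : set G)
    (Gam' K : set G') (p : G' -> G) :
    is_semisimple_lie_group G ->
    arithmetic_subgroup Gam' ->
    is_normal_subgroup K -> compact K ->
    {morph p : x y / (x * y)%g} -> range p = setT -> p @^-1` [set 1%g] = K ->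
    continuous p -> (forall U, open U -> open (p @` U)) ->
    p @` Gam' = Gam ->
    arithmetic_subgroup Gam.

End Lie.

(** * The isomorphism PSL_2(C_n) -> O_{1,n+1}(R)^o, with n = m + 1 *)

Section Moebius.
Variables (R : realType) (m : nat).

Implicit Types (g h : 'M[real_clifford R m]_2) (x y : 'cV[R]_m.+2).

(** [y = (a x + b) (c x + d)^-1] in C_{n+1}.                                  *)
Definition moebius g x y : Prop :=
  let X : real_clifford R m.+1 := cl_vec _ x in
  let Y : real_clifford R m.+1 := cl_vec _ y in
  let num := cl_widen (g 0 0) * X + cl_widen (g 0 1) in
  let den := cl_widen (g 1 0) * X + cl_widen (g 1 1) in
  exists w, [/\ den * w = 1, w * den = 1 & Y = num * w].

(** A map on [SL_2(C_n)] that factors through an isomorphism of [PSL_2(C_n)]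
  onto O_{1,n+1}(R)^o; the image of [g] is the Lorentz transformation
  corresponding to the Moebius transformation of [g] under [to_hyperboloid].  *)
Definition is_moebius_iso
    (phi : 'M[real_clifford R m]_2 -> orthogonal_group (@lorentz R m.+2)) :
    Prop :=
  [/\ forall g h, SL2 g -> SL2 h -> phi (g *m h) = (phi g * phi h)%g,
      forall g h, SL2 g -> SL2 h -> (phi g = phi h <-> g = h \/ g = - h),
      phi @` [set g | SL2 g] =
        @identity_component (orthogonal_group (@lorentz R m.+2))
    & forall g, SL2 g -> exists f,
      [/\ orientation_preserving_isometry f,
          forall x, upper_half x -> moebius g x (f x)
        & forall x, upper_half x ->
            \val (phi g) *m to_hyperboloid x = to_hyperboloid (f x)]].

(** [x^2 - y z + \sum_j d_j x_j^2] in the coordinates [(x, y, z, x_1, ..., x_m)]. *)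
Definition form_Q (d : 'I_m -> nat) (v : 'cV[R]_(3 + m)) : R :=
  v 0 0 ^+ 2 - v 1 0 * v (inord 2) 0
  + \sum_(j < m) (d j)%:R * v (rshift 3 j) 0 ^+ 2.

End Moebius.

(* Main.v *)
Require Import Defs.
From HB Require Import structures.
From mathcomp Require Import all_boot all_order all_algebra.
From mathcomp Require Import all_classical all_reals all_analysis.
From mathcomp Require mpoly.
From mathcomp Require Import ring lra zify.

Set Implicit Arguments.
Unset Strict Implicit.
Unset Printing Implicit Defensive.
Import Order.TTheory GRing.Theory Num.Theory.
Import numFieldNormedType.Exports.
Local Open Scope classical_set_scope.
Local Open Scope ring_scope.

(** The form [Q] is minus the determinant form of the Hermitian matrices
  [[y, x], [x^bar, z]] over the Clifford algebra ([x] a Clifford vector), and a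
  Clifford matrix [g] acts on them by [H |-> g H g^bar^T]; through the
  hyperboloid model this is the Moebius action.  Elements of [SL_2(O)] preserve
  the lattice of integral Hermitian matrices, so that their image lies in a
  conjugate of the arithmetic group O_Q(Z), and only the finiteness of the index
  is at stake.  As O_Q(R) is generated by reflections, its identity component
  has finite index, so let [g] be a real Clifford matrix preserving the lattice.
  If [w] is the matrix [[0, 1], [-1, 0]], then [g^bar^T w = w (g^#)'] with
  [g^# = g^-1], and the matrices [H w] generate M_2(O) up to the parity twist;
  hence [g X g^#] is integral for all integral [X].  The set of [y] such that
  [y X g^#] is integral for all [X] is a bimodule containing [g], and projecting
  on basis elements by [c |-> d_j c - e_j c' e_j] shows that the products of two
  coordinates of [g] have a denominator dividing a constant [D].  So
  [g = N^(-1/2) U] with [U] integral primitive and [N <= D], and two such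
  matrices with the same [N] and congruent [U] mod [N] differ by an element of
  [SL_2(O)]. *)

(** * Smooth maps *)

(** The lattice stabilizer can exceed the image of SL_2(O) even within the identity component: for
    one generator with d = 1, the matrix 2^(-1/2) diag(1 + i, 1 - i) preserves the integral
    Hermitian matrices. Conjugation sees g only through products of two entries, so only
    denominators of such products can be bounded. The bound on N combines two computations with g =
    mu U: primitivity of U makes D mu^2 an integer, and U^# U gives N mu^2 = 1, so N divides D. The
    Clifford conditions enter through one reformulation: g g^# = 1 and g preserves Hermitian
    matrices. Arithmeticity also requires the ambient group to be a semisimple Lie group. Its charts
    are Cayley transforms; for semisimplicity, an element of an abelian normal subgroup commutes
    with its conjugates by all reflections, which forces it to be 1 or -1. As O_Q contains
    isometries of determinant -1, it is embedded in SL of one size more. *)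

Lemma near_eq_differentiable (R : realType) (V W : normedModType R) (f g : V -> W) (x : V) :
  (\forall y \near x, f y = g y) -> differentiable f x -> differentiable g x.
Proof.
move=> fg df; have dfc := diff_continuous df.
have gE : g \o shift x = cst (g x) + 'd f x +o_ 0 id.
  have /eqaddoP fE := diff_locally df; apply/eqaddoP => e e0.
  have nfg : \forall h \near 0, f (h + x) = g (h + x).
    by move: fg; rewrite (near_shift 0 x); apply: filterS => y; rewrite /= subr0.
  have fgx : f x = g x := nbhs_singleton fg.
  have fEe := fE e e0; near=> h.
  have -> : (g \o shift x - (cst (g x) + 'd f x)) h = (f \o shift x - (cst (f x) + 'd f x)) h.
    by rewrite !fctE /= fgx (near nfg h).
  by near: h; exact: fEe.
have dgE := diff_unique dfc gE.
by apply/diff_locallyP; rewrite dgE.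
Unshelve. all: by end_near. Qed.

Section ClassC.
Variables (R : realType) (V W : normedModType R).
Implicit Types (D : set V) (k : nat).

Lemma class_C_sub k D D' (f : V -> W) :
  D' `<=` D -> class_C k D f -> class_C k D' f.
Proof.
move=> sD; elim: k f => [|k IH] f /=; first by move=> cf x /sD /cf.
by move=> [df Df]; split=> [x /sD /df//|v]; apply: IH.
Qed.

Lemma class_C_succ k D (f : V -> W) : class_C k.+1 D f -> class_C k D f.
Proof.
elim: k f => [|k IH] f [df Df].
  by move=> x Dx; apply: differentiable_continuous; exact: df.
by split=> // v; apply: IH; exact: Df.
Qed.

(** Openness of [D] turns an equality on [D] into one near each of its points, which is what
    derivatives depend on. *)
Lemma class_C_congr k D (f g : V -> W) : open D ->
  (forall x, D x -> f x = g x) -> class_C k D f -> class_C k D g.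
Proof.
move=> oD; elim: k f g => [|k IH] f g fg.
  move=> cf x Dx; have cfx := cf x Dx.
  have fgx : \forall y \near x, f y = g y.
    by apply: filterS (open_nbhs_nbhs (conj oD Dx)) => y /fg.
  rewrite /prop_for /continuous_at -(fg x Dx); apply: cvg_trans cfx; apply: near_eq_cvg.
  by apply: filterS fgx => y ->.
have nfg x : D x -> \forall y \near x, f y = g y.
  by move=> Dx; apply: filterS (open_nbhs_nbhs (conj oD Dx)) => y /fg.
move=> [df Df]; split=> [x Dx|v].
  exact: near_eq_differentiable (nfg x Dx) (df x Dx).
by apply: IH (Df v) => x Dx; apply: near_eq_derive; exact: nfg.
Qed.

Lemma class_C_cst k D (c : W) : class_C k D (cst c).
Proof.
elim: k c => [|k IH] c /=; first by move=> x _; exact: cst_continuous.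
split=> [x _|v]; first exact: differentiable_cst.
rewrite (_ : (fun x => _) = cst 0); first exact: IH.
by apply/funext => x; rewrite derive_cst.
Qed.

Lemma class_C_linear k D (f : {linear V -> W}) : continuous f -> class_C k D f.
Proof.
move=> cf; case: k => [|k] /=; first by move=> x _; exact: cf.
split=> [x _|v]; first exact: linear_differentiable.
rewrite (_ : (fun x => _) = cst (f v)); first exact: class_C_cst.
by apply/funext => x; rewrite deriveE ?diff_lin //; exact: linear_differentiable.
Qed.

Lemma class_CD k D (f g : V -> W) : open D ->
  class_C k D f -> class_C k D g -> class_C k D (fun x => f x + g x).
Proof.
move=> oD; elim: k f g => [|k IH] f g /=.
  by move=> cf cg x Dx; apply: continuousD; [exact: cf|exact: cg].
move=> [df Df] [dg Dg]; split=> [x Dx|v].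
  by apply: (@differentiableD _ _ _ f g); [exact: df|exact: dg].
apply: (@class_C_congr _ _ (fun x => 'D_v f x + 'D_v g x)) => //.
  by move=> x Dx; rewrite (@deriveD _ _ _ f g) //; apply: diff_derivable; [exact: df|exact: dg].
by apply: IH.
Qed.

End ClassC.

Section ClassCScalar.
Variables (R : realType) (V : normedModType R).
Implicit Types (D : set V) (k : nat) (f g : V -> R).

Lemma class_CM k D f g : open D ->
  class_C k D f -> class_C k D g -> class_C k D (fun x => f x * g x).
Proof.
move=> oD; elim: k f g => [|k IH] f g.
  by move=> cf cg x Dx; apply: continuousM; [exact: cf|exact: cg].
move=> cf cg; move: (cf) (cg) => [df Df] [dg Dg]; split=> [x Dx|v].
  by apply: (@differentiableM _ _ f g); [exact: df|exact: dg].
apply: (@class_C_congr _ _ _ _ _ (fun x => f x * 'D_v g x + g x * 'D_v f x)) => //.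
  by move=> x Dx; rewrite (@deriveM _ _ f g) //; apply: diff_derivable; [exact: df|exact: dg].
by apply: class_CD => //; apply: IH; [exact: class_C_succ|exact: Dg|exact: class_C_succ|exact: Df].
Qed.

(** The derivative of 1/f is -(1/f)^2 times that of f; it involves 1/f only at one order less, so
    the induction closes. *)
Lemma class_CV k D f : open D -> (forall x, D x -> f x != 0) ->
  class_C k D f -> class_C k D (fun x => (f x)^-1).
Proof.
move=> oD f0; elim: k => [|k IH].
  by move=> cf x Dx; apply: continuousV; [exact: f0|exact: cf].
move=> cf; move: (cf) => [df Df]; split=> [x Dx|v].
  by apply: differentiableV; [exact: df|exact: f0].
have cV := IH (class_C_succ cf).
apply: (@class_C_congr _ _ _ _ _
  (fun x => -1 * (f x)^-1 * (f x)^-1 * 'D_v f x)) => //.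
  move=> x Dx; rewrite (@deriveV _ _ f x v) ?f0 //; last exact/diff_derivable/df.
  by rewrite /GRing.scale /= !mulN1r -exprVn expr2 !mulNr.
apply: class_CM => //; last exact: Df.
apply: class_CM => //; apply: class_CM => //; exact: class_C_cst.
Qed.

Lemma class_C_sum k D (I : Type) (r : seq I) (P : pred I) (F : I -> V -> R) :
  open D -> (forall i, P i -> class_C k D (F i)) ->
  class_C k D (fun x => \sum_(i <- r | P i) F i x).
Proof.
move=> oD cF; rewrite (_ : (fun x => _) = \sum_(i <- r | P i) F i); last first.
  by apply/funext => x; rewrite fct_sumE.
elim/big_ind: _ => [||i Pi]; [exact: class_C_cst|by move=> *; exact: class_CD|exact: cF].
Qed.

Lemma class_C_prod k D (I : Type) (r : seq I) (P : pred I) (F : I -> V -> R) :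
  open D -> (forall i, P i -> class_C k D (F i)) ->
  class_C k D (fun x => \prod_(i <- r | P i) F i x).
Proof.
move=> oD cF; rewrite (_ : (fun x => _) = \prod_(i <- r | P i) F i); last first.
  by apply/funext => x; rewrite fct_prodE.
elim/big_ind: _ => [||i Pi]; [exact: class_C_cst|by move=> *; exact: class_CM|exact: cF].
Qed.

End ClassCScalar.

Lemma continuous_mx (R : realType) (X : topologicalType) p q (F : X -> 'M[R]_(p, q)) x :
  (forall i j, {for x, continuous (fun y => F y i j : R)}) -> {for x, continuous F}.
Proof.
move=> cF A [P Pnb PA].
have : \forall y \near x, forall i j, P i j (F y i j).
  by do 2!(apply: filter_forall => ?); apply: cF.
by apply: filterS => y Py; apply: PA.
Qed.

Section SmoothMatrix.
Variables (R : realType) (V : normedModType R).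
Implicit Types (D : set V).

(** Smoothness is handled entrywise because products, determinants and inverses of matrices are
    rational in the entries; [smooth_mx_smooth] returns to maps between normed spaces. *)
Definition smooth_mx D p q (F : V -> 'M[R]_(p, q)) : Prop :=
  forall i j, smooth_on D (fun x => F x i j : R).

Lemma differentiable_mx p q (F : V -> 'M[R]_(p, q)) x :
  (forall i j, differentiable (fun y => F y i j : R) x) -> differentiable F x.
Proof.
move=> dF.
have -> : F = \sum_(i < p) \sum_(j < q) (fun y => F y i j *: delta_mx i j).
  apply/funext => y; rewrite fct_sumE [LHS]matrix_sum_delta.
  by apply: eq_bigr => i _; rewrite fct_sumE.
apply: differentiable_sum => i; apply: differentiable_sum => j.
exact: differentiableZl.
Qed.

Lemma smooth_mx_smooth D p q (F : V -> 'M[R]_(p, q)) : open D ->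
  smooth_mx D F -> smooth_on D F.
Proof.
move=> oD cF k; have {}cF i j := cF i j k.
elim: k F cF => [|k IH] F cF.
  by move=> x Dx; apply: continuous_mx => i j; exact: cF.
have dF x : D x -> differentiable F x.
  by move=> Dx; apply: differentiable_mx => i j; exact: (cF i j).1.
split=> // v; apply: IH => i j.
apply: class_C_congr ((cF i j).2 v) => // x Dx.
by rewrite derive_mx ?mxE //; apply: diff_derivable; exact: dF.
Qed.

Lemma smooth_mx_congr D p q (F G : V -> 'M[R]_(p, q)) : open D ->
  (forall x, D x -> F x = G x) -> smooth_mx D F -> smooth_mx D G.
Proof.
by move=> oD FG cF i j k; apply: class_C_congr (cF i j k) => // x /FG ->.
Qed.

Lemma smooth_mx_sub D D' p q (F : V -> 'M[R]_(p, q)) :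
  D' `<=` D -> smooth_mx D F -> smooth_mx D' F.
Proof. by move=> sD cF i j k; apply: class_C_sub (cF i j k). Qed.

Lemma smooth_mx_cst D p q (A : 'M[R]_(p, q)) : smooth_mx D (cst A).
Proof. by move=> i j k; exact: class_C_cst. Qed.

Lemma smooth_mxD D p q (F G : V -> 'M[R]_(p, q)) : open D ->
  smooth_mx D F -> smooth_mx D G -> smooth_mx D (fun x => F x + G x).
Proof.
move=> oD cF cG i j k.
rewrite (_ : (fun x => _) = (fun x => F x i j + G x i j)).
  by apply: class_CD; [|exact: cF|exact: cG].
by apply/funext => x; rewrite mxE.
Qed.

Lemma smooth_mxM D p q r (F : V -> 'M[R]_(p, q)) (G : V -> 'M[R]_(q, r)) : open D ->
  smooth_mx D F -> smooth_mx D G -> smooth_mx D (fun x => F x *m G x).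
Proof.
move=> oD cF cG i j k.
rewrite (_ : (fun x => _) = (fun x => \sum_l F x i l * G x l j)).
  by apply: class_C_sum => // l _; apply: class_CM; [|exact: cF|exact: cG].
by apply/funext => x; rewrite mxE.
Qed.

Lemma smooth_det D p (F : V -> 'M[R]_p) : open D ->
  smooth_mx D F -> smooth_on D (fun x => \det (F x) : R).
Proof.
move=> oD cF k; apply: class_C_sum => // s _.
apply: class_CM => //; first exact: class_C_cst.
by apply: class_C_prod => // i _; exact: cF.
Qed.

(** Cramer's rule: [invmx] follows the adjugate formula where the matrix is invertible, so the
    formula is transferred along the open set [D]. *)
Lemma smooth_invmx D p (F : V -> 'M[R]_p) : open D ->
  (forall x, D x -> F x \in unitmx) ->
  smooth_mx D F -> smooth_mx D (fun x => invmx (F x)).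
Proof.
move=> oD uF cF.
apply: (@smooth_mx_congr _ _ _ (fun x => (\det (F x))^-1 *: \adj (F x))) => //.
  by move=> x Dx; rewrite /invmx uF.
move=> i j k.
rewrite (_ : (fun x => _) = (fun x => (\det (F x))^-1 * ((-1) ^+ (j + i) * \det (row' j (col' i (F x)))))); last first.
  by apply/funext => x; rewrite !mxE.
apply: class_CM => //.
  apply: class_CV => //; last exact: smooth_det.
  by move=> x Dx; rewrite -unitfE; apply: uF.
apply: class_CM => //; first exact: class_C_cst.
apply: smooth_det => // a b l.
rewrite (_ : (fun x => _) = (fun x => F x (lift j a) (lift i b))); first exact: cF.
by apply/funext => x; rewrite !mxE.
Qed.

Lemma smooth_mx_continuous D p q (F : V -> 'M[R]_(p, q)) : 
  smooth_mx D F -> forall i j x, D x -> {for x, continuous (fun x => F x i j : R)}.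
Proof. by move=> cF i j; exact: (cF i j 0%N). Qed.
End SmoothMatrix.

(** * The Lie group structure of an orthogonal group *)

Lemma trmxD (V : nmodType) p q (A B : 'M[V]_(p, q)) : (A + B)^T = A^T + B^T.
Proof. by apply/matrixP => i j; rewrite !mxE. Qed.

Lemma trmxN (V : zmodType) p q (A : 'M[V]_(p, q)) : (- A)^T = - A^T.
Proof. by apply/matrixP => i j; rewrite !mxE. Qed.

Section Cayley.
Variables (K : numFieldType) (k : nat).
Implicit Types A X J : 'M[K]_k.

(** The Cayley transform plays the part of the exponential: it is rational, is its own inverse, and
    exchanges the Lie algebra with the isometries wherever 1 + X is invertible. *)
Definition cayley X : 'M[K]_k := (1%:M - X) *m invmx (1%:M + X).

(** The derivative of A^T J A at the identity; its kernel is the Lie algebra of the orthogonal group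
    of [J]. *)
Definition skew J X : 'M[K]_k := X^T *m J + J *m X.

Fact skew_is_linear J : linear (skew J).
Proof.
move=> a X Y; rewrite /skew linearP /= mulmxDl mulmxDr -scalemxAl -scalemxAr.
by rewrite scalerDr !addrA; congr (_ + _); rewrite addrAC.
Qed.
HB.instance Definition _ J := GRing.isLinear.Build K _ _ _ (skew J) (skew_is_linear J).

Lemma add1_cayley X : 1%:M + X \in unitmx -> 1%:M + cayley X = 2 *: invmx (1%:M + X).
Proof.
move=> uX; rewrite /cayley -{1}(mulmxV uX) -mulmxDl addrACA subrr addr0.
by rewrite mulmxDl mul1mx -mulr2n scaler_nat.
Qed.

Lemma unit_add1_cayley X : 1%:M + X \in unitmx -> 1%:M + cayley X \in unitmx.
Proof.
by move=> uX; rewrite add1_cayley // unitmxZ ?unitmx_inv // unitfE pnatr_eq0.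
Qed.

Lemma cayleyK X : 1%:M + X \in unitmx -> cayley (cayley X) = X.
Proof.
move=> uX; rewrite {1}/cayley.
have -> : 1%:M - cayley X = X *m (1%:M + cayley X).
  rewrite add1_cayley // -scalemxAr /cayley -{1}(mulmxV uX) -mulmxBl opprB addrC addrA subrK.
  by rewrite mulmxDl scaler_nat mulr2n.
by rewrite mulmxK // unit_add1_cayley.
Qed.

(** In the expansions of (1 - X)^T J (1 - X) and (1 + X)^T J (1 + X) the terms linear in X vanish by
    skewness, so the two matrices agree. *)
Lemma cayley_isometry J X : 1%:M + X \in unitmx -> skew J X = 0 ->
  (cayley X)^T *m J *m cayley X = J.
Proof.
move=> uX sX.
have e : (1%:M - X)^T *m J *m (1%:M - X) = (1%:M + X)^T *m J *m (1%:M + X).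
  rewrite !trmxD trmxN trmx1 !(mulmxDl, mulmxDr) !(mul1mx, mulmx1).
  rewrite !(mulNmx, mulmxN, mul1mx, mulmx1) !opprK.
  have -> : J *m X = - (X^T *m J) by apply/eqP; rewrite -addr_eq0 addrC; exact/eqP.
  move: (X^T *m J) (X^T *m J *m X) => a b.
  by apply/matrixP => i j; rewrite !mxE; ring.
rewrite /cayley; set U := 1%:M + X; set V := 1%:M - X.
have -> : (V *m invmx U)^T *m J *m (V *m invmx U) = (invmx U)^T *m (V^T *m J *m V) *m invmx U.
  by rewrite trmx_mul !mulmxA.
by rewrite e trmx_inv !mulmxA mulVmx ?unitmx_tr // mul1mx mulmxK.
Qed.

(** Multiplied by (1 + A)^T on the left and 1 + A on the right, the skewness defect becomes 2 (J -
    A^T J A). *)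
Lemma skew_cayley J A : 1%:M + A \in unitmx -> A^T *m J *m A = J -> skew J (cayley A) = 0.
Proof.
move=> uA oA; apply: (can_inj (mulmxK uA)); rewrite mul0mx.
have uAT : (1%:M + A)^T \in unitmx by rewrite unitmx_tr.
apply: (can_inj (mulKmx uAT)); rewrite mulmx0 /skew mulmxDl mulmxDr /cayley.
rewrite trmx_mul trmx_inv !mulmxA mulmxV // mul1mx mulmxKV //.
rewrite !trmxD trmxN trmx1 !(mulmxDl, mulmxDr) !(mul1mx, mulmx1).
rewrite !(mulNmx, mulmxN, mul1mx, mulmx1) oA.
move: (J *m A) (A^T *m J) => a b.
by apply/matrixP => i j; rewrite !mxE; ring.
Qed.

End Cayley.

(** Polarization recovers the bilinear form from [F], and invertibility of [J] makes every solution
    of the matrix equation invertible. *)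
Lemma orthogonal_setP (R : realType) k (F : 'cV[R]_k -> R) (J : 'M[R]_k) :
  (forall v, F v = (v^T *m J *m v) 0 0) -> J^T = J -> J \in unitmx ->
  forall A, orthogonal_set F A <-> A^T *m J *m A = J.
Proof.
move=> FE JT JU A.
have bil (u v : 'cV[R]_k) : F (u + v) = F u + F v + 2 * (u^T *m J *m v) 0 0.
  have sym : (v^T *m J *m u) 0 0 = (u^T *m J *m v) 0 0.
    by rewrite -[in RHS]JT -[in RHS](trmxK v) -trmx_mul -mulmxA -trmx_mul [RHS]mxE mulmxA.
  rewrite !FE trmxD !(mulmxDl, mulmxDr).
  have add00 (M N : 'M[R]_1) : (M + N) 0 0 = M 0 0 + N 0 0 by rewrite mxE.
  rewrite !add00 sym; ring.
have ent (M : 'M[R]_k) i j : M i j = ((delta_mx i 0 : 'cV_k)^T *m M *m (delta_mx j 0 : 'cV_k)) 0 0.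
  by rewrite trmx_delta -rowE -colE !mxE.
split=> [[uA iA]|oA]; last first.
  split=> [|v].
    have : J \in unitmx by []. 
    rewrite -{1}oA !unitmx_mul => /andP[/andP[_ _]]; exact.
  by rewrite !FE trmx_mul -{2}oA !mulmxA.
have B (u v : 'cV[R]_k) : ((A *m u)^T *m J *m (A *m v)) 0 0 = (u^T *m J *m v) 0 0.
  have := bil (A *m u) (A *m v); rewrite -mulmxDr !iA bil => /addrI.
  by move/mulfI => -> //; rewrite pnatr_eq0.
by apply/matrixP => i j; rewrite ent [RHS]ent -B trmx_mul !mulmxA.
Qed.

Lemma continuous_big_sum (R : realType) (X : topologicalType) (I : finType) (f : I -> X -> R) x :
  (forall i, {for x, continuous (f i)}) -> {for x, continuous (fun y => \sum_i f i y)}.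
Proof.
move=> cf; rewrite (_ : (fun y => _) = \sum_i f i); last by apply/funext => y; rewrite fct_sumE.
elim/big_ind: _ => [|g h cg ch|i _]; [exact: cst_continuous| |exact: cf].
exact: continuousD cg ch.
Qed.

Section Topology.
Variables (R : realType) (k : nat) (F : 'cV[R]_k -> R).
Local Notation G := (orthogonal_group F).

Lemma orthogonal_val_continuous : continuous (val : G -> 'M[R]_k).
Proof. exact: (@initial_continuous G 'M[R]_k val). Qed.

Lemma continuous_to_orthogonal (X : topologicalType) (f : X -> G) x :
  {for x, continuous (fun y => val (f y))} -> {for x, continuous f}.
Proof.
move=> cf U [? [[W oW <-]] /= Wfx WU]; apply: filterS WU _; apply: cf.
exact: open_nbhs_nbhs.
Qed.

Lemma orthogonal_hausdorff : hausdorff_space G.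
Proof.
rewrite open_hausdorff => x y xy.
have := @norm_hausdorff R 'M[R]_k; rewrite open_hausdorff => H.
have [|[A B] /= [/set_mem xA /set_mem yB] [oA oB AB]] := H (val x) (val y); first by rewrite val_eqE.
exists (val @^-1` A, val @^-1` B) => /=; first by split; apply/mem_set.
split; [by exists A|by exists B|].
apply/eqP/seteqP; split=> // z [zA zB].
by move/eqP/seteqP: AB => [AB _]; apply: (AB (val z)).
Qed.

Lemma orthogonal_second_countable : @second_countable G.
Proof.
pose Bq (qn : 'M[rat]_k * nat) : set G :=
  [set x | ball (map_mx ratr qn.1 : 'M[R]_k) (qn.2.+1%:R^-1) (val x)].
exists (range Bq).
  by apply: (card_le_trans (card_image_le _ _)); exact: countableP.
split=> [_ [q _ <-]|x U].
  exists (ball (map_mx ratr q.1 : 'M[R]_k) (q.2.+1%:R^-1)) => //; exact: ball_open.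
move=> [? [[W oW <-]] /= Wx WU].
have /nbhs_ballP[e /= e0 eW] : nbhs (val x) W by exact: open_nbhs_nbhs.
(* The rational ball of radius 1/(n+1) contains [x], so it lies in the ball of twice that radius
   about [x]; hence the factor 2. *)
have [n ne] : exists n : nat, 2 / n.+1%:R < e.
  have e20 : 0 < e / 2 by rewrite divr_gt0.
  exists (Num.bound (e / 2)^-1); rewrite mulrC -ltr_pdivlMr //.
  rewrite invf_plt ?posrE // (lt_le_trans (archi_boundP _)) ?invr_ge0 ?ltW //.
  by rewrite ltr_nat.
have n0 : (0 : R) < n.+1%:R^-1 by rewrite invr_gt0.
have q_ex (i j : 'I_k) : exists q : rat, ratr q \in `](val x i j - n.+1%:R^-1), (val x i j + n.+1%:R^-1)[.
  by apply: rat_in_itvoo; rewrite ltrBlDr -addrA ltrDl addr_gt0.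
pose q : 'M[rat]_k := \matrix_(i, j) xchoose (q_ex i j).
have qx : ball (map_mx ratr q : 'M[R]_k) (n.+1%:R^-1) (val x).
  split=> // i j; rewrite !mxE; have := xchooseP (q_ex i j).
  move: (xchoose _) => p; rewrite in_itv /=; move: (ratr p) (val x i j) (n.+1%:R^-1) => a b c /andP[h1 h2].
  by rewrite /ball /= ltr_norml; apply/andP; split; lra.
exists (Bq (q, n)) => /=; first by split; [exists (q, n)|].
move=> y yq; apply: WU => /=; apply: eW; apply: (le_ball (ltW ne)).
rewrite mulr_natl mulr2n.
by apply: ball_triangle yq; apply: ball_sym.
Qed.

Lemma open_unitmx (V : normedModType R) D p (f : V -> 'M[R]_p) : open D -> smooth_mx D f ->
  open (D `&` [set x | f x \in unitmx]).
Proof.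
move=> oD cf; rewrite openE => x [Dx ux].
have cd := smooth_det oD cf 0%N x Dx.
have nD : nbhs x D by exact: open_nbhs_nbhs.
have : \forall y \near x, \det (f y) != 0.
  by apply: (@cvgr_neq0 _ R _ _ _ (fun y => \det (f y)) _ cd); rewrite -unitfE.
by apply: filterS2 nD => y Dy dy; split=> //=; rewrite unitmxE unitfE.
Qed.

Lemma orthogonalM_continuous : continuous (fun p : G * G => (p.1 * p.2)%g).
Proof.
move=> p; apply: continuous_to_orthogonal; apply: continuous_mx => i j.
rewrite (_ : (fun y => _) = (fun y : G * G => \sum_l (val y.1 i l) * (val y.2 l j))); last first.
  by apply/funext => y /=; rewrite mxE.
apply: continuous_big_sum => l; apply: cvgM.
  apply: (@continuous_comp _ _ _ fst (fun x : G => val x i l)); first exact: cvg_fst.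
  by apply: (@continuous_comp _ _ _ (val : G -> 'M[R]_k) (fun M : 'M[R]_k => M i l)); [exact: orthogonal_val_continuous|exact: coord_continuous].
apply: (@continuous_comp _ _ _ snd (fun x : G => val x l j)); first exact: cvg_snd.
by apply: (@continuous_comp _ _ _ (val : G -> 'M[R]_k) (fun M : 'M[R]_k => M l j)); [exact: orthogonal_val_continuous|exact: coord_continuous].
Qed.

Lemma smooth_mx_id p q (D : set 'M[R]_(p, q)) : @smooth_mx R 'M[R]_(p, q) D p q id.
Proof.
move=> i j n.
have @f : {linear 'M[R]_(p, q) -> R}.
  by exists (fun N : 'M[R]_(_, _) => N i j); do 2![eexists]; do ?[constructor];
     rewrite ?mxE// => ? *; rewrite ?mxE//; move=> ?; rewrite !mxE.
apply: (@class_C_linear _ _ _ n D f); exact: coord_continuous.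
Qed.

Lemma orthogonalV_continuous : continuous (fun x : G => (x^-1)%g).
Proof.
move=> x; apply: continuous_to_orthogonal.
have oU : open [set M : 'M[R]_k | M \in unitmx].
  have := open_unitmx (@openT _) (@smooth_mx_id k k setT).
  by rewrite setTI.
apply: (@continuous_comp _ _ _ (val : G -> 'M[R]_k) (@invmx R k)); first exact: orthogonal_val_continuous.
apply: continuous_mx => i j.
have := @smooth_invmx R 'M[R]_k _ k id oU _ (@smooth_mx_id k k _) i j 0%N (val x).
apply=> //; by case: x => ? /= /set_mem[].
Qed.

End Topology.

(** * Cayley charts on an orthogonal group *)

Section OrthogonalLie.
Variables (R : realType) (k : nat) (F : 'cV[R]_k -> R) (J : 'M[R]_k).
Hypothesis FE : forall v, F v = (v^T *m J *m v) 0 0.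
Hypotheses (JT : J^T = J) (JU : J \in unitmx).
Local Notation G := (orthogonal_group F).

Lemma orthogonal_unit (A : G) : val A \in unitmx.
Proof. by case: A => A /= /set_mem[]. Qed.

Lemma orthogonal_isometry (A : G) : (val A)^T *m J *m val A = J.
Proof. by apply/(orthogonal_setP FE JT JU); apply/set_mem; exact: valP. Qed.

Let K := kermx (lin_mx (skew J)).
Let r := \rank K.
Let B : 'M[R]_(r, k * k) := row_base K.

(* [r] is the dimension of the Lie algebra [{X | X^T J + J X = 0}], and [alg_mx], [alg_co]
   are mutually inverse coordinates on it. *)
Definition alg_mx (u : 'rV[R]_r) : 'M[R]_k := vec_mx (u *m B).
Definition alg_co (X : 'M[R]_k) : 'rV[R]_r := mxvec X *m pinvmx B.

Lemma skew_alg_mx u : skew J (alg_mx u) = 0.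
Proof.
apply: (can_inj mxvecK); rewrite -mul_vec_lin vec_mxK linear0.
by apply/sub_kermxP; rewrite (submx_trans (submxMl _ _)) // eq_row_base.
Qed.

Lemma alg_coK X : skew J X = 0 -> alg_mx (alg_co X) = X.
Proof.
move=> sX; rewrite /alg_mx /alg_co mulmxKpV ?mxvecK // eq_row_base.
by apply/sub_kermxP; rewrite mul_vec_lin /= sX linear0.
Qed.

Lemma alg_mxK u : alg_co (alg_mx u) = u.
Proof. by rewrite /alg_co vec_mxK mulmxKp // row_base_free. Qed.

Lemma smooth_alg_mx (V : normedModType R) (D : set V) (g : V -> 'rV[R]_r) : open D ->
  smooth_mx D g -> smooth_mx D (fun u => alg_mx (g u)).
Proof.
move=> oD sg i j n.
rewrite (_ : (fun u => _) = (fun u => (g u *m B) 0 (mxvec_index i j))).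
  by apply: smooth_mxM => //; exact: smooth_mx_cst.
by apply/funext => u; rewrite mxE.
Qed.

Lemma smooth_alg_co (V : normedModType R) (D : set V) (Y : V -> 'M[R]_k) : open D ->
  smooth_mx D Y -> smooth_mx D (fun x => alg_co (Y x)).
Proof.
move=> oD sY; apply: smooth_mxM => //; last exact: smooth_mx_cst.
move=> i l n; case/mxvec_indexP: l => a b.
rewrite (_ : (fun x => _) = (fun x => Y x a b)); first exact: sY.
by apply/funext => x; rewrite ord1 mxvecE.
Qed.

Lemma smooth_cayley (V : normedModType R) (D : set V) (Y : V -> 'M[R]_k) : open D ->
  smooth_mx D Y -> (forall x, D x -> 1%:M + Y x \in unitmx) ->
  smooth_mx D (fun x => cayley (Y x)).
Proof.
move=> oD sY uY; apply: smooth_mxM => //.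
  apply: smooth_mxD => //; first exact: smooth_mx_cst.
  rewrite (_ : (fun x => - Y x) = (fun x => (- 1%:M) *m Y x)); last first.
    by apply/funext => x; rewrite mulNmx mul1mx.
  by apply: smooth_mxM => //; exact: smooth_mx_cst.
apply: smooth_invmx => //; apply: smooth_mxD => //; exact: smooth_mx_cst.
Qed.

Lemma orth_cayley X : skew J X = 0 -> 1%:M + X \in unitmx -> cayley X \in orthogonal_set F.
Proof.
by move=> sX uX; apply/mem_set/(orthogonal_setP FE JT JU); exact: cayley_isometry.
Qed.

Definition to_orth : 'M[R]_k -> G := insubd (orthogonal1 F).

Lemma to_orthK M : M \in orthogonal_set F -> val (to_orth M) = M.
Proof. by move=> oM; rewrite /to_orth insubdK. Qed.

(** The chart at [h] is the Cayley chart at the identity moved by left translation; it contains [h]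
    because 1 + 1 is invertible. *)
Definition ch_dom (h : G) : set G := [set A | 1%:M + val (h^-1 * A)%g \in unitmx].
Definition ch_map (h A : G) : 'rV[R]_r := alg_co (cayley (val (h^-1 * A)%g)).
Definition ch_inv (h : G) (u : 'rV[R]_r) : G := (h * to_orth (cayley (alg_mx u)))%g.
Definition ch_img : set 'rV[R]_r := [set u | 1%:M + alg_mx u \in unitmx].

Lemma ch_img_open : open ch_img.
Proof.
have := open_unitmx (f := fun u => 1%:M + alg_mx u) (@openT _)
  (smooth_mxD (@openT _) (@smooth_mx_cst _ _ setT _ _ 1%:M) (smooth_alg_mx (@openT _) (@smooth_mx_id R 1 r setT))).
by rewrite setTI.
Qed.

Lemma ch_val h u : ch_img u -> val (ch_inv h u) = val h *m cayley (alg_mx u).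
Proof.
move=> iu; rewrite -[LHS]/(val h *m val (to_orth _)) to_orthK //.
exact: orth_cayley (skew_alg_mx u) iu.
Qed.

Lemma ch_mapK h A : ch_dom h A -> ch_inv h (ch_map h A) = A.
Proof.
move=> dA; rewrite /ch_inv /ch_map alg_coK; last first.
  by apply: skew_cayley => //; exact: orthogonal_isometry.
by rewrite cayleyK // /to_orth valKd mulgA mulgV mul1g.
Qed.

Lemma ch_map_img h A : ch_dom h A -> ch_img (ch_map h A).
Proof.
move=> dA; rewrite /ch_img /= /ch_map alg_coK; first exact: unit_add1_cayley.
by apply: skew_cayley => //; exact: orthogonal_isometry.
Qed.

Lemma ch_invK h u : ch_img u -> ch_map h (ch_inv h u) = u.
Proof.
move=> iu; rewrite /ch_map /ch_inv mulgA mulVg mul1g.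
by rewrite (to_orthK (orth_cayley (skew_alg_mx u) iu)) cayleyK // alg_mxK.
Qed.

Lemma ch_inv_dom h u : ch_img u -> ch_dom h (ch_inv h u).
Proof.
move=> iu; rewrite /ch_dom /ch_inv /mkset mulgA mulVg mul1g.
rewrite (to_orthK (orth_cayley (skew_alg_mx u) iu)); exact: unit_add1_cayley.
Qed.

Lemma ch_imgE h : ch_map h @` ch_dom h = ch_img.
Proof.
apply/seteqP; split=> [_ [A dA <-]|u iu]; first exact: ch_map_img.
by exists (ch_inv h u); [exact: ch_inv_dom|exact: ch_invK].
Qed.

(** An open set of matrices whose trace on the group is [ch_dom h]: openness and smoothness are
    checked there, since derivatives need an open set of a normed space. *)
Definition mx_dom (h : G) := [set M : 'M[R]_k | 1%:M + invmx (val h) *m M \in unitmx].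

Lemma smooth_translate (h : G) D : open D -> @smooth_mx R 'M[R]_k D k k (fun M => invmx (val h) *m M).
Proof.
by move=> oD; apply: smooth_mxM => //; [exact: smooth_mx_cst|exact: smooth_mx_id].
Qed.

Lemma mx_dom_open h : open (mx_dom h).
Proof.
have := open_unitmx (f := fun M => 1%:M + invmx (val h) *m M) (@openT _)
  (smooth_mxD (@openT _) (@smooth_mx_cst _ _ setT _ _ 1%:M) (smooth_translate h (@openT _))).
by rewrite setTI.
Qed.

Lemma ch_dom_open h : open (ch_dom h).
Proof. by exists (mx_dom h) => //; exact: mx_dom_open. Qed.

Lemma ch_map_cont h : {within ch_dom h, continuous (ch_map h)}.
Proof.
apply: continuous_in_subspaceT => A /set_mem dA.
have sm : @smooth_mx R 'M[R]_k (mx_dom h) _ _ (fun M => alg_co (cayley (invmx (val h) *m M))).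
  have oh := @mx_dom_open h.
  by apply: smooth_alg_co => //; apply: smooth_cayley => //; exact: smooth_translate.
apply: continuous_mx => i j.
apply: (@continuous_comp _ _ _ (val : G -> 'M[R]_k)
  (fun M => alg_co (cayley (invmx (val h) *m M)) i j)); first exact: orthogonal_val_continuous.
exact: (smooth_mx_continuous sm).
Qed.

Lemma smooth_ch_val (h : G) (D : set 'rV[R]_r) : open D -> D `<=` ch_img -> smooth_mx D (fun u => val h *m cayley (alg_mx u)).
Proof.
move=> oD sD; apply: smooth_mxM => //; first exact: smooth_mx_cst.
by apply: smooth_cayley => //; apply: smooth_alg_mx => //; exact: smooth_mx_id.
Qed.

Lemma ch_inv_cont h : {within ch_map h @` ch_dom h, continuous (ch_inv h)}.
Proof.
rewrite ch_imgE; apply: continuous_in_subspaceT => u /set_mem iu.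
apply: continuous_to_orthogonal; apply: continuous_mx => i j.
have sm := smooth_mx_congr ch_img_open (fun u iu => esym (ch_val h iu))
  (smooth_ch_val h ch_img_open (@subset_refl _ _)).
exact: (smooth_mx_continuous sm).
Qed.

Definition ch (h : G) : chart R G r := @Chart R G r (ch_dom h) (ch_map h) (ch_inv h)
  (ch_dom_open h) (eq_ind_r open ch_img_open (ch_imgE h))
  (@ch_mapK h) (@ch_map_cont h) (@ch_inv_cont h).

(** Transition maps, multiplication and inversion all reduce to this case, where the matrix of [f]
    is a smooth function on an open [D]. Smoothness is proved on the open set [E], which contains
    [S], and then restricted. *)
Lemma smooth_ch_map (V : normedModType R) (D S : set V) (Phi : V -> 'M[R]_k) (f : V -> G) (c : G) :
  open D -> smooth_mx D Phi -> (forall x, D x -> val (f x) = Phi x) ->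
  S `<=` D -> (forall x, S x -> ch_dom c (f x)) ->
  smooth_on S (ch_map c \o f).
Proof.
move=> oD sPhi fE sSD dS.
have sT : smooth_mx D (fun x => invmx (val c) *m Phi x).
  by apply: smooth_mxM => //; exact: smooth_mx_cst.
pose E := D `&` [set x | 1%:M + invmx (val c) *m Phi x \in unitmx].
have oE : open E.
  apply: (open_unitmx (f := fun x => 1%:M + invmx (val c) *m Phi x)) => //.
  by apply: smooth_mxD => //; exact: smooth_mx_cst.
have sE : smooth_mx E (fun x => alg_co (cayley (invmx (val c) *m Phi x))).
  apply: smooth_alg_co => //; apply: smooth_cayley => // [|x []//].
  by apply: smooth_mx_sub sT => x [].
have sfE : smooth_mx E (ch_map c \o f).
  by apply: smooth_mx_congr sE => // x [Dx _]; rewrite /= /ch_map /= fE.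
move=> n; apply: class_C_sub (smooth_mx_smooth oE sfE n) => x Sx.
by split; [exact: sSD|have := dS x Sx; rewrite /ch_dom /= fE //; exact: sSD].
Qed.

Theorem orthogonal_group_lie : is_lie_group R G.
Proof.
split; [exact: orthogonal_hausdorff|exact: orthogonal_second_countable|
  exact: orthogonalM_continuous|exact: orthogonalV_continuous|].
have oI := ch_img_open.
exists r, (range ch); split.
- split=> [A|_ _ [a _ <-] [b _ <-]].
    exists (ch A); first by exists A.
    suff : 1%:M + (1%:M : 'M[R]_k) \in unitmx by rewrite /= /ch_dom /mkset mulVg.
    by rewrite -mulr2n -scaler_nat unitmxZ ?unitmx1 // unitfE pnatr_eq0.
  apply: (smooth_ch_map (D := ch_img) (Phi := fun u => val a *m cayley (alg_mx u))) => //.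
  + exact: smooth_ch_val.
  + by move=> u iu; rewrite ch_val.
  + by move=> _ [A [dA _] <-]; exact: ch_map_img.
  + by move=> _ [A [dA dB] <-] /=; rewrite ch_mapK.
- move=> _ _ _ [a _ <-] [b _ <-] [c _ <-] mul.
  pose D := [set u : 'rV[R]_(r + r) | ch_img (lsubmx u) /\ ch_img (rsubmx u)].
  have sl D' : @smooth_mx R 'rV[R]_(r + r) D' 1 r (@lsubmx R 1 r r).
    move=> i j n; rewrite (_ : (fun x => _) = (fun x : 'rV[R]_(r + r) => x i (lshift r j))).
      exact: smooth_mx_id.
    by apply/funext => x; rewrite mxE.
  have sr D' : @smooth_mx R 'rV[R]_(r + r) D' 1 r (@rsubmx R 1 r r).
    move=> i j n; rewrite (_ : (fun x => _) = (fun x : 'rV[R]_(r + r) => x i (rshift r j))).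
      exact: smooth_mx_id.
    by apply/funext => x; rewrite mxE.
  have oD : open D.
    have o1 := open_unitmx (f := fun u : 'rV[R]_(r + r) => 1%:M + alg_mx (lsubmx u)) (@openT _)
      (smooth_mxD (@openT _) (@smooth_mx_cst _ _ setT _ _ 1%:M) (smooth_alg_mx (@openT _) (sl _))).
    have o2 := open_unitmx (f := fun u : 'rV[R]_(r + r) => 1%:M + alg_mx (rsubmx u)) o1
      (smooth_mxD o1 (@smooth_mx_cst _ _ _ _ _ 1%:M) (smooth_alg_mx o1 (sr _))).
    by move: o2; rewrite setTI.
  apply: (smooth_ch_map (D := D) (Phi := fun u : 'rV[R]_(r + r) =>
      (val a *m cayley (alg_mx (lsubmx u))) *m (val b *m cayley (alg_mx (rsubmx u))))) => //.
  + apply: smooth_mxM => //; apply: smooth_mxM => //; try exact: smooth_mx_cst.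
      by apply: smooth_cayley => //; [exact: smooth_alg_mx|move=> u []].
    by apply: smooth_cayley => //; [exact: smooth_alg_mx|move=> u []].
  + by move=> u [lu ru]; rewrite /mul /= -!ch_val.
  + by move=> u [[A dA eA] [[A' dA' eA'] _]]; split; rewrite -?eA -?eA'; exact: ch_map_img.
  + by move=> u [] _ [].
- move=> _ _ [a _ <-] [b _ <-].
  apply: (smooth_ch_map (D := ch_img)
    (Phi := fun u => invmx (val a *m cayley (alg_mx u))) (f := fun u => (ch_inv a u)^-1%g)) => //.
  + apply: smooth_invmx => //; last exact: smooth_ch_val.
    by move=> u iu; rewrite -ch_val //; exact: orthogonal_unit.
  + by move=> u iu; rewrite /= -ch_val.
  + by move=> _ [A [dA _] <-]; exact: ch_map_img.
  + by move=> _ [A [dA dB] <-] /=; rewrite ch_mapK.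
Qed.

End OrthogonalLie.

(** * Reflections, semisimplicity and the identity component *)

Lemma open_neq0 (R : realType) (X : topologicalType) (f : X -> R) :
  continuous f -> open [set x | f x != 0].
Proof. by move=> cf; rewrite openE => x fx; exact: (@cvgr_neq0 _ R _ _ _ f _ (cf x)). Qed.

(** One representative is chosen in each fibre of [c] that meets [H]; the other fibres receive the
    harmless representative 1. *)
Lemma finite_index_classes (G : groupType) (N H : set G) (T : finType) (c : G -> T) :
  (forall x y, H x -> H y -> c x = c y -> N (y^-1 * x)%g) -> finite_index N H.
Proof.
move=> cN.
pose rep (t : T) : G := if pselect (exists x, H x /\ c x = t) is left e then sval (cid e) else 1%g.
exists [seq rep t | t <- enum T] => x Hx; exists (rep (c x)).
  by apply: map_f; rewrite mem_enum.
rewrite /rep; case: pselect => [e|[]]; last by exists x.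
by case: cid => y /= [Hy cy]; apply: cN.
Qed.

Lemma finite_index_trans (G : groupType) (N H K : set G) :
  finite_index N H -> finite_index H K -> finite_index N K.
Proof.
move=> [s sN] [t tH]; exists [seq (y * z)%g | y <- t, z <- s] => x Kx.
have [y yt Hyx] := tH x Kx; have [z zs Nzx] := sN _ Hyx.
exists (y * z)%g; first exact: allpairs_f.
by rewrite invgM -mulgA.
Qed.

Lemma mulg_quotient_split (G : groupType) (r x y : G) :
  (y^-1 * x = (r^-1 * y)^-1 * (r^-1 * x))%g.
Proof. by rewrite invgM invgK -mulgA (mulgA r) mulgV mul1g. Qed.

Lemma mulg_conj_split (G : groupType) (r q g x : G) :
  ((r * q)^-1 * (g * r * x) = ((r * q)^-1 * g * (r * q)) * (q^-1 * x))%g.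
Proof. by rewrite !mulgA mulgK. Qed.

Section IdentityComponent.
Variable G : topGroupType.
Hypotheses (mulC : continuous (fun p : G * G => (p.1 * p.2)%g))
           (invC : continuous (fun x : G => (x^-1)%g)).
Local Notation G0 := (@identity_component G).

Lemma continuous_mull (x : G) : continuous (fun y : G => (x * y)%g).
Proof.
move=> y; apply: (@continuous_comp _ _ _ (fun y : G => (x, y)) (fun p : G * G => (p.1 * p.2)%g)).
  by apply: cvg_pair; [exact: cvg_cst|exact: cvg_id].
exact: mulC.
Qed.

Lemma continuous_mulr (x : G) : continuous (fun y : G => (y * x)%g).
Proof.
move=> y; apply: (@continuous_comp _ _ _ (fun y : G => (y, x)) (fun p : G * G => (p.1 * p.2)%g)).
  by apply: cvg_pair; [exact: cvg_id|exact: cvg_cst].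
exact: mulC.
Qed.

Lemma identity_component_sub (C : set G) : C 1%g -> connected C -> C `<=` G0.
Proof. by move=> C1 cC; apply: connected_component_max. Qed.

Lemma identity_component1 : G0 1%g.
Proof. exact: connected_component_refl. Qed.

Lemma identity_component_image (f : G -> G) (x : G) : continuous f -> G0 x -> G0 (f x) ->
  forall y, G0 y -> G0 (f y).
Proof.
move=> cf Gx Gfx y Gy.
apply: (connected_component_trans Gfx).
have c : connected (f @` G0).
  apply: connected_continuous_connected; first exact: component_connected.
  exact: continuous_subspaceT.
by apply: (connected_component_max _ _ c); [exists x| |exists y].
Qed.

Lemma identity_componentM x y : G0 x -> G0 y -> G0 (x * y)%g.
Proof.
move=> Gx; apply: (@identity_component_image (fun y => x * y)%g 1%g (@continuous_mull x) identity_component1).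
by rewrite mulg1.
Qed.

Lemma identity_componentV x : G0 x -> G0 (x^-1)%g.
Proof.
apply: (@identity_component_image _ 1%g invC identity_component1).
by rewrite invg1; exact: identity_component1.
Qed.

Lemma identity_component_conj x y : G0 x -> G0 (y^-1 * x * y)%g.
Proof.
have cc : continuous (fun x => y^-1 * x * y)%g.
  move=> z; apply: (@continuous_comp _ _ _ (fun x => y^-1 * x)%g (fun x => x * y)%g).
    exact: continuous_mull.
  exact: continuous_mulr.
apply: (@identity_component_image _ 1%g cc identity_component1).
by rewrite mulg1 mulVg; exact: identity_component1.
Qed.

(** As the component is normal, multiplying by an element of [Rf] only shifts the coset by [s] or
    [t]; the group is therefore covered by the cosets of 1, s, t and st. *)
Lemma identity_component_two_cosets (s t : G) (Rf H : set G) :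
  (s * s = 1)%g -> (t * t = 1)%g -> (s * t = t * s)%g ->
  (forall r, Rf r -> G0 (r * s)%g \/ G0 (r * t)%g) ->
  (forall S : set G, S 1%g -> (forall r A, Rf r -> S A -> S (r * A)%g) -> forall A, S A) ->
  is_subgroup H -> finite_index (G0 `&` H) H.
Proof.
move=> ss tt st cos gen [_ HM HV].
pose rep (ab : bool * bool) : G := ((if ab.1 then s else 1) * (if ab.2 then t else 1))%g.
have cls A : exists ab, G0 ((rep ab)^-1 * A)%g.
  have step ab ab' (g r A' : G) : rep ab' = (r * rep ab)%g -> G0 g ->
      G0 ((rep ab)^-1 * A')%g -> G0 ((rep ab')^-1 * (g * r * A'))%g.
    move=> -> Gg GA; set q := rep ab in GA *.
    have -> : ((r * q)^-1 * (g * r * A') = ((r * q)^-1 * g * (r * q)) * (q^-1 * A'))%g.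
      exact: mulg_conj_split.
    by apply: identity_componentM => //; exact: identity_component_conj.
  apply: (gen (fun A => exists ab, G0 ((rep ab)^-1 * A)%g)) => [|r {}A Rr [[a b] GA]].
    exists (false, false); rewrite /rep /= !mulg1 invg1; exact: identity_component1.
  have [rs|rt] := cos r Rr.
    exists (~~ a, b).
    have -> : (r * A = (r * s) * s * A)%g by rewrite -(mulgA _ s s) ss mulg1.
    apply: step rs GA.
    by rewrite /rep /=; case: a; case: b => /=; rewrite ?mulg1 ?mul1g ?ss // ?mulgA ?ss ?mul1g.
  exists (a, ~~ b).
  have -> : (r * A = (r * t) * t * A)%g by rewrite -(mulgA _ t t) tt mulg1.
  apply: step rt GA.
  by rewrite /rep /=; case: a; case: b => /=; rewrite ?mulg1 ?mul1g ?tt // ?mulgA -?st // -mulgA tt mulg1.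
pose c A := sval (cid (cls A)).
have cP A : G0 ((rep (c A))^-1 * A)%g by rewrite /c; case: cid.
apply: (@finite_index_classes _ _ _ _ c) => x y Hx Hy cxy; split; last by apply: HM => //; exact: HV.
have -> : (y^-1 * x = ((rep (c y))^-1 * y)^-1 * ((rep (c y))^-1 * x))%g.
  exact: mulg_quotient_split.
apply: identity_componentM => //; first by apply: identity_componentV.
by rewrite -cxy.
Qed.

End IdentityComponent.

(** * Forms isometric to minus the Lorentz form: timelike vectors and reflections *)

Section Lorentz.
Variables (R : realType) (p : nat).
Local Notation k := p.+3.
Variables (F : 'cV[R]_k -> R) (J E : 'M[R]_k).
Hypotheses (FE : forall v, F v = (v^T *m J *m v) 0 0) (JT : J^T = J).
Hypotheses (EU : E \in unitmx) (FEl : forall v, F (E *m v) = - lorentz v).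
Local Notation G := (orthogonal_group F).

Definition bform (u v : 'cV[R]_k) : R := (u^T *m J *m v) 0 0.
Local Notation B := bform.

Lemma bformC u v : B u v = B v u.
Proof.
rewrite /B -[in LHS]JT -[in LHS](trmxK u) !trmxK -{1}(trmxK v) -mulmxA -trmx_mul.
by rewrite -trmx_mul [LHS]mxE -mulmxA.
Qed.

Lemma bformDr u v w : B u (v + w) = B u v + B u w.
Proof. by rewrite /B mulmxDr mxE. Qed.

Lemma bformDl u v w : B (u + v) w = B u w + B v w.
Proof. by rewrite bformC bformDr !(bformC w). Qed.

Lemma bformZr a u v : B u (a *: v) = a * B u v.
Proof. by rewrite /B -scalemxAr mxE. Qed.

Lemma bformZl a u v : B (a *: u) v = a * B u v.
Proof. by rewrite bformC bformZr bformC. Qed.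

Lemma bformNr u v : B u (- v) = - B u v.
Proof. by rewrite -scaleN1r bformZr mulN1r. Qed.

Lemma bformNl u v : B (- u) v = - B u v.
Proof. by rewrite bformC bformNr bformC. Qed.

Lemma bform0r u : B u 0 = 0.
Proof. by rewrite -(scale0r 0) bformZr mul0r. Qed.

Lemma formE v : F v = B v v. Proof. exact: FE. Qed.

Definition bformE := (formE, bformDl, bformDr, bformZl, bformZr, bformNl, bformNr).

Lemma lorentz_gram : E^T *m J *m E = - diag_mx (\row_i (if i == 0 then 1 else -1)).
Proof.
set L := diag_mx _.
have LT : L^T = L by rewrite tr_diag_mx.
have FL v : - lorentz v = (v^T *m (- L) *m v) 0 0.
  rewrite mulmxN mulNmx [RHS]mxE; congr (- _).
  rewrite /L -mulmxA mul_diag_mx mxE big_ord_recl !mxE /= mul1r -expr2 /lorentz; congr (_ + _).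
  by rewrite -sumrN; apply: eq_bigr => i _; rewrite !mxE /= expr2; ring.
have ent (M : 'M[R]_k) i j : M i j = ((delta_mx i 0 : 'cV_k)^T *m M *m (delta_mx j 0 : 'cV_k)) 0 0.
  by rewrite trmx_delta -rowE -colE !mxE.
have pol (M : 'M[R]_k) (f : 'cV[R]_k -> R) : M^T = M -> (forall v, f v = (v^T *m M *m v) 0 0) ->
    forall u v : 'cV[R]_k, 2 * (u^T *m M *m v) 0 0 = f (u + v) - f u - f v.
  move=> MT fM u v; rewrite !fM trmxD !(mulmxDl, mulmxDr).
  have add00 (P Q : 'M[R]_1) : (P + Q) 0 0 = P 0 0 + Q 0 0 by rewrite mxE.
  have -> : v^T *m M *m u = (u^T *m M *m v)^T by rewrite !trmx_mul trmxK MT mulmxA.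
  rewrite !add00 [(_^T) 0 0]mxE; ring.
apply/matrixP => i j; rewrite ent [RHS]ent.
apply: (@mulfI R 2); first by rewrite pnatr_eq0.
rewrite (pol (E^T *m J *m E) (fun v => F (E *m v))); first last.
- by move=> v; rewrite FE trmx_mul !mulmxA.
- by rewrite !trmx_mul trmxK JT mulmxA.
by rewrite (pol (- L) (fun v => - lorentz v)) ?trmxN ?LT //= !FEl.
Qed.

Lemma gramE (i j : 'I_k) : B (E *m delta_mx i 0) (E *m delta_mx j 0) =
  if i == j then (if i == 0 then -1 else 1) else 0.
Proof.
rewrite /bform trmx_mul !mulmxA -(mulmxA _ E^T) -(mulmxA _ _ E) lorentz_gram.
rewrite trmx_delta -rowE -colE !mxE eq_sym.
rewrite (eq_sym 0); case: (i == j); rewrite ?mulr0n ?oppr0 ?mulr1n //.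
by case: ifP; rewrite ?opprK.
Qed.

Lemma gram_unit : J \in unitmx.
Proof.
have : E^T *m J *m E \in unitmx.
  rewrite lorentz_gram -scaleN1r unitmxZ ?unitrN1 // unitmxE det_diag unitfE.
  apply/prodf_neq0 => i _; rewrite mxE; case: ifP => _; rewrite ?oppr_eq0 oner_eq0 //.
by rewrite !unitmx_mul => /andP[/andP[]].
Qed.
Let JU := gram_unit.

Lemma bform_orth (A : G) u v : B (val A *m u) (val A *m v) = B u v.
Proof.
by rewrite /B trmx_mul -{2}(orthogonal_isometry FE JT JU A) !mulmxA.
Qed.

Lemma form_orth (A : G) v : F (val A *m v) = F v.
Proof. by rewrite !formE bform_orth. Qed.

(** The orthogonal complement of a timelike vector is positive definite: a Cauchy-Schwarz argument
    on the space parts, in coordinates where [F] is minus the Lorentz form. *)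
Lemma timelike_orth v z : F v < 0 -> B v z = 0 -> F z <= 0 -> z = 0.
Proof.
rewrite -(mulKVmx EU v) -(mulKVmx EU z); set a := invmx E *m v; set b := invmx E *m z.
have -> : B (E *m a) (E *m b) = (a^T *m (E^T *m J *m E) *m b) 0 0 by rewrite /B trmx_mul !mulmxA.
clearbody a b.
rewrite !FEl oppr_lt0 oppr_le0 lorentz_gram mulmxN mulNmx mxE -mulmxA mul_diag_mx mxE big_ord_recl !mxE /= mul1r.
rewrite (eq_bigr (fun i => - (a (lift ord0 i) 0 * b (lift ord0 i) 0))); last first.
  by move=> i _; rewrite !mxE /= mulN1r mulrN.
rewrite /lorentz sumrN => la /eqP; rewrite oppr_eq0 subr_eq0 => /eqP ab lb.
set A2 := \sum_(i < _) a _ _ ^+ 2 in la; set B2 := \sum_(i < _) b _ _ ^+ 2 in lb.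
have A20 : 0 <= A2 by apply: sumr_ge0 => i _; exact: sqr_ge0.
have a0 : a 0 0 != 0 by apply: contraTneq la => ->; rewrite -leNgt; lra.
pose t := b 0 0 / a 0 0.
have key : 0 <= B2 - 2 * t * (a 0 0 * b 0 0) + t ^+ 2 * A2.
  rewrite ab /B2 /A2 !mulr_sumr -sumrB -big_split /=; apply: sumr_ge0 => i _.
  by rewrite (_ : _ + _ = (b (lift ord0 i) 0 - t * a (lift ord0 i) 0) ^+ 2) ?sqr_ge0 //; ring.
have bE : b 0 0 = t * a 0 0 by rewrite divfK.
have t0 : t = 0.
  apply/eqP; rewrite -sqrf_eq0 eq_le sqr_ge0 andbT leNgt; apply/negP => t0.
  have := mulr_gt0 t0 la; move: key lb; rewrite bE; move: (a 0 0) => x; nra.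
have b0 : b 0 0 = 0 by rewrite bE t0 mul0r.
have B20 : B2 = 0.
  apply/eqP; rewrite eq_le (_ : 0 <= B2) ?andbT; last by apply: sumr_ge0 => i _; exact: sqr_ge0.
  by move: lb; rewrite b0; lra.
suff -> : b = 0 by rewrite mulmx0.
apply/matrixP => i j; rewrite (ord1 j) [RHS]mxE; case: (unliftP ord0 i) => [l|] ->//.
have /psumr_eq0P H := B20; apply/eqP; rewrite -sqrf_eq0; apply/eqP/H => // s _; exact: sqr_ge0.
Qed.

(** Two linear conditions on a space of dimension at least 3. *)
Lemma exists_orth2 v w : exists2 f, f != 0 & B v f = 0 /\ B w f = 0.
Proof.
pose X : 'M[R]_(k, 1 + 1) := row_mx (J *m v) (J *m w).
have : kermx X != 0.
  rewrite -mxrank_eq0 mxrank_ker subn_eq0 -ltnNge.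
  exact: leq_ltn_trans (rank_leq_col X) _.
case/rowV0Pn => u /sub_kermxP; rewrite /X mul_mx_row => uX u0.
have [e1 e2] : u *m (J *m v) = 0 /\ u *m (J *m w) = 0.
  by apply: eq_row_mx; rewrite uX row_mx0.
exists u^T; first by rewrite -(trmx0 R) (can_eq trmxK) //.
by split; rewrite bformC /B trmxK -mulmxA ?e1 ?e2 mxE.
Qed.

Definition refl_mx (v : 'cV[R]_k) : 'M[R]_k := 1%:M - (2 / F v) *: (v *m (v^T *m J)).

Lemma refl_mxE v x : refl_mx v *m x = x - (2 * B v x / F v) *: v.
Proof.
rewrite /refl_mx mulmxBl mul1mx -scalemxAl -mulmxA; congr (_ - _).
rewrite [v^T *m J *m x]mx11_scalar -/(B v x) mul_mx_scalar scalerA.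
by congr (_ *: _); ring.
Qed.

Lemma refl_mxK v (x : 'cV[R]_k) : F v != 0 -> refl_mx v *m (refl_mx v *m x) = x.
Proof.
move=> v0; rewrite !refl_mxE -addrA -opprD -scalerDl bformDr bformNr bformZr -formE.
set b := B v x; rewrite (_ : 2 * b / F v + _ = 0) ?scale0r ?subr0 //; field; exact: v0.
Qed.

Lemma refl_mx_orth v : F v != 0 -> refl_mx v \in orthogonal_set F.
Proof.
move=> v0; apply/mem_set; split.
  have /mulmx1_unit[] // : refl_mx v *m refl_mx v = 1%:M.
  apply/matrixP => i j; have ent (M : 'M[R]_k) : M i j = (M *m delta_mx j 0 : 'cV_k) i 0.
    by rewrite -colE mxE.
  by rewrite ent [RHS]ent mul1mx -mulmxA refl_mxK.
move=> x; rewrite refl_mxE !bformE -(bformC v x); field; by rewrite -formE.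
Qed.

Definition refl (v : 'cV[R]_k) : G := insubd (orthogonal1 F) (refl_mx v).

Lemma val_refl v : F v != 0 -> val (refl v) = refl_mx v.
Proof. by move=> v0; rewrite /refl insubdK //; exact: refl_mx_orth. Qed.

Lemma reflE v x : F v != 0 -> val (refl v) *m x = x - (2 * B v x / F v) *: v.
Proof. by move=> v0; rewrite val_refl // refl_mxE. Qed.

Lemma orth_ext (A C : G) : (forall x : 'cV[R]_k, val A *m x = val C *m x) -> A = C.
Proof.
move=> AC; apply/val_inj/matrixP => i j.
have := AC (delta_mx j 0); rewrite -!colE => /matrixP/(_ i 0).
by rewrite !mxE.
Qed.

Lemma orthME (A C : G) (x : 'cV[R]_k) : val (A * C)%g *m x = val A *m (val C *m x).
Proof. by rewrite mulmxA. Qed.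

Lemma reflK v : F v != 0 -> (refl v * refl v = 1)%g.
Proof.
move=> v0; apply: orth_ext => x; rewrite orthME val_refl // refl_mxK //.
by symmetry; exact: mul1mx.
Qed.

Lemma reflV v : F v != 0 -> ((refl v)^-1 = refl v)%g.
Proof. by move=> v0; apply: (mulgI (refl v)); rewrite mulgV reflK. Qed.

Lemma refl_conj (A : G) v : F v != 0 -> (A * refl v * A^-1 = refl (val A *m v))%g.
Proof.
move=> v0; have Av0 : F (val A *m v) != 0 by rewrite form_orth.
suff e : (A * refl v = refl (val A *m v) * A)%g by rewrite e -mulgA mulgV mulg1.
apply: orth_ext => x; rewrite !orthME !reflE // bform_orth form_orth.
by rewrite mulmxBr -scalemxAr.
Qed.

Lemma refl_self v : F v != 0 -> val (refl v) *m v = - v.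
Proof.
by move=> v0; rewrite reflE // -formE mulfK // scaler_nat mulr2n opprD addNKr.
Qed.

Lemma reflZ a v : a != 0 -> F v != 0 -> refl (a *: v) = refl v.
Proof.
move=> a0 v0; have av0 : F (a *: v) != 0 by rewrite !bformE -formE !mulf_neq0.
apply: orth_ext => x; rewrite !reflE //; congr (_ - _); rewrite scalerA; congr (_ *: _).
by rewrite !bformE -!formE; field; rewrite v0.
Qed.

Lemma refl_comm v w : F v != 0 -> F w != 0 -> B v w = 0 -> (refl v * refl w = refl w * refl v)%g.
Proof.
move=> v0 w0 vw; have e : val (refl v) *m w = w by rewrite reflE // vw mulr0 mul0r scale0r subr0.
by rewrite -{2}e -refl_conj // -mulgA mulVg mulg1.
Qed.

Lemma exists_timelike : exists e, F e < 0.
Proof.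
exists (E *m delta_mx 0 0); rewrite FEl /lorentz big1 ?subr0 => [|i _]; last first.
  by rewrite mxE eqxx /= expr0n.
by rewrite mxE !eqxx expr1n oppr_lt0 ltr01.
Qed.

Opaque refl bform.

(* The commutation of [C] with [r_u C r_u] gives [r_w r_{Cw} = r_u r_w] for [w = C u]. *)
Lemma commute_conj_refl (C : G) u : F u != 0 ->
  (C * (refl u * C * refl u) = (refl u * C * refl u) * C)%g ->
  let b := B (val C *m u) u / F u in
  val C *m (val C *m u) = u \/
   val C *m (val C *m u) + u = (2 * b) *: (val C *m u).
Proof.
move=> u0 com b; have [w wE] : exists w, w = val C *m u by exists (val C *m u).
have [x xwE] : exists x, x = val C *m w by exists (val C *m w).
have Fw : F w = F u by rewrite wE form_orth.
have Fx : F x = F u by rewrite xwE form_orth.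
have w0 : F w != 0 by rewrite Fw.
have x0 : F x != 0 by rewrite Fx.
have bE : b = B w u / F u by rewrite wE.
have rw : (C * refl u = refl w * C)%g by rewrite wE -refl_conj // -mulgA mulVg mulg1.
have rx : (C * refl w = refl x * C)%g by rewrite xwE -refl_conj // -mulgA mulVg mulg1.
rewrite -wE -xwE; clearbody b.
have e : (refl w * refl x = refl u * refl w)%g.
  apply: (mulIg C); apply: (mulIg C).
  have h1 : (C * (refl u * C * refl u) = refl w * refl x * C * C)%g.
    by rewrite !mulgA rw -[LHS]mulgA rw !mulgA -[(refl w * C * refl w)%g]mulgA rx !mulgA.
  have h2 : (refl u * C * refl u * C = refl u * refl w * C * C)%g.
    by rewrite -[(refl u * C * refl u)%g]mulgA rw !mulgA.
  by rewrite -h1 com h2.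
(* So r_x is also the reflection in r_w u, and x must be a multiple of r_w u; equivalently, y = r_w
   x below is a multiple of u. *)
have rxE : refl x = (refl w * refl u * refl w)%g.
  apply: (mulgI (refl w)); rewrite !mulgA (reflK w0) mul1g; exact: e.
have : val (refl x) *m x = - x by rewrite refl_self.
rewrite rxE !orthME; have [y yE0] : exists y, y = val (refl w) *m x by exists (val (refl w) *m x).
rewrite -yE0 => ey.
have wwK (z : 'cV[R]_k) : val (refl w) *m (val (refl w) *m z) = z by rewrite val_refl // refl_mxK.
have Fy : F y = F u by rewrite yE0 form_orth.
have ry : val (refl u) *m y = - y by rewrite -[LHS]wwK ey mulmxN -yE0.
have yE : y = (B u y / F u) *: u.
  move: ry; rewrite reflE // => /eqP; rewrite subr_eq addrC -subr_eq opprK -mulr2n -scaler_nat => /eqP ry.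
  apply: (@scalerI R _ 2); first by rewrite pnatr_eq0.
  by rewrite ry scalerA mulrA.
have [l lE] : exists l, l = B u y / F u by exists (B u y / F u).
rewrite -lE in yE.
have l2 : l ^+ 2 = 1.
  apply: (mulIf u0); rewrite mul1r -[in RHS]Fy [in RHS]yE !bformE; ring.
have xE : x = l *: (u - (2 * b) *: w).
  have -> : x = val (refl w) *m y by rewrite yE0 wwK.
  by rewrite yE -scalemxAr (reflE _ w0) Fw bE mulrA.
(* Preservation of [F] leaves the factors 1 and -1. For 1, pairing with [w] forces b = 0, hence x =
   u; for -1 the second alternative results. *)
have /orP[/eqP l1|/eqP l1] : (l == 1) || (l == -1) by rewrite -eqf_sqr l2 expr1n.
  left; have Bwx : B w x = B u w by rewrite xwE {1}wE bform_orth.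
  move: Bwx; rewrite xE l1 scale1r bformDr bformNr bformZr -formE Fw bformC => Bwx.
  have -> : b = 0 by apply: (mulIf u0); rewrite mul0r; move: Bwx; move: (F u) (B u w) => q r; lra.
  by rewrite mulr0 scale0r subr0.
by right; rewrite xE l1 scaleN1r opprB addrNK.
Qed.

(** * Abelian normal subgroups of the orthogonal group *)

Section NormalAbelian.
Variable N : set G.
Hypotheses (nN : is_normal_subgroup N) (aN : forall x y, N x -> N y -> (x * y = y * x)%g).

Lemma normal_conj (A C : G) : N A -> N (C * A * C^-1)%g.
Proof. by move=> NA; have := nN.2 A C^-1%g NA; rewrite conjgE invgK mulgA. Qed.

Lemma normal_commute_refl (C : G) u : N C -> F u != 0 ->
  (C * (refl u * C * refl u) = (refl u * C * refl u) * C)%g.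
Proof. by move=> NC u0; apply: aN => //; rewrite -{2}reflV //; exact: normal_conj. Qed.

(** With w = A v, the product c = r_w r_v equals [A] times a conjugate of its inverse, so it lies in
    [N]; it fixes all vectors orthogonal to v and w. Commuting with its conjugates by reflections
    leaves b = 0 or b^2 = 1 for the normalized product b of w and v. The first is impossible for
    timelike vectors, and the second gives w = b v. *)
Lemma normal_abelian_timelike (A : G) v : N A -> F v < 0 ->
  val A *m v = v \/ val A *m v = - v.
Proof.
move=> NA v0; have vn0 : F v != 0 by rewrite lt_eqF.
set w := val A *m v; have Fw : F w = F v by rewrite form_orth.
have wn0 : F w != 0 by rewrite Fw.
set b := B w v / F v; have Bwv : B w v = b * F v by rewrite divfK.
pose c := (refl w * refl v)%g.
have Nc : N c.
  have [N1 NM NV] := nN.1; rewrite /c.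
  have -> : (refl w * refl v = A * (refl v * A^-1 * (refl v)^-1))%g by rewrite reflV // -refl_conj // !mulgA.
  by apply: NM => //; apply: normal_conj; exact: NV.
have cv : val c *m v = - v + (2 * b) *: w.
  by rewrite orthME refl_self // mulmxN reflE // Fw opprB addrC /b mulrA.
have ccv : val c *m (val c *m v) = (1 - 4 * b ^+ 2) *: v - (4 * b - 8 * b ^+ 3) *: w.
  have cw : val c *m w = - w - (2 * b) *: (v - (2 * b) *: w).
    rewrite orthME (reflE _ vn0) (bformC v) Bwv mulrA mulfK // mulmxBr -scalemxAr refl_self //.
    by rewrite reflE // Bwv Fw mulrA mulfK.
  by rewrite cv mulmxDr mulmxN -scalemxAr cw cv; apply/matrixP => i j; rewrite !mxE; ring.
have [f f0 [vf wf]] := exists_orth2 v w.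
have Ff : 0 < F f.
  by rewrite ltNge; apply: contra f0 => Ff; apply/eqP; exact: timelike_orth v0 vf Ff.
(* F v + s^2 F f vanishes for at most one of s = 1 and s = 2, as F f > 0. *)
have [s s0 u0] : exists2 s : R, s != 0 & F (v + s *: f) != 0.
  have FE' s : F (v + s *: f) = F v + s ^+ 2 * F f.
    by rewrite !bformE (bformC f) vf; ring.
  have [e|ne] := eqVneq (F v + F f) 0; last by exists 1; rewrite ?oner_eq0 // FE' expr1n mul1r.
  by exists 2; rewrite ?pnatr_eq0 // FE'; apply/eqP => e2; move: e e2 Ff; lra.
set u := v + s *: f in u0.
have cf : val c *m f = f.
  by rewrite orthME !reflE // vf mulr0 mul0r scale0r subr0 wf mulr0 mul0r scale0r subr0.
have b_eq : b = 0 \/ b ^+ 2 = 1.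
  have bb x y : b ^+ x.+1 * (b ^+ 2 - 1) ^+ y.+1 = 0 -> b = 0 \/ b ^+ 2 = 1.
    by move/eqP; rewrite mulf_eq0 !expf_eq0 /= subr_eq0 => /orP[] /eqP; [left|right].
  have := @commute_conj_refl c u u0 (normal_commute_refl Nc u0).
  rewrite /u !mulmxDr -!scalemxAr !cf ccv => -[/addIr|].
    move/(congr1 (B v)); rewrite bformDr bformNr !bformZr -formE (bformC v) Bwv => e.
    apply: (bb 1%N 0%N); apply: (mulIf vn0); rewrite mul0r.
    by move: e; move: (F v) => x e; nra.
  rewrite cv; set b' := _ / _ => e.
  have eB z : B z ((1 - 4 * b ^+ 2) *: v - (4 * b - 8 * b ^+ 3) *: w + s *: f + (v + s *: f)) =
    B z ((2 * b') *: (- v + (2 * b) *: w + s *: f)) by rewrite e.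
  (* The element [c] fixes [f], so pairing both sides with [f] compares 2 with 2 b'. *)
  have b'1 : b' = 1.
    have := eB f; rewrite !bformE !(bformC f) vf wf -formE => e1.
    have : s * F f * (b' - 1) = 0 by move: e1; lra.
    by move/eqP; rewrite !mulf_eq0 (negPf s0) (gt_eqF Ff) /= subr_eq0 => /eqP.
  have := eB w; rewrite !bformE wf Bwv -!formE Fw b'1 => e1.
  apply: (bb 0%N 0%N); apply: (mulIf vn0); rewrite mul0r.
  by move: e1; move: (F v) => x e1; nra.
case: b_eq => [b0|b1].
  have w_eq0 : w = 0.
    by apply: (timelike_orth v0); rewrite ?(bformC v) ?Bwv ?b0 ?mul0r // Fw ltW.
  by move: wn0; rewrite w_eq0 formE bform0r eqxx.
have /eqP : w - b *: v = 0.
  apply: (timelike_orth v0); first by rewrite bformDr bformNr bformZr -formE (bformC v) Bwv subrr.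
  have bb : b * (b * F v) = F v by rewrite mulrA -expr2 b1 mul1r.
  by rewrite !bformE (bformC v) Bwv -!formE Fw mulrN opprK !bb subrr add0r addNr.
rewrite subr_eq0 => /eqP ->.
have /orP[/eqP->|/eqP->] : (b == 1) || (b == -1) by rewrite -eqf_sqr b1 expr1n.
  by left; rewrite scale1r.
by right; rewrite scaleN1r.
Qed.

(** Every timelike vector is multiplied by 1 or -1. For x orthogonal to the timelike [e], some e + s
    x is still timelike, and its sign must agree with that of [e]; so [A] is scalar. *)
Lemma normal_abelian_scalar (A : G) : N A -> val A = 1%:M \/ val A = - 1%:M.
Proof.
move=> NA; have [e e0] := exists_timelike; have en0 : F e != 0 by rewrite lt_eqF.
have [t tE t1] : exists2 t : R, val A *m e = t *: e & t = 1 \/ t = -1.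
  have [->|->] := normal_abelian_timelike NA e0; first by exists 1; [rewrite scale1r|left].
  by exists (-1); [rewrite scaleN1r|right].
have perp x : B e x = 0 -> val A *m x = t *: x.
  move=> ex.
  (* This s lies in (0, 1] and satisfies s^2 F x < - F e, so that e + s x is timelike. *)
  pose s := - F e / (1 - F e + `|F x|).
  have d0 : 0 < 1 - F e + `|F x| by have := normr_ge0 (F x); lra.
  have s0 : 0 < s by rewrite divr_gt0 // oppr_gt0.
  have s1 : s <= 1 by rewrite ler_pdivrMr // mul1r; have := normr_ge0 (F x); lra.
  have Fsx : F (e + s *: x) < 0.
    rewrite !bformE (bformC x) ex -!formE !mulr0 addr0 add0r mulrA.
    have sd : s * (1 - F e + `|F x|) = - F e by rewrite divfK // gt_eqF.
    have h1 : s * s * F x <= s * `|F x|.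
      apply: (@le_trans _ _ (s * s * `|F x|)); first by rewrite ler_wpM2l ?ler_norm // mulr_ge0 // ltW.
      by rewrite ler_wpM2r // ger_pMr.
    have h2 := mulr_gt0 s0 (_ : 0 < 1 - F e); have {}h2 := h2 ltac:(lra).
    by move: sd h1 h2; rewrite mulrDr; lra.
  have [t' t'E t't] : exists2 t', val A *m (e + s *: x) = t' *: (e + s *: x) & t' = t \/ t' = - t.
    have [->|->] := normal_abelian_timelike NA Fsx.
      by exists 1; [rewrite scale1r|case: t1 => ->; [left|right; rewrite opprK]].
    by exists (-1); [rewrite scaleN1r|case: t1 => ->; [right|left]].
  move: t'E; rewrite mulmxDr -scalemxAr tE; case: t't => ->.
    rewrite scalerDr => /addrI; rewrite (scalerA t s) (mulrC t s) -(scalerA s t).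
    by apply: (@scalerI R 'cV[R]_k s); rewrite gt_eqF.
  (* The opposite sign would give s A x = -2 t e - t s x; comparing the values of [F] on both sides
     then yields F e = 0. *)
  move=> Ax; have FA : F (s *: (val A *m x)) = s ^+ 2 * F x by rewrite !bformE bform_orth; ring.
  have Ax' : s *: (val A *m x) = (- (2 * t)) *: e - (t * s) *: x.
    by apply: (addrI (t *: e)); rewrite Ax; apply/matrixP => i j; rewrite !mxE; ring.
  have t2 : t ^+ 2 = 1 by case: t1 => ->; rewrite ?sqrrN expr1n.
  move: FA; rewrite Ax' !bformE (bformC x) ex -!formE => FA.
  have : t ^+ 2 * (4 * F e) = (1 - t ^+ 2) * (s ^+ 2 * F x) by move: FA; nra.
  by rewrite t2 subrr mul0r mul1r => e4; exfalso; move: e0 e4; move: (F e) => q; lra.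
suff AE (x : 'cV[R]_k) : val A *m x = t *: x.
  have -> : val A = t%:M.
    apply/matrixP => i j; have := AE (delta_mx j 0); rewrite -colE => /matrixP/(_ i 0).
    by rewrite !mxE eqxx andbT mulr_natr eq_sym.
  by case: t1 => ->; [left|right; rewrite raddfN].
have -> : x = (B e x / F e) *: e + (x - (B e x / F e) *: e) by rewrite addrC subrK.
rewrite mulmxDr -scalemxAr tE perp; last by rewrite bformDr bformNr bformZr -formE divfK ?subrr.
by rewrite [RHS]scalerDr; congr (_ + _); rewrite !scalerA mulrC.
Qed.

End NormalAbelian.

(** Abelian normal subgroups lie in {1, -1}. Connectedness excludes -1: the corner entry takes only
    the values 1 and -1, and would otherwise have to take the value 0. *)
Theorem orthogonal_group_semisimple : is_semisimple_lie_group R G.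
Proof.
split; first exact: orthogonal_group_lie FE JT JU.
move=> N nN _ cN aN; apply/seteqP; split=> [A NA|_ ->]; last by case: nN => -[].
have [A1|A1] := normal_abelian_scalar nN aN NA; first by apply/val_inj.
have cf : continuous (fun C : G => val C 0 0).
  move=> C; apply: (@continuous_comp _ _ _ (val : G -> 'M[R]_k) (fun M : 'M[R]_k => M 0 0)).
    exact: orthogonal_val_continuous.
  exact: coord_continuous.
have cI := connected_continuous_connected cN (continuous_subspaceT cf).
have N1 : N 1%g by case: nN => -[].
have := (connected_intervalP _).1 cI (-1) 1 _ _ 0.
case.
- by exists A => //; rewrite A1 !mxE eqxx.
- by exists 1%g => //; rewrite -[LHS]/((1%:M : 'M[R]_k) 0 0) mxE eqxx.
- by rewrite lerN10 ler01.
move=> C NC; have [->|->] := normal_abelian_scalar nN aN NC; rewrite !mxE eqxx => /eqP.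
  by rewrite oner_eq0.
by rewrite oppr_eq0 oner_eq0.
Qed.

(** * Generation by reflections and the identity component *)

Local Notation G0 := (@identity_component G).

Let mulC := @orthogonalM_continuous R k F.
Let invC := @orthogonalV_continuous R k F.

(** The reflections along the segment form a path from r_v to r_w; multiplied by r_v, it starts at
    the identity. *)
Lemma refl_segment v w : F v != 0 -> (forall t, 0 <= t <= 1 -> F (v + t *: (w - v)) != 0) ->
  G0 (refl w * refl v)%g.
Proof.
move=> v0 seg0; pose u (t : R) := v + t *: (w - v).
have su D : open D -> smooth_mx D u.
  move=> oD i j n; rewrite (_ : (fun t => _) = (fun t => v i j + t * (w - v) i j)); last first.
    by apply/funext => t; rewrite !mxE.
  apply: class_CD => //; first exact: class_C_cst.
  apply: class_CM => //; last exact: class_C_cst.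
  by apply: (@class_C_linear _ R R n D idfun) => t; exact: cvg_id.
have suT D : open D -> smooth_mx D (fun t => (u t)^T).
  move=> oD i j; rewrite (_ : (fun t => _) = (fun t => u t j i)); first exact: su.
  by apply/funext => t; rewrite mxE.
have sF D : open D -> smooth_on D (fun t => F (u t) : R).
  move=> oD; rewrite (_ : (fun t => _) = (fun t => ((u t)^T *m J *m u t) 0 0)); last by apply/funext => t; rewrite FE.
  apply: smooth_mxM (su _ oD) _ _ => //; apply: smooth_mxM (suT _ oD) _ => //; exact: smooth_mx_cst.
pose D := [set t : R | F (u t) != 0].
have oD : open D by apply: open_neq0 => t; exact: (sF _ openT 0%N).
have sr : smooth_mx D (fun t => refl_mx (u t)).
  move=> i j n; rewrite (_ : (fun t => _) =
      (fun t => (1%:M : 'M[R]_k) i j + (- 2 * (F (u t))^-1) * (u t *m ((u t)^T *m J)) i j)); last first.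
    by apply/funext => t; rewrite /refl_mx !mxE; ring.
  apply: class_CD => //; first exact: class_C_cst.
  apply: class_CM => //.
    by apply: class_CM => //; [exact: class_C_cst|apply: class_CV => //; exact: sF].
  apply: smooth_mxM (su _ oD) _ _ _ _ => //; apply: smooth_mxM (suT _ oD) _ => //; exact: smooth_mx_cst.
have cr t : D t -> {for t, continuous (fun t => (refl (u t) * refl v)%g)}.
  move=> Dt; apply: (@continuous_comp _ _ _ (fun t => refl (u t)) (fun y : G => y * refl v)%g).
    apply: continuous_to_orthogonal; apply: continuous_mx => i j.
    have sr' : smooth_mx D (fun t => val (refl (u t))).
      by apply: smooth_mx_congr sr => // s Ds; rewrite val_refl.
    exact: (smooth_mx_continuous sr').
  exact: continuous_mulr.
have cI : connected ((fun t => (refl (u t) * refl v)%g) @` `[0, 1]).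
  apply: connected_continuous_connected; first exact: segment_connected.
  apply: continuous_in_subspaceT => t /set_mem /=; rewrite in_itv /= => t01.
  by apply: cr; exact: seg0.
apply: (identity_component_sub _ cI).
  exists 0; first by rewrite /= in_itv /= lexx ler01.
  by rewrite /u scale0r addr0 reflK.
by exists 1; [rewrite /= in_itv /= lexx ler01|rewrite /u scale1r addrC subrK].
Qed.

(** After replacing w by -w if necessary, which has the same reflection, the segment from v to w
    meets no isotropic vector: multiplied by F v, the terms of [F] along it are nonnegative with
    positive sum. *)
Lemma refl_same_sign v w : 0 < F v * F w -> G0 (refl w * refl v)%g.
Proof.
move=> vw; have v0 : F v != 0 by apply: contraTneq vw => ->; rewrite mul0r ltxx.
have w0 : F w != 0 by apply: contraTneq vw => ->; rewrite mulr0 ltxx.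
wlog Bvw : w vw w0 / 0 <= F v * B v w.
  move=> H; have [|/ltW le] := leP 0 (F v * B v w); first exact: H.
  have FN : F (- w) = F w by rewrite !formE bformNl bformNr opprK.
  rewrite -(reflZ (a := -1)) ?oppr_eq0 ?oner_eq0 // scaleN1r; apply: H; rewrite ?FN //.
  by rewrite bformNr mulrN oppr_ge0.
apply: refl_segment => // t /andP[t0 t1].
have -> : F (v + t *: (w - v)) = (1 - t) ^+ 2 * F v + t ^+ 2 * F w + 2 * (t * (1 - t)) * B v w.
  rewrite !bformE (bformC w v) -!formE; ring.
apply/eqP => e.
have : F v * ((1 - t) ^+ 2 * F v + t ^+ 2 * F w + 2 * (t * (1 - t)) * B v w) = 0 by rewrite e mulr0.
have h1 : 0 <= (t * (1 - t)) * (F v * B v w) by apply: mulr_ge0 => //; apply: mulr_ge0; lra.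
have h2 : 0 < F v ^+ 2 by rewrite exprn_even_gt0.
have h3 : 0 <= (1 - t) ^+ 2 * F v ^+ 2 by rewrite mulr_ge0 ?sqr_ge0.
have h4 : 0 <= t ^+ 2 * (F v * F w) by rewrite mulr_ge0 ?sqr_ge0 // ltW.
have h5 : 0 < (1 - t) ^+ 2 * F v ^+ 2 + t ^+ 2 * (F v * F w).
  have [->|tn0] := eqVneq t 0; first by rewrite subr0 expr1n mul1r expr0n mul0r addr0.
  by apply: ltr_wpDl => //; rewrite mulr_gt0 // exprn_even_gt0.
move: h1 h5; move: (F v) (F w) (B v w) => x y z; nra.
Qed.

(** The Cartan-Dieudonne argument: one or two reflections make the isometry fix one more vector of
    an orthonormal basis. *)
Lemma refl_generation (S : set G) : S 1%g ->
  (forall v A, F v != 0 -> S A -> S (refl v * A)%g) -> forall A, S A.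
Proof.
move=> S1 SM.
pose e (i : nat) : 'cV[R]_k := E *m delta_mx (inord i) 0.
have Fe i : (i < k)%N -> F (e i) != 0.
  by move=> ik; rewrite formE gramE eqxx; case: ifP; rewrite ?opprK ?oppr_eq0 oner_eq0.
have Be i j : (i < k)%N -> (j < k)%N -> i != j -> B (e i) (e j) = 0.
  move=> ik jk ij; rewrite gramE ifN //.
  by apply: contra ij => /eqP/(congr1 val); rewrite /= !inordK // => ->.
suff H i A : (i <= k)%N -> (forall j, (j < k - i)%N -> val A *m e j = e j) -> S A.
  by move=> A; apply: (H k A) => // j; rewrite subnn.
elim: i A => [|i IH] A ik fixA.
  suff -> : A = 1%g by [].
  apply/val_inj; apply: (can_inj (mulmxK EU)); rewrite [RHS]mul1mx.
  apply/matrixP => a j.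
  have := fixA j; rewrite subn0 ltn_ord => /(_ isT); rewrite /e inord_val mulmxA -!colE.
  by move/matrixP/(_ a 0); rewrite !mxE.
set j0 := (k - i.+1)%N; have j0k : (j0 < k)%N by rewrite /j0 ltn_subrL.
have lt_j j : (j < k - i)%N -> (j < j0)%N \/ j = j0.
  by rewrite /j0; move: ik; rewrite leq_eqVlt => ?; case: (ltngtP j (k - i.+1)); [left|lia|right].
set w := val A *m e j0.
have Fw : F w = F (e j0) by rewrite form_orth.
have red v : F v != 0 -> S (refl v * A)%g -> S A.
  by move=> v0 /(SM v _ v0); rewrite mulgA (reflK v0) mul1g.
have fixed v j : F v != 0 -> (j < j0)%N -> B v (e j) = 0 -> val (refl v * A)%g *m e j = e j.
  move=> v0 lj vj; rewrite orthME fixA; last by rewrite /j0 in lj; lia.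
  by rewrite reflE // vj mulr0 mul0r scale0r subr0.
have Bwj j : (j < j0)%N -> B w (e j) = 0.
  move=> lj; have := fixA j; rewrite -/j0 => /(_ ltac:(rewrite /j0 in lj *; lia)) <-.
  by rewrite /w bform_orth Be // ?gtn_eqF //; exact: ltn_trans lj j0k.
have Bej j : (j < j0)%N -> B (e j0) (e j) = 0.
  by move=> lj; rewrite Be ?gtn_eqF //; exact: ltn_trans lj j0k.
(* Since F (w - e) + F (w + e) = 4 F e is nonzero, w - e or w + e is anisotropic. Reflection in the
   former maps w to e; reflection in the latter maps w to -e and is followed by reflection in e. *)
have [Fm|Fm] := eqVneq (F (w - e j0)) 0; last first.
  apply: (red _ Fm); apply: IH; first exact: ltnW.
  move=> j /lt_j[lj|->].
    by apply: fixed => //; rewrite bformDl bformNl Bwj // Bej // subrr.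
  rewrite orthME -/w reflE //.
  have -> : 2 * B (w - e j0) w = F (w - e j0).
    by rewrite !bformE (bformC w) -!formE Fw; ring.
  by rewrite divff // scale1r opprB addrC subrK.
have Fp : F (w + e j0) != 0.
  have : F (w - e j0) + F (w + e j0) = 4 * F (e j0).
    by rewrite !bformE (bformC w) -!formE Fw; ring.
  by rewrite Fm add0r => ->; rewrite mulf_neq0 ?pnatr_eq0 // Fe.
have Fej := Fe _ j0k.
apply: (red _ Fp); rewrite -[(refl _ * A)%g]mul1g -(reflK Fej) -mulgA.
apply: SM => //; apply: IH; first exact: ltnW.
move=> j /lt_j[lj|->]; rewrite orthME.
  rewrite fixed // ?bformDl ?Bwj ?Bej ?addr0 //.
  by rewrite reflE // Bej // mulr0 mul0r scale0r subr0.
rewrite orthME -/w (reflE _ Fp).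
have -> : 2 * B (w + e j0) w = F (w + e j0).
  by rewrite !bformE (bformC w) -!formE Fw; ring.
by rewrite divff // scale1r opprD addrA subrr add0r mulmxN refl_self // opprK.
Qed.

Lemma identity_component_finite_index (H : set G) : is_subgroup H -> finite_index (G0 `&` H) H.
Proof.
pose v : 'cV[R]_k := E *m delta_mx 1 0; pose w : 'cV[R]_k := E *m delta_mx 0 0.
have Fv : F v = 1 by rewrite formE gramE.
have Fw : F w = -1 by rewrite formE gramE.
have v0 : F v != 0 by rewrite Fv oner_eq0.
have w0 : F w != 0 by rewrite Fw oppr_eq0 oner_eq0.
have vw : B v w = 0 by rewrite gramE.
apply: (identity_component_two_cosets mulC invC (reflK v0) (reflK w0) (refl_comm v0 w0 vw)
  (Rf := [set A | exists2 x, F x != 0 & A = refl x])).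
  move=> _ [x x0 ->]; have [x1|x1|x1] := ltgtP (F x) 0; last by rewrite x1 eqxx in x0.
    by right; apply: refl_same_sign; rewrite Fw mulN1r oppr_gt0.
  by left; apply: refl_same_sign; rewrite Fv mul1r.
by move=> S S1 SM; apply: refl_generation => // x A x0; apply: SM; exists x.
Qed.

End Lorentz.

(** * Integral points of orthogonal groups *)

Import (canonicals) mpoly.

(** As a ring morphism, evaluation passes through matrix products, so the equations of the scheme
    can be evaluated as matrix identities. *)
Lemma evalp_is_rmorphism (n : nat) (A : comNzRingType) (v : 'I_n -> A) :
  exists psi : {rmorphism mpoly.mpoly n int -> A},
    (forall p, psi p = mpoly.meval v (mpoly.map_mpoly (fun z : int => z%:~R : A) p)) /\
    (forall i, psi (mpoly.mpolyX int (mpoly.mnm1 i)) = v i) /\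
    (forall z : int, psi z%:~R = z%:~R).
Proof.
exists (mpoly.meval v \o mpoly.map_mpoly intr); split=> // ; split=> [i|z].
  by rewrite /= mpoly.map_mpolyX mpoly.mevalXU.
by rewrite rmorph_int.
Qed.

Section OrthogonalScheme.
Variables (k : nat) (J : 'M[int]_k).
Local Notation N := (k + 1)%N.
Local Notation P := (mpoly.mpoly (N * N) int).

Definition generic_mx : 'M[P]_N := \matrix_(i, j) mpoly.mpolyX int (mpoly.mnm1 (mxvec_index i j)).

(* The group scheme of the matrices [diag(a, t)] in [SL_(k+1)] with [a^T J a = J]. *)
Definition orthogonal_scheme : set P :=
  [set p | [\/ exists i, exists j, p = ursubmx generic_mx i j,
               exists i, exists j, p = dlsubmx generic_mx i j |
               exists i, exists j, p = ((ulsubmx generic_mx)^T *m map_mx intr J *m ulsubmx generic_mx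
                                        - map_mx intr J) i j]].

(** The extra entry [t] compensates the determinant of [a], so that isometries of determinant -1
    also give points of SL. *)
Lemma orthogonal_scheme_points (A : comNzRingType) (g : 'M[A]_N) :
  scheme_points orthogonal_scheme g <->
  \det g = 1 /\ exists (a : 'M[A]_k) (t : 'M[A]_1),
    g = block_mx a 0 0 t /\ a^T *m map_mx intr J *m a = map_mx intr J.
Proof.
have [psi [psiE [psiX psiZ]]] := evalp_is_rmorphism (fun l => mxvec g 0 l).
have gE : map_mx psi generic_mx = g.
  by apply/matrixP => i j; rewrite !mxE psiX mxvecE.
have JE : map_mx psi (map_mx intr J) = map_mx intr J.
  by apply/matrixP => i j; rewrite !mxE psiZ.
have eJ : map_mx psi ((ulsubmx generic_mx)^T *m map_mx intr J *m ulsubmx generic_mx - map_mx intr J) =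
  (ulsubmx g)^T *m map_mx intr J *m ulsubmx g - map_mx intr J.
  by rewrite map_mxB !map_mxM -map_trmx map_ulsubmx gE JE.
split=> [[dg Ig]|[dg [a [t [gB oa]]]]].
  split=> //; exists (ulsubmx g), (drsubmx g); split.
    rewrite -[LHS]submxK; congr block_mx; apply/matrixP => i j; rewrite [RHS]mxE -gE.
      by rewrite -map_ursubmx mxE psiE; apply: Ig; apply: Or31; exists i, j.
    by rewrite -map_dlsubmx mxE psiE; apply: Ig; apply: Or32; exists i, j.
  apply/eqP; rewrite -subr_eq0 -eJ; apply/eqP/matrixP => i j; rewrite mxE [RHS]mxE psiE.
  by apply: Ig; apply: Or33; exists i, j.
split=> // p Ip; rewrite -psiE.
have psim (u v : nat) (M : 'M[P]_(u, v)) i j : psi (M i j) = (map_mx psi M) i j by rewrite mxE.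
case: Ip => -[i [j ->]]; rewrite psim.
- by rewrite map_ursubmx gE gB block_mxKur mxE.
- by rewrite map_dlsubmx gE gB block_mxKdl mxE.
- by rewrite eJ gB block_mxKul oa subrr mxE.
Qed.

(** Over an arbitrary ring [J] may become singular, so the inverse of [a] comes from its adjugate
    and the relation det a * t = 1. *)
Lemma orthogonal_scheme_subgroup : is_subgroup_scheme orthogonal_scheme.
Proof.
move=> A; split.
- apply/orthogonal_scheme_points; rewrite det1; split=> //; exists 1%:M, 1%:M.
  by rewrite -scalar_mx_block trmx1 mul1mx mulmx1.
- move=> g h /orthogonal_scheme_points[dg [a [t [gE oa]]]] /orthogonal_scheme_points[dh [b [s [hE ob]]]].
  apply/orthogonal_scheme_points; rewrite det_mulmx dg dh mulr1; split=> //; exists (a *m b), (t *m s).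
  rewrite gE hE mulmx_block !mulmx0 !mul0mx !addr0 !add0r; split=> //.
  have -> : (a *m b)^T *m map_mx intr J *m (a *m b) = b^T *m (a^T *m map_mx intr J *m a) *m b.
    by rewrite trmx_mul !mulmxA.
  by rewrite oa ob.
- move=> g /orthogonal_scheme_points[dg [a [t [gE oa]]]].
  have dat : \det a * t 0 0 = 1 by rewrite -dg gE det_ublock det_mx11.
  pose b := t 0 0 *: \adj a; pose s := (\det a)%:M : 'M[A]_1.
  have ab : a *m b = 1%:M by rewrite -scalemxAr mul_mx_adj scale_scalar_mx mulrC dat.
  have ts : t *m s = 1%:M by rewrite [t]mx11_scalar -scalar_mxM mulrC dat.
  exists (block_mx b 0 0 s); last by rewrite gE mulmx_block !mulmx0 !mul0mx !addr0 !add0r ab ts -scalar_mx_block.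
  apply/orthogonal_scheme_points; split.
    have := congr1 determinant (erefl (g *m block_mx b 0 0 s)); rewrite {1}gE mulmx_block !mulmx0 !mul0mx !addr0 !add0r ab ts.
    by rewrite -scalar_mx_block det1 det_mulmx dg mul1r.
  exists b, s; split=> //.
  rewrite -{1}oa !mulmxA -trmx_mul ab trmx1 mul1mx -mulmxA ab mulmx1 //.
Qed.

End OrthogonalScheme.

Lemma map_intr_int p q (M : 'M[int]_(p, q)) : map_mx (intr : int -> int) M = M.
Proof. by apply/matrixP => i j; rewrite mxE intz. Qed.

Lemma det_conj_mx (K : fieldType) n (h X : 'M[K]_n) : h \in unitmx ->
  \det (invmx h *m X *m h) = \det X.
Proof.
by move=> hU; rewrite !det_mulmx det_inv mulrAC mulVf ?mul1r // -unitfE; exact: hU.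
Qed.

Section ArithmeticOrthogonal.
Variables (R : realType) (k : nat) (F : 'cV[R]_k -> R) (J : 'M[R]_k) (JZ : 'M[int]_k).
Hypotheses (FE : forall v, F v = (v^T *m J *m v) 0 0) (JT : J^T = J) (JU : J \in unitmx).
Hypothesis JZE : map_mx intr JZ = 2 *: J.
Local Notation G := (orthogonal_group F).

(** The stabilizer of the lattice h Z^k: an integral isometry has determinant 1 or -1, so its
    inverse is integral too. *)
Definition integral_orthogonal (h : G) : set G :=
  [set A | exists B : 'M[int]_k, val A = val h *m map_mx intr B *m invmx (val h)].

Lemma det_orthogonal (A : G) : \det (val A) * \det (val A) = 1.
Proof.
have := congr1 determinant (orthogonal_isometry FE JT JU A).
rewrite !det_mulmx det_tr => e; have dJ : \det J != 0 by rewrite -unitfE; exact: JU.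
by apply: (mulIf dJ); rewrite mul1r -[RHS]e; ring.
Qed.

(** The scheme needs an integral Gram matrix, hence twice [J]; over the reals the factor 2 leaves
    the isometries unchanged. *)
Let oJZ (a : 'M[R]_k) : (a^T *m map_mx intr JZ *m a = map_mx intr JZ) <-> orthogonal_set F a.
Proof.
rewrite JZE -scalemxAr -scalemxAl; apply: iff_trans (iff_sym (orthogonal_setP FE JT JU a)).
by split=> [/scalerI -> //|->]; rewrite ?pnatr_eq0.
Qed.

(** Conjugation by [h] carries the stabilizer to the integral points, and the second block of [f]
    records the determinant. *)
Lemma integral_orthogonal_arithmetic (h : G) : is_semisimple_lie_group R G ->
  arithmetic_subgroup R (integral_orthogonal h).
Proof.
move=> ssG; have hU := orthogonal_unit h.
pose f (A : G) : 'M[R]_(k + 1) :=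
  block_mx (invmx (val h) *m val A *m val h) 0 0 (\det (val A))%:M.
pose f' (M : 'M[R]_(k + 1)) : G := insubd (orthogonal1 F) (val h *m ulsubmx M *m invmx (val h)).
have fK : cancel f f'.
  move=> A; rewrite /f' /f block_mxKul !mulmxA mulmxV // mul1mx mulmxK //; exact: valKd.
have pts M : scheme_points (orthogonal_scheme JZ) (M : 'M[R]_(k + 1)) -> exists A, f A = M.
  move=> /orthogonal_scheme_points[dM [a [t [ME /oJZ oa]]]].
  pose a' : G := insubd (orthogonal1 F) a.
  have a'E : val a' = a by rewrite /a' insubdK //; exact/mem_set.
  have haE : val (h * a' * h^-1)%g = val h *m a *m invmx (val h) by rewrite -a'E.
  exists (h * a' * h^-1)%g; rewrite /f ME haE; congr block_mx.
    by rewrite !mulmxA mulVmx // mul1mx mulmxKV.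
  have -> : \det (val h *m a *m invmx (val h)) = \det a.
    rewrite !det_mulmx det_inv.
    by rewrite mulrAC divff ?mul1r // -unitfE; exact: hU.
  have dat : \det a * t 0 0 = 1 by rewrite -dM ME det_ublock det_mx11.
  have daa : \det a * \det a = 1 by rewrite -a'E det_orthogonal.
  rewrite [t]mx11_scalar; congr _%:M.
  by rewrite -[LHS]mulr1 -dat mulrA daa mul1r.
have fpts A : scheme_points (orthogonal_scheme JZ) (f A).
  apply/orthogonal_scheme_points; split.
    by rewrite det_ublock det_scalar1 det_conj_mx // det_orthogonal.
  exists (invmx (val h) *m val A *m val h), (\det (val A))%:M; split=> //; apply/oJZ.
  exact: set_mem (valP (h^-1 * A * h)%g).
have cf : continuous f.
  move=> A; apply: (@continuous_comp _ _ _ (val : G -> 'M[R]_k) (fun M : 'M[R]_k =>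
     block_mx (invmx (val h) *m M *m val h) 0 0 (\det M)%:M : 'M[R]_(k + 1))).
    exact: orthogonal_val_continuous.
  have sc : @smooth_mx R 'M[R]_k setT _ _ (fun M => invmx (val h) *m M *m val h).
    by do 2?apply: smooth_mxM; try exact: openT; try exact: smooth_mx_cst; exact: smooth_mx_id.
  have sd := smooth_det (@openT _) (@smooth_mx_id R k k setT).
  apply: continuous_mx => i j; rewrite -(splitK i) -(splitK j).
  case: (fintype.split i) => i'; case: (fintype.split j) => j' /=.
  - rewrite (_ : (fun y => _) = (fun y => (invmx (val h) *m y *m val h) i' j')); last first.
      by apply/funext => y; rewrite block_mxEul.
    exact: (sc i' j' 0%N).
  - rewrite (_ : (fun y => _) = cst 0); first exact: cst_continuous.
    by apply/funext => y; rewrite block_mxEur mxE.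
  - rewrite (_ : (fun y => _) = cst 0); first exact: cst_continuous.
    by apply/funext => y; rewrite block_mxEdl mxE.
  - rewrite (_ : (fun y => _) = (fun y => \det y)); last first.
      by apply/funext => y; rewrite block_mxEdr !ord1 mxE.
    exact: (sd 0%N).
apply: (@arithmetic_Zpoints R G _ _ (orthogonal_scheme JZ) f) => //.
- exact: orthogonal_scheme_subgroup.
- split=> //.
  + move=> A C; rewrite /f -[val (A * C)%g]/(val A *m val C) mulmx_block !mulmx0 !mul0mx !addr0 !add0r.
    by rewrite det_mulmx scalar_mxM !mulmxA mulmxK.
  + by apply/seteqP; split=> [_ [A _ <-]//|M /pts[A AM]]; exists A.
  + exists f' => //.
    have cg : continuous (fun M : 'M[R]_(k + 1) => val h *m ulsubmx M *m invmx (val h)).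
      move=> M; apply: continuous_mx => i j.
      have sg : @smooth_mx R 'M[R]_(k + 1) setT _ _ (fun M => val h *m ulsubmx M *m invmx (val h)).
        have su : @smooth_mx R 'M[R]_(k + 1) setT _ _ ulsubmx.
          move=> a b n; rewrite (_ : (fun x => _) = (fun x : 'M[R]_(k + 1) => x (lshift 1 a) (lshift 1 b))).
            exact: smooth_mx_id.
          by apply/funext => x; rewrite !mxE.
        by do 2?apply: smooth_mxM; try exact: openT; try exact: smooth_mx_cst.
      exact: (sg i j 0%N).
    (* [f'] takes a default value off the group; on the points of the scheme its matrix agrees with
       a globally continuous formula. *)
    have cf' : {within scheme_points (orthogonal_scheme JZ) (A := R), continuous (fun M => val (f' M))}.
      apply: subspace_eq_continuous (continuous_subspaceT cg) => M /set_mem /pts[A <-].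
      rewrite -[LHS]/(val h *m ulsubmx (f A) *m invmx (val h)) -[RHS]/(val (f' (f A))).
      by rewrite fK /f block_mxKul !mulmxA mulmxV // mul1mx mulmxK.
    by move=> M; apply: continuous_to_orthogonal; exact: cf'.
- apply/seteqP; split.
    move=> _ [A [B AB] <-]; have fA := fpts A.
    have eB : invmx (val h) *m val A *m val h = map_mx intr B.
      by rewrite AB !mulmxA mulVmx // mul1mx mulmxKV.
    pose dB := \det B.
    exists (block_mx B 0 0 dB%:M); last first.
      rewrite map_block_mx !map_mx0 map_scalar_mx /f eB; congr block_mx; congr _%:M.
      by rewrite /= /dB -det_map_mx -eB det_conj_mx.
    apply/orthogonal_scheme_points; split.
      rewrite det_ublock det_scalar1 -/dB; apply: (@intr_inj R); rewrite rmorphM /= -det_map_mx -eB.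
      by rewrite det_conj_mx // det_orthogonal.
    exists B, dB%:M; split=> //; rewrite map_intr_int.
    have inj : injective (map_mx (intr : int -> R) : 'M[int]_k -> 'M[R]_k).
      by move=> X Y /matrixP XY; apply/matrixP => i j; have := XY i j; rewrite !mxE => /intr_inj.
    apply: inj; rewrite !map_mxM -map_trmx -eB; apply/oJZ.
    exact: set_mem (valP (h^-1 * A * h)%g).
  move=> _ [M MZ <-]; have MR : scheme_points (orthogonal_scheme JZ) (map_mx intr M : 'M[R]_(k + 1)).
    move: MZ => /orthogonal_scheme_points[dM [a [t [ME oa]]]]; apply/orthogonal_scheme_points; split.
      by rewrite det_map_mx dM.
    exists (map_mx intr a), (map_mx intr t); rewrite ME map_block_mx !map_mx0; split=> //.
    by rewrite map_intr_int in oa; rewrite map_trmx -!map_mxM oa.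
  have [A AM] := pts _ MR; exists A => //.
  by exists (ulsubmx M); rewrite map_ulsubmx -AM /f block_mxKul !mulmxA mulmxV // mul1mx mulmxK.
Qed.

End ArithmeticOrthogonal.

(** * Clifford matrices *)

Section CliffordInvolutions.
Variables (A : comNzRingType) (m : nat) (q : 'I_m -> A).
Local Notation C := (clifford q).
Implicit Types (x y : C) (S : {set 'I_m}).

Lemma cl_parityD x y : cl_parity (x + y) = cl_parity x + cl_parity y.
Proof. by apply/ffunP => S; rewrite !ffunE mulrDr. Qed.

Lemma cl_transpD x y : cl_transp (x + y) = cl_transp x + cl_transp y.
Proof. by apply/ffunP => S; rewrite !ffunE mulrDr. Qed.

Lemma cl_parityZ (a : A) x : cl_parity (a *: x) = a *: cl_parity x.
Proof. by apply/ffunP => S; rewrite !ffunE [LHS]mulrCA. Qed.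

Lemma cl_transpZ (a : A) x : cl_transp (a *: x) = a *: cl_transp x.
Proof. by apply/ffunP => S; rewrite !ffunE [LHS]mulrCA. Qed.

Lemma cl_parityN x : cl_parity (- x) = - cl_parity x.
Proof. by rewrite -scaleN1r cl_parityZ scaleN1r. Qed.

Lemma cl_transpN x : cl_transp (- x) = - cl_transp x.
Proof. by rewrite -scaleN1r cl_transpZ scaleN1r. Qed.

Lemma cl_parityK x : cl_parity (cl_parity x) = x.
Proof. by apply/ffunP => S; rewrite !ffunE mulrA -expr2 sqrr_sign mul1r. Qed.

Lemma cl_transpK x : cl_transp (cl_transp x) = x.
Proof. by apply/ffunP => S; rewrite !ffunE mulrA -expr2 sqrr_sign mul1r. Qed.

Lemma cl_transp_parity x : cl_transp (cl_parity x) = cl_parity (cl_transp x).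
Proof. by apply/ffunP => S; rewrite !ffunE [LHS]mulrCA. Qed.

Lemma cl_parity1 : cl_parity (1 : C) = 1.
Proof.
apply/ffunP => S; rewrite !ffunE; case: eqP => [->|_]; last by rewrite mulr0.
by rewrite cards0 mul1r.
Qed.

Lemma cl_transp1 : cl_transp (1 : C) = 1.
Proof.
apply/ffunP => S; rewrite !ffunE; case: eqP => [->|_]; last by rewrite mulr0.
by rewrite cards0 mul1r.
Qed.

Lemma cl_parity0 : cl_parity (0 : C) = 0.
Proof. by apply/ffunP => S; rewrite !ffunE mulr0. Qed.

Lemma cl_transp0 : cl_transp (0 : C) = 0.
Proof. by apply/ffunP => S; rewrite !ffunE mulr0. Qed.

Lemma cl_conjD x y : cl_conj (x + y) = cl_conj x + cl_conj y.
Proof. by rewrite /cl_conj cl_parityD cl_transpD. Qed.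

Lemma cl_conjZ (a : A) x : cl_conj (a *: x) = a *: cl_conj x.
Proof. by rewrite /cl_conj cl_parityZ cl_transpZ. Qed.

Lemma cl_conjN x : cl_conj (- x) = - cl_conj x.
Proof. by rewrite /cl_conj cl_parityN cl_transpN. Qed.

Lemma cl_conjM x y : cl_conj (x * y) = cl_conj y * cl_conj x.
Proof. by rewrite /cl_conj cl_parityM cl_transpM. Qed.

Lemma cl_conjK x : cl_conj (cl_conj x) = x.
Proof. by rewrite /cl_conj cl_transp_parity cl_transpK cl_parityK. Qed.

Lemma cl_conj1 : cl_conj (1 : C) = 1.
Proof. by rewrite /cl_conj cl_parity1 cl_transp1. Qed.

Lemma cl_conj0 : cl_conj (0 : C) = 0.
Proof. by rewrite /cl_conj cl_parity0 cl_transp0. Qed.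

Lemma cl_conj_alg (a : A) : cl_conj (a%:A : C) = a%:A.
Proof. by rewrite cl_conjZ cl_conj1. Qed.

Lemma cl_algE (a : A) S : (a%:A : C) S = if S == finset.set0 then a else 0.
Proof. by rewrite !ffunE; case: eqP => _; [exact: mulr1|exact: mulr0]. Qed.

Lemma cl_scalarP x : is_cl_scalar x <-> forall S, S != finset.set0 -> x S = 0.
Proof.
split=> [[r ->] S S0|x0]; first by rewrite cl_algE (negPf S0).
exists (x finset.set0); apply/ffunP => S; rewrite cl_algE.
by case: eqP => [->//|/eqP/x0].
Qed.

Lemma cl_vecE (v : 'cV[A]_m.+1) S : cl_vec q v S =
  (if S == finset.set0 then v 0 0 else 0) + \sum_(j < m) (if S == [set j]%SET then v (lift ord0 j) 0 else 0).
Proof.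
rewrite /cl_vec ffunE cl_algE; congr (_ + _); rewrite sum_ffunE; apply: eq_bigr => j _.
by rewrite !ffunE; case: eqP => _; [exact: mulr1|exact: mulr0].
Qed.

Lemma cl_vec0 (v : 'cV[A]_m.+1) : cl_vec q v finset.set0 = v 0 0.
Proof.
rewrite cl_vecE eqxx big1 ?addr0 // => j _; case: eqP => // /setP/(_ j).
by rewrite !inE eqxx.
Qed.

Lemma cl_vec1 (v : 'cV[A]_m.+1) j : cl_vec q v [set j]%SET = v (lift ord0 j) 0.
Proof.
rewrite cl_vecE (_ : (_ == _) = false); last first.
  by apply/eqP => /setP/(_ j); rewrite !inE eqxx.
rewrite add0r (bigD1 j) //= eqxx big1 ?addr0 // => i ij; case: eqP => // /finset.set1_inj e.
by rewrite e eqxx in ij.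
Qed.

Lemma cl_vecP x : is_cl_vec x <-> forall S, (1 < #|S|)%N -> x S = 0.
Proof.
split=> [[v ->] S S1|x0].
  rewrite cl_vecE ifN ?add0r; last by apply: contraTneq S1 => ->; rewrite cards0.
  by rewrite big1 // => j _; rewrite ifN //; apply: contraTneq S1 => ->; rewrite cards1.
exists (\col_i (if unlift ord0 i is Some j then x [set j]%SET else x finset.set0)).
apply/ffunP => S; case: (ltngtP #|S| 1%N) => [| S1 | /eqP/cards1P[j ->]].
- by rewrite ltnS leqn0 cards_eq0 => /eqP->; rewrite cl_vec0 mxE unlift_none.
- rewrite (x0 S S1); set v := \col_i _; rewrite (cl_vecE v S) ifN ?add0r; last by apply: contraTneq S1 => ->; rewrite cards0.
  by rewrite big1 // => j _; rewrite ifN //; apply: contraTneq S1 => ->; rewrite cards1.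
- by rewrite cl_vec1 mxE liftK.
Qed.

Lemma cl_vec_inj : injective (@cl_vec A m q).
Proof.
move=> v w vw; apply/matrixP => i j; rewrite (ord1 j); case: (unliftP ord0 i) => [k|] ->.
  by rewrite -!cl_vec1 vw.
by rewrite -[ord0]/(0 : 'I_m.+1) -!cl_vec0 vw.
Qed.

Lemma cl_vecD v w : cl_vec q (v + w) = cl_vec q v + cl_vec q w.
Proof.
rewrite /cl_vec mxE scalerDl addrACA -big_split /=; congr (_ + _).
by apply: eq_bigr => j _; rewrite mxE scalerDl.
Qed.

Lemma cl_vecZ (a : A) v : cl_vec q (a *: v) = a *: cl_vec q v.
Proof.
rewrite /cl_vec mxE -scalerA scalerDr scaler_sumr; congr (_ + _).
by apply: eq_bigr => j _; rewrite mxE scalerA.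
Qed.

Lemma is_cl_scalarD x y : is_cl_scalar x -> is_cl_scalar y -> is_cl_scalar (x + y).
Proof. by move=> [a ->] [b ->]; exists (a + b); rewrite scalerDl. Qed.

Lemma is_cl_scalarZ (a : A) x : is_cl_scalar x -> is_cl_scalar (a *: x).
Proof. by move=> [b ->]; exists (a * b); rewrite scalerA. Qed.

Lemma is_cl_vecD x y : is_cl_vec x -> is_cl_vec y -> is_cl_vec (x + y).
Proof. by move=> [a ->] [b ->]; exists (a + b); rewrite cl_vecD. Qed.

Lemma is_cl_vecZ (a : A) x : is_cl_vec x -> is_cl_vec (a *: x).
Proof. by move=> [b ->]; exists (a *: b); rewrite cl_vecZ. Qed.

Lemma cl_transp_vec x : is_cl_vec x -> cl_transp x = x.
Proof.
move=> /cl_vecP x0; apply/ffunP => S; rewrite ffunE; have [S1|S1] := ltnP 1 #|S|.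
  by rewrite x0 // mulr0.
by rewrite bin_small // mul1r.
Qed.

Lemma cl_conj_vec (v : 'cV[A]_m.+1) :
  cl_conj (cl_vec q v) = (v 0 0)%:A - \sum_(j < m) v (lift ord0 j) 0 *: cl_gen q j.
Proof.
rewrite /cl_conj cl_transp_parity (cl_transp_vec (ex_intro _ v erefl)) /cl_vec cl_parityD.
rewrite cl_parityZ cl_parity1 -sumrN; congr (_ + _).
rewrite (big_morph (@cl_parity A m q) cl_parityD cl_parity0); apply: eq_bigr => j _.
by rewrite cl_parityZ cl_parity_gen scalerN.
Qed.

Lemma cl_basis_rec S k : k \in S -> exists b : bool,
  cl_basis q S = (-1) ^+ b *: (cl_gen q k * cl_basis q (S :\ k)%SET).
Proof.
move=> kS; rewrite /cl_gen cl_basisM.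
have -> : symdiff [set k]%SET (S :\ k)%SET = S.
  by apply/setP => j; rewrite !inE; case: eqP => [->|] //=.
rewrite /cl_coef (_ : [set k]%SET :&: (S :\ k)%SET = finset.set0); last first.
  by apply/setP => j; rewrite !inE; case: eqP.
rewrite big_set0 mulr1; set n := #|_|; exists (odd n).
by rewrite signr_odd scalerA -expr2 sqrr_sign scale1r.
Qed.

Lemma cl_basis_ind (P : C -> Prop) : P 1 -> (forall x, P x -> P (- x)) ->
  (forall k x, P x -> P (cl_gen q k * x)) -> forall S, P (cl_basis q S).
Proof.
move=> P1 PN PM S; elim: {S}#|S| {-2}S (erefl #|S|) => [|n IH] S.
  by move/eqP; rewrite cards_eq0 => /eqP->.
move=> cS; have /card_gt0P[k kS] : (0 < #|S|)%N by rewrite cS.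
have [b ->] := cl_basis_rec kS.
have Pk : P (cl_gen q k * cl_basis q (S :\ k)%SET).
  by apply: PM; apply: IH; move: cS; rewrite (cardsD1 k) kS => -[].
by case: b; rewrite ?scaleN1r ?scale1r //; apply: PN.
Qed.

(** Moving e_j across e_S costs a sign for each factor other than e_j, whereas parity supplies a
    sign for every factor; only a factor e_j leaves one over. *)
Lemma cl_gen_parity j S :
  cl_gen q j * cl_parity (cl_basis q S) = (-1) ^+ (j \in S) *: (cl_basis q S * cl_gen q j).
Proof.
elim: {S}#|S| {-2}S (erefl #|S|) => [|n IH] S.
  move/eqP; rewrite cards_eq0 => /eqP->; rewrite inE scale1r -[cl_basis _ _]/(1 : C).
  by rewrite cl_parity1 mulr1 mul1r.
move=> cS; have /card_gt0P[k kS] : (0 < #|S|)%N by rewrite cS.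
have [b ->] := cl_basis_rec kS.
have {}IH := IH (S :\ k)%SET _; rewrite cl_parityZ cl_parityM cl_parity_gen -!scalerAr -!scalerAl.
rewrite scalerA [in RHS]mulrC -scalerA; congr (_ *: _).
have cS' : #|(S :\ k)%SET| = n by move: cS; rewrite (cardsD1 k) kS => -[].
have [jk|jk] := eqVneq j k.
  rewrite -jk in IH *; rewrite jk kS scaleN1r mulNr mulrN -jk IH ?jk // !inE eqxx /= scale1r.
  by rewrite mulrA.
rewrite mulNr mulrN mulrA (cl_gen_anti _ jk) mulNr opprK -mulrA IH // !inE jk /=.
by rewrite -scalerAr mulrA.
Qed.

(** Multiplication by e_S brings the coordinate at [S] to the constant term, so that later only
    constant terms have to be bounded. *)
Lemma cl_basis_coord x S : (x * cl_basis q S) finset.set0 = cl_coef q S S * x S.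
Proof.
rewrite ffunE (bigD1 S) //= symdiffs0 cl_basisE eqxx mulr1 big1 ?addr0 // => T TS.
by rewrite symdiffs0 cl_basisE (negPf TS) !mulr0.
Qed.

End CliffordInvolutions.

Section Matrices2.
Variables (A : comNzRingType) (m : nat) (q : 'I_m -> A).
Local Notation C := (clifford q).
Local Notation M2 := ('M[C]_2).
Implicit Types (a b c d x : C) (g h H : M2).

Definition mk2 a b c d : M2 :=
  \matrix_(i, j) (if i == 0 then (if j == 0 then a else b) else (if j == 0 then c else d)).

Lemma mk2E00 a b c d : mk2 a b c d 0 0 = a. Proof. by rewrite mxE. Qed.
Lemma mk2E01 a b c d : mk2 a b c d 0 1 = b. Proof. by rewrite mxE. Qed.
Lemma mk2E10 a b c d : mk2 a b c d 1 0 = c. Proof. by rewrite mxE. Qed.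
Lemma mk2E11 a b c d : mk2 a b c d 1 1 = d. Proof. by rewrite mxE. Qed.
Definition mk2E := (mk2E00, mk2E01, mk2E10, mk2E11).

Lemma ord2P (P : 'I_2 -> Prop) : P 0 -> P 1 -> forall i, P i.
Proof. by move=> P0 P1 [[|[|//]] Hi]; [move: P0|move: P1]; congr P; apply: val_inj. Qed.

Lemma mk2_ext g h : g 0 0 = h 0 0 -> g 0 1 = h 0 1 -> g 1 0 = h 1 0 -> g 1 1 = h 1 1 -> g = h.
Proof.
move=> e00 e01 e10 e11; apply/matrixP => i j.
by move: i j; apply: ord2P; apply: ord2P.
Qed.

Lemma mk2_eta g : g = mk2 (g 0 0) (g 0 1) (g 1 0) (g 1 1).
Proof. by apply: mk2_ext; rewrite mk2E. Qed.

Lemma mulmx2E g h i j : (g *m h) i j = g i 0 * h 0 j + g i 1 * h 1 j.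
Proof. by rewrite mxE big_ord_recl big_ord1; congr (_ + g _ _ * h _ _); apply: val_inj. Qed.

Lemma mk2M a b c d a' b' c' d' : mk2 a b c d *m mk2 a' b' c' d' =
  mk2 (a * a' + b * c') (a * b' + b * d') (c * a' + d * c') (c * b' + d * d').
Proof. by apply: mk2_ext; rewrite mulmx2E !mk2E. Qed.

Lemma mk2D a b c d a' b' c' d' : mk2 a b c d + mk2 a' b' c' d' =
  mk2 (a + a') (b + b') (c + c') (d + d').
Proof. by apply: mk2_ext; rewrite mxE !mk2E. Qed.

Lemma mk2N a b c d : - mk2 a b c d = mk2 (- a) (- b) (- c) (- d).
Proof. by apply: mk2_ext; rewrite mxE !mk2E. Qed.

Lemma mk2_1 : 1%:M = mk2 1 0 0 1 :> M2.
Proof. by apply: mk2_ext; rewrite !mk2E mxE. Qed.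

(* [hash g] is the inverse of [g] when [SL2 g], and [ctr g] its conjugate transpose. *)
Definition hash g : M2 :=
  mk2 (cl_transp (g 1 1)) (- cl_transp (g 0 1)) (- cl_transp (g 1 0)) (cl_transp (g 0 0)).
Definition ctr g : M2 :=
  mk2 (cl_conj (g 0 0)) (cl_conj (g 1 0)) (cl_conj (g 0 1)) (cl_conj (g 1 1)).
Definition par g : M2 :=
  mk2 (cl_parity (g 0 0)) (cl_parity (g 0 1)) (cl_parity (g 1 0)) (cl_parity (g 1 1)).

Lemma hash_mul g h : hash (g *m h) = hash h *m hash g.
Proof.
rewrite /hash mk2M !mulmx2E !cl_transpD !cl_transpM !(mulrN, mulNr) !opprK !opprD.
by apply: mk2_ext; rewrite !mk2E // addrC.
Qed.

Lemma hashK g : hash (hash g) = g.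
Proof. by rewrite /hash !mk2E !cl_transpN !cl_transpK !opprK -mk2_eta. Qed.

Lemma hashN g : hash (- g) = - hash g.
Proof. by rewrite /hash mk2N !mxE !cl_transpN. Qed.

Lemma ctr_mul g h : ctr (g *m h) = ctr h *m ctr g.
Proof. by rewrite /ctr mk2M !mulmx2E !cl_conjD !cl_conjM. Qed.

Lemma ctrK g : ctr (ctr g) = g.
Proof. by rewrite /ctr !mk2E !cl_conjK -mk2_eta. Qed.

Lemma ctrN g : ctr (- g) = - ctr g.
Proof. by rewrite /ctr mk2N !mxE !cl_conjN. Qed.

Lemma par_mul g h : par (g *m h) = par g *m par h.
Proof. by rewrite /par mk2M !mulmx2E !cl_parityD !cl_parityM. Qed.

Lemma parK g : par (par g) = g.
Proof. by rewrite /par !mk2E !cl_parityK -mk2_eta. Qed.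

Lemma parD g h : par (g + h) = par g + par h.
Proof. by rewrite /par mk2D !mxE !cl_parityD. Qed.

Lemma par1 : par 1%:M = 1%:M.
Proof. by rewrite mk2_1 /par !mk2E !cl_parity1 !cl_parity0. Qed.

Lemma ctr_wE g : ctr g *m mk2 0 1 (-1) 0 = mk2 0 1 (-1) 0 *m par (hash g).
Proof.
rewrite /ctr /par /hash !mk2E !mk2M !(mulr0, mul0r, mulr1, mul1r, addr0, add0r, mulrN1, mulN1r).
by rewrite /cl_conj !cl_parityN !opprK -!cl_transp_parity.
Qed.

Definition is_herm H : Prop :=
  [/\ is_cl_scalar (H 0 0), is_cl_scalar (H 1 1), is_cl_vec (H 0 1) & H 1 0 = cl_conj (H 0 1)].

Definition preserves_herm g : Prop := forall H, is_herm H -> is_herm (g *m H *m ctr g).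

Lemma is_herm_ctr H : is_herm H -> ctr H = H.
Proof.
case=> [[y y0] [z z1] _ e10]; apply: mk2_ext; rewrite !mk2E ?e10 ?cl_conjK //.
  by rewrite y0 cl_conj_alg.
by rewrite z1 cl_conj_alg.
Qed.

(** The coefficients of y, z and x in these entries are the expressions occurring in the definition
    of [SL2]. *)
Lemma herm_actionE g (y z : A) x :
  let H := g *m mk2 y%:A x (cl_conj x) z%:A *m ctr g in
  [/\ H 0 0 = y *: (g 0 0 * cl_conj (g 0 0)) + z *: (g 0 1 * cl_conj (g 0 1))
        + (g 0 0 * x * cl_conj (g 0 1) + g 0 1 * cl_conj x * cl_conj (g 0 0)),
      H 1 1 = y *: (g 1 0 * cl_conj (g 1 0)) + z *: (g 1 1 * cl_conj (g 1 1))
        + (g 1 0 * x * cl_conj (g 1 1) + g 1 1 * cl_conj x * cl_conj (g 1 0))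
    & H 0 1 = y *: (g 0 0 * cl_conj (g 1 0)) + z *: (g 0 1 * cl_conj (g 1 1))
        + (g 0 0 * x * cl_conj (g 1 1) + g 0 1 * cl_conj x * cl_conj (g 1 0))].
Proof.
move=> H; rewrite /H !mulmx2E /ctr !mk2E !mulrDl !mulr_algr -!scalerAl.
have sw (a b c d : C) : a + b + (c + d) = a + d + (c + b).
  by rewrite addrACA [RHS]addrACA (addrC b d).
by split; exact: sw.
Qed.

(** The three equations of [SL2] amount to g g^# = 1. The other conditions are read off from
    [herm_actionE] at (y, z, x) = (1, 0, 0), (0, 1, 0) and (0, 0, x). Closure under products becomes
    immediate in this form. *)
Lemma SL2P g : SL2 g <-> g *m hash g = 1%:M /\ preserves_herm g.
Proof.
have s0 : is_cl_scalar (0 : C) by exists 0; rewrite scale0r.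
have v0 : is_cl_vec (0 : C) by apply/cl_vecP => S _; rewrite ffunE.
split=> [[[e1 e2 e3] [sa sb sc sd] [vac vbd] sx]|[e pg]].
  split.
    rewrite {1}(mk2_eta g) /hash mk2M mk2_1 !mulrN e1 e2 e3 !subrr.
    (* The remaining diagonal entry is the transpose of the first equation. *)
    have := congr1 (@cl_transp A m q) e1; rewrite cl_transp1 cl_transpD cl_transpN !cl_transpM !cl_transpK => <-.
    by rewrite addNr addrC.
  move=> H hH; have [[y y0] [z z1] vx e10] := hH.
  have HE : H = mk2 y%:A (H 0 1) (cl_conj (H 0 1)) z%:A by rewrite [LHS]mk2_eta y0 z1 e10.
  have [E00 E11 E01] := herm_actionE g y z (H 0 1); rewrite -HE in E00 E11 E01.
  have [sx1 sx2 vx3] := sx _ vx.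
  split.
  - by rewrite E00; do 2?apply: is_cl_scalarD => //; exact: is_cl_scalarZ.
  - by rewrite E11; do 2?apply: is_cl_scalarD => //; exact: is_cl_scalarZ.
  - by rewrite E01; do 2?apply: is_cl_vecD => //; exact: is_cl_vecZ.
  - have : ctr (g *m H *m ctr g) = g *m H *m ctr g.
      by rewrite ctr_mul ctrK ctr_mul (is_herm_ctr hH) mulmxA.
    by move=> /matrixP/(_ 1 0) <-; rewrite {1}/ctr mk2E.
have ent i j := congr1 (fun M : M2 => M i j) e.
have e00 := ent 0 0; have e01 := ent 0 1; have e10 := ent 1 0; clear ent.
rewrite !mulmx2E /hash !mk2E !mxE /= !mulrN in e00 e01 e10.
have pH y z x : is_cl_vec x -> is_herm (g *m mk2 y%:A x (cl_conj x) z%:A *m ctr g).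
  by move=> vx; apply: pg; split; rewrite !mk2E //; [exists y|exists z].
have s10 (a b p r s t : C) : 1 *: a + 0 *: b + (p * 0 * r + s * cl_conj 0 * t) = a.
  by rewrite scale1r scale0r cl_conj0 !mulr0 !mul0r !addr0.
have s01 (a b p r s t : C) : 0 *: a + 1 *: b + (p * 0 * r + s * cl_conj 0 * t) = b.
  by rewrite scale1r scale0r cl_conj0 !mulr0 !mul0r !addr0 add0r.
have s00 (a b c : C) : 0 *: a + 0 *: b + c = c by rewrite !scale0r !add0r.
have [A1 A2 A3 _] := pH 1 0 0 v0; have [B1 B2 B3 _] := pH 0 1 0 v0.
have [EA1 EA2 EA3] := herm_actionE g 1 0 0; have [EB1 EB2 EB3] := herm_actionE g 0 1 0.
rewrite s10 in EA1; rewrite s10 in EA2; rewrite s10 in EA3.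
rewrite s01 in EB1; rewrite s01 in EB2; rewrite s01 in EB3.
rewrite EA1 in A1; rewrite EA2 in A2; rewrite EA3 in A3.
rewrite EB1 in B1; rewrite EB2 in B2; rewrite EB3 in B3.
split; [|by split|by split|].
  split=> //; first by apply/eqP; rewrite eq_sym -subr_eq0 addrC e01.
  by apply/eqP; rewrite -subr_eq0 e10.
move=> x vx; have [X1 X2 X3 _] := pH 0 0 x vx; have [EX1 EX2 EX3] := herm_actionE g 0 0 x.
by rewrite s00 in EX1; rewrite s00 in EX2; rewrite s00 in EX3; rewrite -EX1 -EX2 -EX3.
Qed.

Lemma preserves_hermM g h : preserves_herm g -> preserves_herm h -> preserves_herm (g *m h).
Proof.
move=> pg ph H hH; rewrite ctr_mul.
have -> : g *m h *m H *m (ctr h *m ctr g) = g *m (h *m H *m ctr h) *m ctr g by rewrite !mulmxA.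
exact/pg/ph.
Qed.

Lemma SL2M g h : SL2 g -> SL2 h -> SL2 (g *m h).
Proof.
move=> /SL2P[eg pg] /SL2P[eh ph]; apply/SL2P; split; last exact: preserves_hermM.
by rewrite hash_mul mulmxA -(mulmxA g) eh mulmx1.
Qed.

Lemma SL2N g : SL2 g -> SL2 (- g).
Proof.
move=> /SL2P[eg pg]; apply/SL2P; rewrite hashN mulmxN mulNmx opprK; split=> // H hH.
by rewrite ctrN mulmxN !mulNmx opprK; exact: pg.
Qed.

Lemma SL2_1 : SL2 (1%:M : M2).
Proof.
apply/SL2P; split.
  by rewrite mk2_1 /hash !mk2E cl_transp1 cl_transp0 oppr0 -mk2_1 mulmx1.
by move=> H; rewrite mk2_1 /ctr !mk2E cl_conj0 cl_conj1 -mk2_1 mulmx1 mul1mx.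
Qed.

End Matrices2.

(** * The Hermitian model of the Moebius action *)

Section RealVectors.
Variables (R : realType) (m : nat).
Local Notation C := (real_clifford R m).

(** Adding the double sum to its transpose makes the mixed terms cancel by anticommutation; this
    computes twice the square. *)
Lemma cl_gen_comb_sqr (c : 'I_m -> R) :
  (\sum_j c j *: cl_gen _ j : C) * (\sum_j c j *: cl_gen _ j) = (- \sum_j c j ^+ 2)%:A.
Proof.
pose e j : C := c j *: cl_gen _ j.
have anti i j : i != j -> e i * e j + e j * e i = 0.
  move=> ij; rewrite /e -!scalerAl -!scalerAr (cl_gen_anti _ ij) !scalerA (mulrC (c j)) scalerN.
  by rewrite addNr.
have sq j : e j * e j = (- (c j ^+ 2))%:A.
  by rewrite /e -scalerAl -scalerAr cl_gen_sqr !scalerA -expr2 mulrN1.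
apply: (@scalerI R C 2); first by rewrite pnatr_eq0.
rewrite !scaler_nat !mulr2n -/(e _); rewrite -[X in _ = X]scalerDl.
have -> : (\sum_j e j) * (\sum_j e j) = \sum_i \sum_j e i * e j.
  by rewrite mulr_suml; apply: eq_bigr => i _; rewrite mulr_sumr.
rewrite {2}exchange_big /= -big_split /=.
under eq_bigr do rewrite -big_split /=.
rewrite (eq_bigr (fun i => (- (c i ^+ 2) *+ 2)%:A)) => [|i _].
  by rewrite -scaler_suml; congr (_ *: _); rewrite sumrMnl sumrN mulr2n.
rewrite (bigD1 i) //= big1 ?addr0 => [|j ji].
  by rewrite sq -scalerDl mulr2n.
by apply: anti; rewrite eq_sym.
Qed.

Lemma cl_vec_norm (v : 'cV[R]_m.+1) :
  (cl_vec _ v : C) * cl_conj (cl_vec _ v) = (sq_norm v)%:A.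
Proof.
rewrite cl_conj_vec {1}/cl_vec; set e := \sum_j _; set a := (v 0 0)%:A.
have ea : a * e = e * a by rewrite /a mulr_algl mulr_algr.
rewrite mulrDl !mulrBr ea addrA subrK /e cl_gen_comb_sqr /a -scalerAl mul1r scalerA -scalerBl opprK.
by rewrite /sq_norm big_ord_recl.
Qed.

End RealVectors.

Lemma addr_shuffle (V : zmodType) (a b c d e f : V) :
  a + (b + e) + ((c - f) + d) = a + d + (b + c) + (e - f).
Proof. by rewrite (addrC (c - f)) addrACA (addrACA b) addrA. Qed.

(** * The splitting of C_{n+1} as C_n + C_n i_n *)

Section Widen.
Variables (R : realType) (m : nat).
Local Notation C := (real_clifford R m).
Local Notation C1 := (real_clifford R m.+1).
Local Notation W := (@cl_widen R m).
Local Notation wset := (fun S : {set 'I_m} => [set widen_ord (leqnSn m) j | j in S]%SET).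
Local Notation pre := (fun U : {set 'I_m.+1} => [set j | widen_ord (leqnSn m) j \in U]%SET).

Let widI : injective (widen_ord (leqnSn m)).
Proof. by move=> i j /(congr1 val) /= /val_inj. Qed.

Lemma mem_wset (S : {set 'I_m}) j : (widen_ord (leqnSn m) j \in wset S) = (j \in S).
Proof. by rewrite mem_imset. Qed.

Lemma max_wset (S : {set 'I_m}) : ord_max \notin wset S.
Proof.
apply/imsetP => -[j _ /(congr1 val) /= e].
by have := ltn_ord j; rewrite -e ltnn.
Qed.

Lemma wset_pre (U : {set 'I_m.+1}) : ord_max \notin U -> wset (pre U) = U.
Proof.
move=> U0; apply/setP => i; apply/imsetP/idP => [[j]|iU]; first by rewrite inE => ? ->.
have im : (i < m)%N.
  rewrite ltn_neqAle -ltnS ltn_ord andbT; apply: contra U0 => /eqP e.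
  by rewrite (_ : ord_max = i) //; apply: val_inj; rewrite /= e.
by exists (Ordinal im); rewrite ?inE; [rewrite (_ : widen_ord _ _ = i) //|]; apply: val_inj.
Qed.

Lemma cl_widenD x y : W (x + y) = W x + W y.
Proof. by apply/ffunP => U; rewrite !ffunE; case: ifP; rewrite ?addr0. Qed.

Lemma cl_widenZ (a : R) x : W (a *: x) = a *: W x.
Proof. by apply/ffunP => U; rewrite !ffunE; case: ifP => _ //; rewrite [RHS]mulr0. Qed.

Lemma cl_widen0 : W 0 = 0.
Proof. by rewrite -(scale0r 0) cl_widenZ scale0r. Qed.

Lemma cl_widenN x : W (- x) = - W x.
Proof. by rewrite -scaleN1r cl_widenZ scaleN1r. Qed.

Lemma cl_widen_inj : injective W.
Proof.
move=> x y /ffunP xy; apply/ffunP => S; have := xy (wset S); rewrite !ffunE.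
rewrite (negPf (max_wset S)) (_ : [set j | _]%SET = S) //.
by apply/setP => j; rewrite inE mem_wset.
Qed.

Lemma cl_widen_basis S : W (cl_basis _ S) = cl_basis _ (wset S).
Proof.
apply/ffunP => U; rewrite !ffunE; case: ifPn => [Um|Um].
  by case: eqP => // e; move: Um; rewrite e (negPf (max_wset S)).
congr (_%:R : R); congr nat_of_bool; apply/eqP/eqP => [<-|->]; first by rewrite wset_pre.
by apply/setP => j; rewrite inE mem_wset.
Qed.

Lemma cl_widen1 : W 1 = 1.
Proof. by have := cl_widen_basis finset.set0; rewrite imset0. Qed.

Lemma cl_widen_alg (a : R) : W a%:A = a%:A.
Proof. by rewrite cl_widenZ cl_widen1. Qed.

Lemma cl_widen_gen j : W (cl_gen _ j) = cl_gen _ (widen_ord (leqnSn m) j).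
Proof. by rewrite /cl_gen cl_widen_basis imset_set1. Qed.

Lemma wset_symdiff S T : wset (symdiff S T) = symdiff (wset S) (wset T).
Proof.
apply/setP => i; case: (unliftP ord_max i) => [j|] ->; last first.
  by rewrite (negPf (max_wset _)) inE (negPf (max_wset S)) (negPf (max_wset T)).
have -> : lift ord_max j = widen_ord (leqnSn m) j.
  by apply: ord_inj; rewrite /= /bump leqNgt ltn_ord.
by rewrite mem_wset !inE !mem_wset.
Qed.

Lemma cl_coef_wset S T :
  cl_coef (fun=> 1 : R) (wset S) (wset T) = cl_coef (fun=> 1 : R) S T.
Proof.
rewrite /cl_coef !prodr_const -imsetI; last by move=> ? ? _ _; exact: widI.
rewrite (card_imset _ widI); congr ((-1) ^+ _ * _).
pose w2 (p : 'I_m * 'I_m) := (widen_ord (leqnSn m) p.1, widen_ord (leqnSn m) p.2).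
have w2I : injective w2 by move=> [a b] [c e] [] /val_inj -> /val_inj ->.
rewrite -(card_imset _ w2I); apply: eq_card => -[i j]; rewrite inE /=.
apply/and3P/imsetP => [[/imsetP[a aS ->] /imsetP[b bT ->] lt]|[[a b]]].
  by exists (a, b); rewrite // inE /= aS bT.
by rewrite inE /= => /and3P[aS bT lt] [-> ->]; rewrite !mem_wset.
Qed.

Lemma cl_widenM x y : W (x * y) = W x * W y.
Proof.
have Wsum (f : {set 'I_m} -> C) : W (\sum_S f S) = \sum_S W (f S).
  exact: (big_morph W cl_widenD cl_widen0).
rewrite (cl_basis_spanning x) (cl_basis_spanning y) mulr_suml !Wsum mulr_suml.
apply: eq_bigr => S _; rewrite mulr_sumr Wsum mulr_sumr; apply: eq_bigr => T _.
rewrite -scalerAl -scalerAr cl_basisM !cl_widenZ !cl_widen_basis -scalerAl -scalerAr cl_basisM.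
by rewrite cl_coef_wset wset_symdiff.
Qed.

Lemma card_pre (U : {set 'I_m.+1}) : ord_max \notin U -> #|pre U| = #|U|.
Proof. by move=> U0; rewrite -[in RHS](wset_pre U0) card_imset. Qed.

Lemma cl_widen_parity x : cl_parity (W x) = W (cl_parity x).
Proof. by apply/ffunP => U; rewrite !ffunE; case: ifPn => Um; rewrite ?mulr0 // ?card_pre. Qed.

Lemma cl_widen_transp x : cl_transp (W x) = W (cl_transp x).
Proof. by apply/ffunP => U; rewrite !ffunE; case: ifPn => Um; rewrite ?mulr0 // ?card_pre. Qed.

Lemma cl_widen_conj x : cl_conj (W x) = W (cl_conj x).
Proof. by rewrite /cl_conj cl_widen_parity cl_widen_transp. Qed.

Let i_n : C1 := cl_gen _ ord_max.

Lemma i_n_sqr : i_n * i_n = -1.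
Proof. by rewrite /i_n cl_gen_sqr scaleN1r. Qed.

Lemma i_n_parity x : i_n * W (cl_parity x) = W x * i_n.
Proof.
rewrite (cl_basis_spanning x).
rewrite (big_morph (@cl_parity R m _) (@cl_parityD _ _ _) (@cl_parity0 _ _ _)).
rewrite !(big_morph W cl_widenD cl_widen0) mulr_sumr mulr_suml; apply: eq_bigr => S _.
rewrite cl_parityZ !cl_widenZ -scalerAr -scalerAl -cl_widen_parity cl_widen_basis cl_gen_parity.
by rewrite (negPf (max_wset S)) scale1r.
Qed.

Lemma i_n_conj x : i_n * W (cl_conj x) = W (cl_transp x) * i_n.
Proof. by rewrite -i_n_parity /cl_conj cl_transp_parity. Qed.

(** The map z -> i_n z' i_n negates [W x] and fixes [W y * i_n], so it separates the two
    summands. *)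
Lemma widen_direct x y : W x + W y * i_n = 0 -> x = 0 /\ y = 0.
Proof.
move=> e; have e2 : - W x + W y * i_n = 0.
  have : i_n * cl_parity (W x + W y * i_n) * i_n = 0 by rewrite e cl_parity0 mulr0 mul0r.
  rewrite cl_parityD cl_parityM cl_parity_gen -/i_n !cl_widen_parity mulrDr i_n_parity mulrN mulrN.
  by rewrite (mulrA i_n) i_n_parity -(mulrA (W y)) i_n_sqr mulrN1 opprK mulrDl -mulrA i_n_sqr mulrN1.
have x0 : W x = 0.
  apply: (@scalerI R C1 2); first by rewrite pnatr_eq0.
  by rewrite scaler0 scaler_nat mulr2n -[RHS](subrr 0) -{1}e -e2 opprD addrACA opprK subrr addr0.
split; first by apply: cl_widen_inj; rewrite x0 cl_widen0.
move: e; rewrite x0 add0r => /(congr1 ( *%R^~ i_n)); rewrite -mulrA i_n_sqr mulrN1 mul0r => /eqP.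
by rewrite oppr_eq0 => /eqP e; apply: cl_widen_inj; rewrite e cl_widen0.
Qed.

Lemma cl_vec_split (x : 'cV[R]_m.+2) : (cl_vec _ x : C1) =
  W (cl_vec _ (\col_i x (widen_ord (leqnSn m.+1) i) 0)) + x ord_max 0 *: i_n.
Proof.
rewrite /cl_vec cl_widenD cl_widen_alg mxE big_ord_recr /= addrA; congr (_%:A + _ + x _ 0 *: _).
- by congr (x _ 0); apply: val_inj.
- rewrite (big_morph W cl_widenD cl_widen0); apply: eq_bigr => j _.
  rewrite cl_widenZ cl_widen_gen mxE; congr (x _ 0 *: _).
  exact: val_inj.
- exact: val_inj.
Qed.

(* The pseudo-determinant [H_00 H_11 - H_01 H_10] of [hmx v] is [lorentz v]. *)
Definition hmx (v : 'cV[R]_m.+3) : 'M[C]_2 :=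
  let x := cl_vec _ (\col_(i < m.+1) v (lift ord0 (lift ord0 i)) 0) in
  mk2 (v 0 0 + v (lift ord0 ord0) 0)%:A x (cl_conj x) (v 0 0 - v (lift ord0 ord0) 0)%:A.

Lemma hmx_herm v : is_herm (hmx v).
Proof. by split; rewrite /hmx !mk2E //; eexists. Qed.

Lemma hmx_inj : injective hmx.
Proof.
move=> v w /matrixP e; have e00 := e 0 0; have e01 := e 0 1; have e11 := e 1 1.
rewrite /hmx !mk2E in e00 e01 e11.
have {}e00 := congr1 (fun x : C => x finset.set0) e00; rewrite !cl_algE eqxx in e00.
have {}e11 := congr1 (fun x : C => x finset.set0) e11; rewrite !cl_algE eqxx in e11.
move/cl_vec_inj/matrixP in e01.
apply/matrixP => i j; rewrite (ord1 j); case: (unliftP ord0 i) => [k|] ->; last first.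
  by change (v 0 0 = w 0 0); move: e00 e11; lra.
case: (unliftP ord0 k) => [l|] ->; last by move: e00 e11; lra.
by have := e01 l 0; rewrite !mxE.
Qed.

(** The products den den^bar, num den^bar and num num^bar are computed by [PQ]: up to the factor t,
    their C_n-parts are the entries of g H g^bar^T, and their i_n-parts are 0, 1 and 0 by the
    equations of [SL2]. Substituting num = Y den then yields the entries of the matrix of y. *)
Lemma moebius_hmx (g : 'M[C]_2) (x y : 'cV[R]_m.+2) : SL2 g ->
  upper_half x -> upper_half y -> moebius g x y ->
  hmx (to_hyperboloid y) = g *m hmx (to_hyperboloid x) *m ctr g.
Proof.
move=> sg x0 y0 [w [den_w w_den Y_E]].
set X := cl_vec _ x in den_w w_den Y_E; set Y := cl_vec _ y in Y_E.
set num := _ + _ in Y_E; set den := _ + _ in den_w w_den.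
have num_E : num = Y * den by rewrite Y_E -mulrA w_den mulr1.
have [[e1 e2 e3] _ _ _] := sg; have /SL2P[_ pg] := sg.
set t := x ord_max 0 in x0; set u := y ord_max 0 in y0.
have t0 : t != 0 by rewrite gt_eqF. have u0 : u != 0 by rewrite gt_eqF.
set x' := cl_vec _ (\col_i x (widen_ord (leqnSn m.+1) i) 0) : C.
set y' := cl_vec _ (\col_i y (widen_ord (leqnSn m.+1) i) 0) : C.
have XE : X = W x' + t *: i_n by exact: cl_vec_split.
have YE : Y = W y' + u *: i_n by exact: cl_vec_split.
have XcE : cl_conj X = W (cl_conj x') - t *: i_n.
  rewrite XE cl_conjD cl_conjZ cl_widen_conj /cl_conj cl_parity_gen cl_transpN cl_transp_gen.
  by rewrite scalerN.
(* In half-space coordinates the Hermitian matrix is t^-1 [[|x|^2, x'], [x'^bar, 1]], where x' is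
   the part of x in C_n and t its height. *)
have hE (z : 'cV[R]_m.+2) : z ord_max 0 != 0 -> hmx (to_hyperboloid z) =
    mk2 (sq_norm z / z ord_max 0)%:A
        ((z ord_max 0)^-1 *: cl_vec _ (\col_i z (widen_ord (leqnSn m.+1) i) 0))
        (cl_conj ((z ord_max 0)^-1 *: cl_vec _ (\col_i z (widen_ord (leqnSn m.+1) i) 0)))
        ((z ord_max 0)^-1)%:A.
  move=> z0; rewrite /hmx to_hyperboloid0 to_hyperboloid1 -cl_vecZ.
  have -> : (\col_(i < m.+1) to_hyperboloid z (lift ord0 (lift ord0 i)) 0) =
      (z ord_max 0)^-1 *: (\col_i z (widen_ord (leqnSn m.+1) i) 0).
    by apply/matrixP => i j; rewrite [LHS]mxE to_hyperboloid2 !mxE mulrC.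
  congr (mk2 _%:A _ _ _%:A); field; exact: z0.
have pgH := pg _ (hmx_herm (to_hyperboloid x)).
move: pgH; rewrite (hE y u0) (hE x t0) -/t -/u -/x' -/y'.
have [E00 E11 E01] := herm_actionE g (sq_norm x / t) t^-1 (t^-1 *: x').
set G := g *m _ *m _ in E00 E11 E01 *.
move=> [[s00 sE00] [s11 sE11] v01 e10].
(* [P Q^bar] for two rows [(p1, p2)], [(q1, q2)] of [g], [P = p1 X + p2], [Q = q1 X + q2]. *)
have PQ (p1 p2 q1 q2 : C) : (W p1 * X + W p2) * cl_conj (W q1 * X + W q2) =
   t *: (W ((sq_norm x / t) *: (p1 * cl_conj q1) + t^-1 *: (p2 * cl_conj q2) +
     (p1 * (t^-1 *: x') * cl_conj q2 + p2 * cl_conj (t^-1 *: x') * cl_conj q1))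
     + W (p1 * cl_transp q2 - p2 * cl_transp q1) * i_n).
  have T1 : W p1 * X * (cl_conj X * W (cl_conj q1)) = sq_norm x *: W (p1 * cl_conj q1).
    by rewrite -mulrA (mulrA X) cl_vec_norm mulr_algl -scalerAr -cl_widenM.
  have T2 : W p1 * X * W (cl_conj q2) =
      W (p1 * x' * cl_conj q2) + t *: (W (p1 * cl_transp q2) * i_n).
    rewrite -mulrA XE mulrDl -scalerAl i_n_conj mulrDr -scalerAr !mulrA -!cl_widenM.
    by [].
  have T3 : W p2 * (cl_conj X * W (cl_conj q1)) =
      W (p2 * cl_conj x' * cl_conj q1) - t *: (W (p2 * cl_transp q1) * i_n).
    rewrite XcE mulrBl -scalerAl i_n_conj mulrBr -scalerAr !mulrA -!cl_widenM.
    by [].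
  have T4 : W p2 * W (cl_conj q2) = W (p2 * cl_conj q2) by rewrite -cl_widenM.
  have S1 (a : C) : t *: W ((sq_norm x / t) *: a) = sq_norm x *: W a.
    by rewrite cl_widenZ scalerA mulrC divfK.
  have S2 (a : C) : t *: W (t^-1 *: a) = W a by rewrite cl_widenZ scalerA divff // scale1r.
  have L1 : cl_conj (W q1 * X + W q2) = cl_conj X * W (cl_conj q1) + W (cl_conj q2) :> C1.
    by rewrite cl_conjD cl_conjM !cl_widen_conj.
  have L2 (a b c e : C1) : (a + b) * (c + e) = a * c + a * e + (b * c + b * e).
    by rewrite mulrDl !mulrDr.
  rewrite L1; transitivity (W p1 * X * (cl_conj X * W (cl_conj q1)) + W p1 * X * W (cl_conj q2) +
    (W p2 * (cl_conj X * W (cl_conj q1)) + W p2 * W (cl_conj q2)) : C1); first exact: L2.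
  rewrite T1 T2 T3 T4.
  rewrite cl_conjZ -!(scalerAr t^-1) -!(scalerAl t^-1) !cl_widenD cl_widenN !scalerDr S1 !S2.
  rewrite mulrDl mulNr scalerDr scalerN; exact: addr_shuffle.
have den2 : den * cl_conj den = (t * s11)%:A.
  by rewrite PQ -E11 sE11 e3 subrr cl_widen0 mul0r addr0 cl_widen_alg scalerA.
have nd : num * cl_conj den = t *: (W (G 0 1) + i_n).
  by rewrite PQ -E01 e1 cl_widen1 mul1r.
have nn : num * cl_conj num = (t * s00)%:A.
  by rewrite PQ -E00 sE00 e2 subrr cl_widen0 mul0r addr0 cl_widen_alg scalerA.
have eY : s11 *: Y = W (G 0 1) + i_n.
  apply: (@scalerI R C1 t t0); rewrite -nd num_E -mulrA den2 mulr_algr.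
  by rewrite scalerA.
(* Comparing components in C_n + C_n i_n gives the off-diagonal entry and s11 = 1/u. *)
have [G01 su] : s11 *: y' - G 0 1 = 0 /\ (s11 * u - 1)%:A = 0 :> C.
  apply: widen_direct; rewrite cl_widenD cl_widenN cl_widenZ cl_widen_alg mulr_algl scalerBl scale1r.
  by rewrite addrACA -scalerA -scalerDr -YE eY -opprD subrr.
have su1 : s11 * u = 1.
  by have := congr1 (fun x : C => x finset.set0) su; rewrite cl_algE eqxx ffunE => /eqP; rewrite subr_eq0 => /eqP.
have s11E : s11 = u^-1 by rewrite -[s11]mulr1 -(mulfV u0) mulrA su1 mul1r.
have s00E : s00 = sq_norm y / u.
  have : (t * s00)%:A = (t * s11 * sq_norm y)%:A :> C1.
    rewrite -nn num_E cl_conjM mulrA -(mulrA Y) den2 -scalerAl mulr_algr -scalerAl.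
    have -> : Y * cl_conj Y = (sq_norm y)%:A by exact: cl_vec_norm.
    by rewrite scalerA -[t * s11 * _]mulrA.
  move/(congr1 (fun x : C1 => x finset.set0)); rewrite !cl_algE eqxx -mulrA => /(mulfI t0) ->.
  by rewrite s11E mulrC.
have e01 : G 0 1 = u^-1 *: y' by apply/esym/eqP; rewrite -subr_eq0 -s11E G01.
by apply: mk2_ext; rewrite !mk2E ?sE00 ?sE11 ?e10 ?e01 ?s00E ?s11E.
Qed.

End Widen.

(** * The isomorphism [phi] read off on Hermitian matrices *)

Section HermitianModel.
Variables (R : realType) (m : nat).
Local Notation C := (real_clifford R m).
Local Notation V := 'cV[R]_m.+3.

Lemma hmxD (u v : V) : hmx (u + v) = hmx u + hmx v.
Proof.
rewrite /hmx mk2D -cl_conjD -cl_vecD -!scalerDl !mxE; congr (mk2 _%:A (cl_vec _ _) (cl_conj (cl_vec _ _)) _%:A).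
- by rewrite addrACA.
- by apply/matrixP => i j; rewrite !mxE.
- by apply/matrixP => i j; rewrite !mxE.
- by rewrite opprD addrACA.
Qed.

Definition rscale (a : R) (M : 'M[C]_2) : 'M[C]_2 := map_mx (fun x : C => a *: x) M.

Lemma rscaleE (a : R) (M : 'M[C]_2) i j : rscale a M i j = a *: M i j.
Proof. by rewrite mxE. Qed.

Lemma hmxZ (a : R) (v : V) : hmx (a *: v) = rscale a (hmx v).
Proof.
apply: mk2_ext; rewrite rscaleE /hmx !mk2E ?mxE ?scalerA ?mulrDr ?mulrN //.
  by rewrite -cl_vecZ; congr cl_vec; apply/matrixP => i j; rewrite !mxE.
by rewrite -cl_conjZ -cl_vecZ; congr (cl_conj (cl_vec _ _)); apply/matrixP => i j; rewrite !mxE.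
Qed.

Lemma rscale_mulmxr (a : R) (g h : 'M[C]_2) : g *m rscale a h = rscale a (g *m h).
Proof. by apply/matrixP => i j; rewrite rscaleE !mulmx2E !rscaleE -!scalerAr scalerDr. Qed.

Lemma rscale_mulmxl (a : R) (g h : 'M[C]_2) : rscale a g *m h = rscale a (g *m h).
Proof. by apply/matrixP => i j; rewrite rscaleE !mulmx2E !rscaleE -!scalerAl scalerDr. Qed.

Lemma is_hermP (H : 'M[C]_2) : is_herm H -> exists v : V, H = hmx v.
Proof.
case=> -[y y0] [z z1] [x vx] e10.
pose v : V := \col_i (if unlift ord0 i is Some j then
  if unlift ord0 j is Some k then x k 0 else (y - z) / 2 else (y + z) / 2).
have v0 : v 0 0 = (y + z) / 2 by rewrite mxE unlift_none.
have v1 : v (lift ord0 ord0) 0 = (y - z) / 2 by rewrite mxE liftK unlift_none.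
have vE : (\col_(i < m.+1) v (lift ord0 (lift ord0 i)) 0) = x.
  by apply/matrixP => i j; rewrite !mxE !liftK (ord1 j).
exists v; rewrite /hmx vE v0 v1 -vx -e10 [LHS]mk2_eta y0 z1.
congr (mk2 _%:A _ _ _%:A); lra.
Qed.

(** The hyperboloid spans the whole space, so linear identities need checking only on it. *)
Lemma hyperboloid_span (P : V -> Prop) :
  (forall x, upper_half x -> P (to_hyperboloid x)) ->
  (forall a u v, P u -> P v -> P (u + a *: v)) -> forall v, P v.
Proof.
move=> Ph Pl v; have [_ _ surj] := @to_hyperboloid_bij R m.+1.
have Pw w : lorentz w = 1 -> 0 < w 0 0 -> P w.
  by move=> w1 w0; have [x xu <-] := surj w (conj w1 w0); exact: Ph.
pose s := \sum_(i < m.+2) v (lift ord0 i) 0 ^+ 2.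
have s0 : 0 <= s by apply: sumr_ge0 => i _; exact: sqr_ge0.
pose w (a b : R) : V := \col_i (if unlift ord0 i is Some j then b * v (lift ord0 j) 0 else a).
have w0 a b : w a b 0 0 = a by rewrite mxE unlift_none.
have wl a b : lorentz (w a b) = a ^+ 2 - b ^+ 2 * s.
  rewrite /lorentz w0 /s mulr_sumr; congr (_ - _); apply: eq_bigr => i _.
  by rewrite mxE liftK exprMn.
(* The first vector has the space part of v and the height that puts it on the hyperboloid; the
   second is the base point (1, 0, ..., 0), which corrects the height. *)
have -> : v = w (Num.sqrt (1 + s)) 1 + (v 0 0 - Num.sqrt (1 + s)) *: w 1 0.
  apply/matrixP => i j; rewrite (ord1 j) !mxE.
  by case: (unliftP ord0 i) => [k|] ->; rewrite ?liftK ?unlift_none //=; ring.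
by apply: Pl; apply: Pw; rewrite ?wl ?w0 ?sqr_sqrtr ?sqrtr_gt0 ?expr1n ?expr0n /=; lra.
Qed.

Variable phi : 'M[C]_2 -> orthogonal_group (@lorentz R m.+2).
Hypothesis phi_iso : is_moebius_iso phi.
Local Notation G := (orthogonal_group (@lorentz R m.+2)).

(** Both sides are linear in v and agree on the hyperboloid by [moebius_hmx]. *)
Lemma phi_hmx (g : 'M[C]_2) : SL2 g ->
  forall v, hmx (val (phi g) *m v) = g *m hmx v *m ctr g.
Proof.
move=> sg; have [_ _ _ /(_ g sg)[f [[fb _ _ _] fm fh]]] := phi_iso.
apply: hyperboloid_span => [x x0|a u v hu hv].
  rewrite fh //; apply: moebius_hmx => //; last exact: fm.
  by have [+ _ _] := fb; apply.
have -> : val (phi g) *m (u + a *: v) = val (phi g) *m u + a *: (val (phi g) *m v).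
  by rewrite mulmxDr -scalemxAr.
by rewrite !hmxD !hmxZ hu hv mulmxDr mulmxDl rscale_mulmxr rscale_mulmxl.
Qed.

Lemma phiM g h : SL2 g -> SL2 h -> phi (g *m h) = (phi g * phi h)%g.
Proof. by have [+ _ _ _] := phi_iso; apply. Qed.

Lemma phi1 : phi 1%:M = 1%g.
Proof.
have s1 := @SL2_1 R m (fun=> 1); have := phiM s1 s1.
by rewrite mulmx1 => /(congr1 (fun x => (x * (phi 1%:M)^-1)%g)); rewrite mulgK mulgV => ->.
Qed.

Lemma phi_eq1 g : SL2 g -> phi g = 1%g -> exists b : bool, g = (-1) ^+ b.
Proof.
move=> sg; have [_ /(_ g 1%:M sg (@SL2_1 R m _))[+ _] _ _] := phi_iso; rewrite phi1 => h /h[] ->.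
  by exists false.
by exists true.
Qed.

Lemma phi_sign (b : bool) g : SL2 g -> phi ((-1) ^+ b * g) = phi g.
Proof.
move=> sg; case: b; rewrite ?mul1r // mulN1r.
by have [_ /(_ (- g) g (SL2N sg) sg)[_ +] _ _] := phi_iso; apply; right.
Qed.

Lemma phi_component g : SL2 g -> identity_component (phi g).
Proof. by move=> sg; have [_ _ e _] := phi_iso; rewrite -[@identity_component _]e; exists g. Qed.

Lemma phi_surj (x : G) : identity_component x -> exists2 g, SL2 g & phi g = x.
Proof. by have [_ _ e _] := phi_iso; rewrite -[@identity_component _]e => -[g]; exists g. Qed.

(* A right inverse [hash g] of [g] is two-sided because the Lorentz group is a group. *)
Lemma SL2_hash g : SL2 g ->
  [/\ SL2 (hash g), hash g *m g = 1%:M & phi (hash g) = ((phi g)^-1)%g].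
Proof.
move=> sg; have GV := @identity_componentV G (@orthogonalV_continuous _ _ _).
have [h sh eh] := phi_surj (GV _ (phi_component sg)).
have [gh _] := (SL2P g).1 sg.
have [b hg] : exists b : bool, h *m g = (-1) ^+ b.
  by apply: phi_eq1; [exact: SL2M|rewrite phiM // eh mulVg].
have e : hash g = (-1) ^+ b * h.
  have : h *m g *m hash g = h by rewrite -mulmxA gh mulmx1.
  by rewrite hg => <-; rewrite mulrA -expr2 sqrr_sign mul1r.
have sb (x : 'M[C]_2) : SL2 x -> SL2 ((-1) ^+ b * x).
  by case: b {hg e} => sx; rewrite ?mulN1r ?mul1r //; exact: SL2N.
split; first by rewrite e; exact: sb.
  by rewrite e -mulmxA hg -[_ *m _]/(_ * _) -expr2 sqrr_sign.
by rewrite e phi_sign.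
Qed.

End HermitianModel.

(** * Integral coordinates *)

Lemma linear_mxE (R : comNzRingType) n p (f : 'cV[R]_n -> 'cV[R]_p) :
  (forall a u v, f (a *: u + v) = a *: f u + f v) ->
  forall u, (\matrix_(i, j) f (delta_mx j 0) i 0) *m u = f u.
Proof.
move=> fl u; have f0 : f 0 = 0.
  by have := fl (-1) 0 0; rewrite scaler0 addr0 scaleN1r addNr.
have fs (s : seq 'I_n) : f (\sum_(j <- s) u j 0 *: delta_mx j 0) = \sum_(j <- s) u j 0 *: f (delta_mx j 0).
  by elim: s => [|j s IH]; rewrite ?big_nil // !big_cons fl IH.
have uE : u = \sum_j u j 0 *: delta_mx j 0.
  rewrite [LHS]matrix_sum_delta; apply: eq_bigr => j _; by rewrite big_ord1.
rewrite [in RHS]uE fs; apply/matrixP => i j; rewrite (ord1 j) mxE summxE.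
by apply: eq_bigr => k _; rewrite !mxE mulrC.
Qed.

Section QuadraticCoordinates.
Variable m : nat.

Lemma ordQP (i : 'I_(3 + m)) :
  [\/ i = 0, i = 1, i = inord 2 | exists j, i = rshift 3 j].
Proof.
have [lt|ge] := ltnP i 3; last first.
  have im : (i - 3 < m)%N by have := ltn_ord i; rewrite ltn_subLR.
  by apply: Or44; exists (Ordinal im); apply: val_inj; rewrite /= subnKC.
case: i lt => -[|[|[|//]]] Hi _.
- by apply: Or41; apply: val_inj.
- by apply: Or42; apply: val_inj.
- by apply: Or43; apply: val_inj; rewrite /= inordK.
Qed.

Section Coord.
Variable A : nmodType.

Definition mkQ (a b c : A) (w : 'I_m -> A) : 'cV[A]_(3 + m) :=
  \col_(i < 3 + m) (match fintype.split i with inl k => [:: a; b; c]`_k | inr l => w l end).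

Lemma mkQ0 a b c w : mkQ a b c w 0 0 = a.
Proof. by rewrite mxE (_ : 0 = lshift m (0 : 'I_3)) ?(unsplitK (inl _)) //; apply: val_inj. Qed.
Lemma mkQ1 a b c w : mkQ a b c w 1 0 = b.
Proof. by rewrite mxE (_ : 1 = lshift m (1 : 'I_3)) ?(unsplitK (inl _)) //; apply: val_inj. Qed.
Lemma mkQ2 a b c w : mkQ a b c w (inord 2) 0 = c.
Proof.
rewrite mxE (_ : inord 2 = lshift m (inord 2 : 'I_3)) ?(unsplitK (inl _)) ?inordK //.
by apply: val_inj; rewrite /= !inordK.
Qed.
Lemma mkQr a b c w j : mkQ a b c w (rshift 3 j) 0 = w j.
Proof. by rewrite mxE (unsplitK (inr _)). Qed.

End Coord.

Variables (R : realType) (d : 'I_m -> nat).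

(** Twice the Gram matrix of Q, because the term -yz has half-integral matrix entries. *)
Definition gramZ : 'M[int]_(3 + m) :=
  2 *: delta_mx 0 0 - delta_mx 1 (inord 2) - delta_mx (inord 2) 1
  + \sum_j (2 * (d j)%:Z) *: delta_mx (rshift 3 j) (rshift 3 j).

Definition gram : 'M[R]_(3 + m) := 2^-1 *: map_mx intr gramZ.

Lemma gramZE : map_mx intr gramZ = 2 *: gram.
Proof. by rewrite /gram scalerA divff ?pnatr_eq0 // scale1r. Qed.

Lemma gram_sym : gram^T = gram.
Proof.
have sym : gramZ^T = gramZ.
  apply/matrixP => i j; rewrite /gramZ !mxE !summxE; congr (_ + _); last first.
    by apply: eq_bigr => k _; rewrite !mxE andbC.
  by rewrite !(andbC (j == _)) addrAC.
by rewrite /gram linearZ /= map_trmx sym.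
Qed.

Lemma delta_formE (v : 'cV[R]_(3 + m)) i j : (v^T *m delta_mx i j *m v) 0 0 = v i 0 * v j 0.
Proof.
rewrite mxE (bigD1 j) //= mxE (bigD1 i) //= !mxE !eqxx mulr1 !big1 ?addr0 // => k /negPf ki.
  by rewrite mxE big1 ?mul0r // => l _; rewrite !mxE ki andbF mulr0.
by rewrite !mxE ki mulr0.
Qed.

Lemma form_gramE (v : 'cV[R]_(3 + m)) : form_Q d v = (v^T *m gram *m v) 0 0.
Proof.
have -> : gram = 2^-1 *: (2 *: delta_mx 0 0 - delta_mx 1 (inord 2) - delta_mx (inord 2) 1
  + \sum_j (2 * (d j)%:R) *: delta_mx (rshift 3 j) (rshift 3 j)).
  rewrite /gram /gramZ; congr (_ *: _); apply/matrixP => i j.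
  rewrite !mxE !summxE !(rmorphD, rmorphN, rmorphM, rmorph_nat, rmorph_sum) /= .
  by congr (_ + _); apply: eq_bigr => k _; rewrite !mxE !rmorphM /= !rmorph_nat.
pose q (M : 'M[R]_(3 + m)) := (v^T *m M *m v) 0 0.
have qD M N : q (M + N) = q M + q N by rewrite /q mulmxDr mulmxDl mxE.
have qZ a M : q (a *: M) = a * q M by rewrite /q -scalemxAr -scalemxAl mxE.
have qN M : q (- M) = - q M by rewrite -scaleN1r qZ mulN1r.
have q0 : q 0 = 0 by rewrite -(scale0r 0) qZ mul0r.
rewrite -/(q _) qZ !qD !qN qZ (big_morph q qD q0) /q !delta_formE /form_Q.
rewrite [in RHS](eq_bigr (fun j => 2 * ((d j)%:R * v (rshift 3 j) 0 ^+ 2))) => [|j _].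
  by rewrite -mulr_sumr expr2; set s := \sum_j _; field.
by rewrite -/(q _) qZ /q delta_formE; ring.
Qed.

(** Chosen so that [hmx] of the image is [[y, x], [x^bar, z]] with x = u_0 + sum of sqrt(d_l) u_l
    i_l; integral vectors then correspond to Hermitian matrices over the order. *)
Definition lorentz_coord (u : 'cV[R]_(3 + m)) : 'cV[R]_m.+3 :=
  \col_i (if unlift ord0 i is Some j then
    if unlift ord0 j is Some k then
      if unlift ord0 k is Some l then Num.sqrt (d l)%:R * u (rshift 3 l) 0 else u 0 0
    else (u 1 0 - u (inord 2) 0) / 2
  else (u 1 0 + u (inord 2) 0) / 2).

Definition coord_mx : 'M[R]_(m.+3, 3 + m) := \matrix_(i, j) lorentz_coord (delta_mx j 0) i 0.

Lemma coord_mxE u : coord_mx *m u = lorentz_coord u.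
Proof.
apply: (@linear_mxE R (3 + m) m.+3) => a x y; apply/matrixP => i j; rewrite !mxE.
by case: unlift => [k|]; [case: unlift => [l|]; [case: unlift => [n|]|]|]; rewrite ?mxE; ring.
Qed.

Lemma lorentz_coordE u : lorentz (coord_mx *m u) = - form_Q d u.
Proof.
rewrite coord_mxE lorentzE big_ord_recl !mxE !(unlift_none, liftK).
rewrite /form_Q (eq_bigr (fun j => (d j)%:R * u (rshift 3 j) 0 ^+ 2)) => [|j _].
  by set s := \sum_j _; field.
by rewrite !mxE !liftK exprMn sqr_sqrtr ?ler0n.
Qed.

Hypothesis d_gt0 : forall j, (0 < d j)%N.

Lemma coord_mx_unit : (coord_mx : 'M[R]_m.+3) \in unitmx.
Proof.
rewrite -unitmx_tr -row_free_unit -kermx_eq0; apply/rowV0P => v /sub_kermxP vS.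
pose u : 'cV[R]_(3 + m) := v^T.
have : coord_mx *m u = 0 by rewrite -[LHS]trmxK trmx_mul trmxK vS trmx0.
rewrite coord_mxE => /matrixP e; suff u0 : u = 0 by rewrite -[v]trmxK -/u u0 trmx0.
apply/matrixP => i j; rewrite (ord1 j) [RHS]mxE.
have e0 := e ord0 0; have e1 := e (lift ord0 ord0) 0; have e2 := e (lift ord0 (lift ord0 ord0)) 0.
rewrite [LHS]mxE [RHS]mxE !(unlift_none, liftK) in e0.
rewrite [LHS]mxE [RHS]mxE !(unlift_none, liftK) in e1.
rewrite [LHS]mxE [RHS]mxE !(unlift_none, liftK) in e2.
have [->|->|->|[l ->]] := ordQP i; [exact: e2|lra|lra|].
have := e (lift ord0 (lift ord0 (lift ord0 l))) 0; rewrite [LHS]mxE [RHS]mxE !liftK => /eqP.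
by rewrite mulf_eq0 sqrtr_eq0 leNgt ltr0n d_gt0 /= => /eqP.
Qed.

Lemma hmx_coord u : hmx (coord_mx *m u) =
  let x := cl_vec _ (\col_i (if unlift ord0 i is Some l then Num.sqrt (d l)%:R * u (rshift 3 l) 0 else u 0 0)) in
  mk2 (u 1 0)%:A x (cl_conj x) (u (inord 2) 0)%:A.
Proof.
rewrite coord_mxE /hmx.
have -> : \col_(i < m.+1) lorentz_coord u (lift ord0 (lift ord0 i)) 0 =
  \col_i (if unlift ord0 i is Some l then Num.sqrt (d l)%:R * u (rshift 3 l) 0 else u 0 0).
  by apply/matrixP => i j; rewrite !mxE !liftK.
by congr (mk2 _%:A _ _ _%:A); rewrite !mxE !(unlift_none, liftK); field.
Qed.

End QuadraticCoordinates.

Section OrderInclusion.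
Variables (R : realType) (m : nat) (d : 'I_m -> nat).
Hypothesis d_gt0 : forall j, (0 < d j)%N.
Local Notation O := (clifford (fun j => (d j)%:Z)).
Local Notation C := (real_clifford R m).
Local Notation incl := (@order_incl R m d).
Local Notation inclM := (map_mx incl : 'M[O]_2 -> 'M[C]_2).

Definition rootd (S : {set 'I_m}) : R := \prod_(j in S) Num.sqrt (d j)%:R.

Lemma order_inclE x S : incl x S = (x S)%:~R * rootd S.
Proof. by rewrite ffunE. Qed.

Lemma rootd_neq0 S : rootd S != 0.
Proof. by apply/prodf_neq0 => j _; rewrite gt_eqF // sqrtr_gt0 ltr0n. Qed.

Lemma rootd_sqr S : rootd S * rootd S = (\prod_(j in S) (d j)%:Z)%:~R.
Proof.
rewrite /rootd -big_split rmorph_prod /=; apply: eq_bigr => j _.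
by rewrite -expr2 sqr_sqrtr ?ler0n.
Qed.

Lemma order_inclZ (z : int) x : incl (z *: x) = z%:~R *: incl x.
Proof. by apply/ffunP => S; rewrite [RHS]ffunE !order_inclE ffunE intrM -mulrA. Qed.

Lemma order_incl0 : incl 0 = 0.
Proof. by rewrite -(scale0r 0) order_inclZ scale0r. Qed.

Lemma order_inclN x : incl (- x) = - incl x.
Proof. by rewrite -scaleN1r order_inclZ scaleN1r. Qed.

Lemma order_incl_alg (z : int) : incl z%:A = (z%:~R)%:A.
Proof. by rewrite order_inclZ order_incl1. Qed.

Lemma order_incl_parity x : incl (cl_parity x) = cl_parity (incl x).
Proof.
apply/ffunP => S; rewrite [RHS]ffunE !order_inclE ffunE intrM rmorphXn /= rmorphN1.
by rewrite mulrA.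
Qed.

Lemma order_incl_transp x : incl (cl_transp x) = cl_transp (incl x).
Proof.
apply/ffunP => S; rewrite [RHS]ffunE !order_inclE ffunE intrM rmorphXn /= rmorphN1.
by rewrite mulrA.
Qed.

Lemma order_incl_conj x : incl (cl_conj x) = cl_conj (incl x).
Proof. by rewrite order_incl_transp order_incl_parity. Qed.

Lemma order_incl_eq0 x S : (incl x S == 0) = (x S == 0).
Proof. by rewrite order_inclE mulf_eq0 (negPf (rootd_neq0 S)) orbF intr_eq0. Qed.

Lemma order_incl_scalar x : is_cl_scalar (incl x) <-> is_cl_scalar x.
Proof.
split=> /cl_scalarP h; apply/cl_scalarP => S S0; apply/eqP; have /eqP := h S S0;
by rewrite order_incl_eq0.
Qed.

Lemma order_incl_isvec x : is_cl_vec (incl x) <-> is_cl_vec x.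
Proof.
split=> /cl_vecP h; apply/cl_vecP => S S0; apply/eqP; have /eqP := h S S0;
by rewrite order_incl_eq0.
Qed.

Lemma order_incl_vec (v : 'cV[int]_m.+1) : incl (cl_vec _ v) = cl_vec _
  (\col_i (if unlift ord0 i is Some l then Num.sqrt (d l)%:R * (v i 0)%:~R else (v 0 0)%:~R)).
Proof.
rewrite /cl_vec order_inclD order_incl_alg mxE unlift_none; congr (_ + _).
rewrite (big_morph incl (@order_inclD _ _ _) order_incl0); apply: eq_bigr => j _.
by rewrite order_inclZ order_incl_gen scalerA mxE liftK mulrC.
Qed.

Lemma inclM_mul g h : inclM (g *m h) = inclM g *m inclM h.
Proof. by apply/matrixP => i j; rewrite mxE !mulmx2E !mxE order_inclD !order_inclM. Qed.

Lemma inclMD g h : inclM (g + h) = inclM g + inclM h.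
Proof. by apply/matrixP => i j; rewrite !mxE order_inclD. Qed.

Lemma inclMN g : inclM (- g) = - inclM g.
Proof. by apply/matrixP => i j; rewrite !mxE order_inclN. Qed.

Lemma inclM_mk2 a b c e : inclM (mk2 a b c e) = mk2 (incl a) (incl b) (incl c) (incl e).
Proof. by apply: mk2_ext; rewrite mxE !mk2E. Qed.

Lemma inclM_1 : inclM 1%:M = 1%:M.
Proof. by rewrite !mk2_1 inclM_mk2 order_incl1 order_incl0. Qed.

Lemma inclM_hash g : inclM (hash g) = hash (inclM g).
Proof. by rewrite /hash inclM_mk2 !order_inclN !order_incl_transp !mxE. Qed.

Lemma inclM_ctr g : inclM (ctr g) = ctr (inclM g).
Proof. by rewrite /ctr inclM_mk2 !order_incl_conj !mxE. Qed.

Lemma inclM_par g : inclM (par g) = par (inclM g).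
Proof. by rewrite /par inclM_mk2 !order_incl_parity !mxE. Qed.

Lemma inclM_inj : injective inclM.
Proof. by move=> g h /matrixP e; apply/matrixP => i j; have := e i j; rewrite !mxE => /order_incl_inj ->. Qed.

Lemma inclM_herm H : is_herm (inclM H) <-> is_herm H.
Proof.
rewrite /is_herm !mxE -!order_incl_conj.
split=> -[h1 h2 h3 h4]; split; by [apply/order_incl_scalar|apply/order_incl_isvec|rewrite h4|exact: order_incl_inj h4].
Qed.

Definition hermZ (u : 'cV[int]_(3 + m)) : 'M[O]_2 :=
  let x := cl_vec _ (\col_i (if unlift ord0 i is Some l then u (rshift 3 l) 0 else u 0 0)) in
  mk2 (u 1 0)%:A x (cl_conj x) (u (inord 2) 0)%:A.

Lemma inclM_hermZ u : inclM (hermZ u) = hmx (coord_mx R d *m map_mx intr u).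
Proof.
rewrite /hermZ inclM_mk2 !order_incl_alg order_incl_conj order_incl_vec hmx_coord !mxE.
rewrite unlift_none.
set x := \col_i _; set y := \col_i _; suff -> : x = y by [].
apply/matrixP => i j; rewrite [LHS]mxE [RHS]mxE; case E: (unlift ord0 i) => [l|//].
by rewrite !mxE E.
Qed.

Lemma hermZ_herm u : is_herm (hermZ u).
Proof. by split; rewrite /hermZ !mk2E //; eexists. Qed.

Lemma is_hermZP (H : 'M[O]_2) : is_herm H -> exists u, H = hermZ u.
Proof.
case=> -[y y0] [z z1] [x vx] e10; exists (mkQ (x 0 0) y z (fun l => x (lift ord0 l) 0)).
rewrite /hermZ mkQ0 mkQ1 mkQ2.
set w := \col_i _; have -> : w = x.
  apply/matrixP => i j; rewrite mxE (ord1 j); case: (unliftP ord0 i) => [l|] -> //.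
  by rewrite mkQr.
by rewrite -vx -e10 [LHS]mk2_eta y0 z1.
Qed.

Lemma coord_mx_surj (v : 'cV[R]_m.+3) : exists u, v = coord_mx R d *m u.
Proof.
exists (invmx (coord_mx R d : 'M[R]_m.+3) *m v); by rewrite mulKVmx //; exact: coord_mx_unit.
Qed.

Lemma herm_ind (P : 'cV[R]_m.+3 -> Prop) :
  (forall u, P (coord_mx R d *m map_mx intr u)) ->
  (forall a u v, P u -> P v -> P (u + a *: v)) -> forall v, P v.
Proof.
move=> Pi Pl v; have [u ->] := coord_mx_surj v.
have P0 : P 0 by have := Pi 0; rewrite map_mx0 mulmx0.
have -> : u = \sum_j u j 0 *: map_mx intr (delta_mx j 0 : 'cV[int]_(3 + m)).
  rewrite [LHS]matrix_sum_delta; apply: eq_bigr => j _; rewrite big_ord1.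
  by congr (_ *: _); apply/matrixP => i k; rewrite !mxE; case: (_ && _).
rewrite mulmx_sumr; elim: (index_enum _) => [|j s IH]; rewrite ?big_nil // big_cons addrC.
by rewrite -scalemxAr; exact: Pl.
Qed.

Lemma is_herm_lin (a : R) (H K : 'M[C]_2) : is_herm H -> is_herm K -> is_herm (H + rscale a K).
Proof.
move=> [h1 h2 h3 h4] [k1 k2 k3 k4]; split; rewrite ![(H + _) _ _]mxE !rscaleE.
- by apply: is_cl_scalarD => //; exact: is_cl_scalarZ.
- by apply: is_cl_scalarD => //; exact: is_cl_scalarZ.
- by apply: is_cl_vecD => //; exact: is_cl_vecZ.
- by rewrite h4 k4 cl_conjD cl_conjZ.
Qed.

(** The embedding rescales coordinates by nonzero factors, so it detects scalars and Clifford
    vectors. Preservation extends from integral to real Hermitian matrices because the former span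
    the latter. *)
Lemma SL2_incl (g : 'M[O]_2) : SL2 (inclM g) <-> SL2 g.
Proof.
split=> /SL2P[e pg]; apply/SL2P.
  split; first by apply: inclM_inj; rewrite inclM_mul inclM_hash e inclM_1.
  move=> H hH; apply/inclM_herm; rewrite !inclM_mul inclM_ctr; apply: pg.
  exact/inclM_herm.
split; first by rewrite -inclM_hash -inclM_mul e inclM_1.
move=> H /is_hermP[v ->].
apply: (herm_ind (P := fun v => is_herm (inclM g *m hmx v *m ctr (inclM g)))) v => [u|a u v hu hv].
  rewrite -inclM_hermZ -inclM_ctr -!inclM_mul; apply/inclM_herm; apply: pg.
  exact: hermZ_herm.
rewrite hmxD hmxZ mulmxDr mulmxDl rscale_mulmxr rscale_mulmxl; exact: is_herm_lin.
Qed.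

Definition integral (X : 'M[C]_2) : Prop := exists Y, X = inclM Y.

Lemma integralM X Y : integral X -> integral Y -> integral (X *m Y).
Proof. by move=> [x ->] [y ->]; exists (x *m y); rewrite inclM_mul. Qed.
Lemma integralD X Y : integral X -> integral Y -> integral (X + Y).
Proof. by move=> [x ->] [y ->]; exists (x + y); rewrite inclMD. Qed.
Lemma integralN X : integral X -> integral (- X).
Proof. by move=> [x ->]; exists (- x); rewrite inclMN. Qed.
Lemma integral_hash X : integral X -> integral (hash X).
Proof. by move=> [x ->]; exists (hash x); rewrite inclM_hash. Qed.
Lemma integral_par X : integral X -> integral (par X).
Proof. by move=> [x ->]; exists (par x); rewrite inclM_par. Qed.
Lemma integral1 : integral 1%:M.
Proof. by exists 1%:M; rewrite inclM_1. Qed.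
End OrderInclusion.

(** * Bounded denominators *)

Lemma mulmx_cancel_mid (K : nzRingType) n (a x h g y b : 'M[K]_n) : h *m g = 1%:M ->
  a *m x *m h *m (g *m y *m b) = a *m (x *m y) *m b.
Proof. by move=> e; rewrite !mulmxA -(mulmxA _ h g) e mulmx1. Qed.

Lemma mk2_scalar (A : comNzRingType) m (q : 'I_m -> A) (c : clifford q) : c%:M = mk2 c 0 0 c.
Proof. by apply: mk2_ext; rewrite mk2E mxE. Qed.

Section MatrixGeneration.
Variables (m : nat) (q : 'I_m -> int).
Local Notation C := (clifford q).

Lemma matrix2_generation (P : 'M[C]_2 -> Prop) :
  P 1%:M -> (forall X Y, P X -> P Y -> P (X + Y)) -> (forall X, P X -> P (- X)) ->
  (forall X Y, P X -> P Y -> P (X *m Y)) ->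
  P (mk2 0 1 0 0) -> P (mk2 0 0 1 0) -> (forall j, P (cl_gen q j)%:M) -> forall X, P X.
Proof.
move=> P1 PD PN PM Pe Pf Pg X.
have P0 : P 0 by rewrite -[0](addNr 1%:M); apply: PD => //; exact: PN.
have PS S : P (cl_basis q S)%:M.
  apply: (cl_basis_ind (P := fun c => P c%:M)) => [|x Px|k x Px] //.
    by rewrite raddfN; exact: PN.
  by rewrite scalar_mxM; exact: PM.
have PZ (z : int) (c : C) : P c%:M -> P (z *: c)%:M.
  have Pn n : P c%:M -> P (n%:Z *: c)%:M.
    move=> Pc; elim: n => [|n IH]; first by rewrite scale0r raddf0.
    by rewrite intS scalerDl scale1r raddfD; exact: PD.
  by case: z => n Pc; [exact: Pn|rewrite NegzE scaleNr raddfN; apply: PN; exact: Pn].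
have Pc (c : C) : P c%:M.
  rewrite (cl_basis_spanning c) raddf_sum; elim: (index_enum _) => [|S s IH]; rewrite ?big_nil ?big_cons //.
  by apply: PD => //; exact: PZ.
have -> : X = (X 0 0)%:M *m (mk2 0 1 0 0 *m mk2 0 0 1 0) + (X 0 1)%:M *m mk2 0 1 0 0
    + ((X 1 0)%:M *m mk2 0 0 1 0 + (X 1 1)%:M *m (mk2 0 0 1 0 *m mk2 0 1 0 0)).
  rewrite [LHS]mk2_eta !mk2_scalar !mk2M !mk2D.
  by rewrite !(mulr0, mul0r, mulr1, addr0, add0r).
exact: (PD _ _ (PD _ _ (PM _ _ (Pc _) (PM _ _ Pe Pf)) (PM _ _ (Pc _) Pe))
  (PD _ _ (PM _ _ (Pc _) Pf) (PM _ _ (Pc _) (PM _ _ Pf Pe)))).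
Qed.

End MatrixGeneration.

(** Hence c -> d_j c - (sqrt(d_j) e_j) c' (sqrt(d_j) e_j) kills the coordinates whose index contains
    j and multiplies the others by 2 d_j. *)
Lemma gen_parity_gen_coord (R : realType) m (c : real_clifford R m) j U :
  (cl_gen _ j * cl_parity c * cl_gen _ j) U = - (-1) ^+ (j \in U) * c U.
Proof.
have cl_sum (f : {set 'I_m} -> real_clifford R m) : cl_parity (\sum_S f S) = \sum_S cl_parity (f S).
  exact: (big_morph (@cl_parity _ _ _) (@cl_parityD _ _ _) (@cl_parity0 _ _ _)).
have -> : cl_gen _ j * cl_parity c * cl_gen _ j = \sum_(S : {set 'I_m}) ((- (-1) ^+ (j \in S) * c S) : R) *: cl_basis (fun=> 1) S :> real_clifford R m.
  rewrite (cl_basis_spanning c) cl_sum mulr_sumr mulr_suml; apply: eq_bigr => S _.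
  rewrite -(cl_basis_spanning c) cl_parityZ -scalerAr -scalerAl cl_gen_parity -scalerAl -mulrA cl_gen_sqr.
  by rewrite scaleN1r mulrN1 !scalerN scalerA mulNr scaleNr mulrC.
rewrite sum_ffunE (bigD1 U) //= big1 => [|S SU].
  by rewrite addr0 ffunE cl_basisE eqxx [LHS]mulr1.
by rewrite ffunE cl_basisE eq_sym (negPf SU) [LHS]mulr0.
Qed.

Section Denominators.
Variables (R : realType) (m : nat) (d : 'I_m -> nat).
Hypothesis d_gt0 : forall j, (0 < d j)%N.
Local Notation O := (clifford (fun j => (d j)%:Z)).
Local Notation C := (real_clifford R m).
Local Notation incl := (@order_incl R m d).
Local Notation inclM := (map_mx incl : 'M[O]_2 -> 'M[C]_2).
Local Notation int2 := (@integral R m d).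

Variable g : 'M[C]_2.
Hypothesis Vg : hash g *m g = 1%:M.
Hypothesis gH : forall u, int2 (g *m inclM (hermZ d u) *m ctr g).

(** [N1] is a ring because the inner factors g^# g cancel. [N2] is its twisted companion: N1 N2 lies
    in [N2], and multiplying by the parity of an element of [N2] removes the twist. *)
Let N1 (Y : 'M[O]_2) := int2 (g *m inclM Y *m hash g).
Let N2 (Y : 'M[O]_2) := int2 (g *m inclM Y *m par (hash g)).

Let N1M X Y : N1 X -> N1 Y -> N1 (X *m Y).
Proof.
move=> hX hY; have := integralM hX hY; rewrite /N1 inclM_mul.
suff -> : g *m inclM X *m hash g *m (g *m inclM Y *m hash g) = g *m (inclM X *m inclM Y) *m hash g by [].
exact: mulmx_cancel_mid.
Qed.

Let N12 X Y : N1 X -> N2 Y -> N2 (X *m Y).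
Proof.
move=> hX hY; have := integralM hX hY; rewrite /N2 inclM_mul.
suff -> : g *m inclM X *m hash g *m (g *m inclM Y *m par (hash g)) = g *m (inclM X *m inclM Y) *m par (hash g) by [].
exact: mulmx_cancel_mid.
Qed.

Let N22 X Y : N2 X -> N2 Y -> N1 (X *m par Y).
Proof.
move=> hX hY; have := integralM hX (integral_par hY); rewrite /N1 inclM_mul !par_mul parK inclM_par.
suff -> : g *m inclM X *m par (hash g) *m (par g *m par (inclM Y) *m hash g) =
  g *m (inclM X *m par (inclM Y)) *m hash g by [].
by apply: mulmx_cancel_mid; rewrite -par_mul Vg par1.
Qed.

Let N1D X Y : N1 X -> N1 Y -> N1 (X + Y).
Proof. by rewrite /N1 inclMD mulmxDr mulmxDl; exact: integralD. Qed.

Let N1N X : N1 X -> N1 (- X).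
Proof. by rewrite /N1 inclMN mulmxN mulNmx; exact: integralN. Qed.

Let N2N X : N2 X -> N2 (- X).
Proof. by rewrite /N2 inclMN mulmxN mulNmx; exact: integralN. Qed.

(* [g^bar^T w = w (g^#)'] turns the Hermitian action into [X |-> g X (g^#)']. *)
Let N2H H : is_herm H -> N2 (H *m mk2 0 1 (-1) 0).
Proof.
move=> /is_hermZP[u ->]; have [Y HY] := gH u.
exists (Y *m mk2 0 1 (-1) 0); rewrite !inclM_mul -HY inclM_mk2 order_inclN order_incl1 order_incl0.
by rewrite -(mulmxA _ (ctr g)) ctr_wE !mulmxA.
Qed.

Let s0 : is_cl_scalar (0 : O). Proof. by exists 0; rewrite scale0r. Qed.
Let s1 : is_cl_scalar (1 : O). Proof. by exists 1; rewrite scale1r. Qed.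
Let v0 : is_cl_vec (0 : O). Proof. by apply/cl_vecP => S _; rewrite ffunE. Qed.
Let v1 : is_cl_vec (1 : O).
Proof. by apply/cl_vecP => S; rewrite ffunE; case: eqP => // ->; rewrite cards0. Qed.
Let vg j : is_cl_vec (cl_gen _ j : O).
Proof. by apply/cl_vecP => S; rewrite ffunE; case: eqP => // ->; rewrite cards1. Qed.

(** Here and in the next three facts, w multiplies the Hermitian matrices diag(1, 0), diag(0, 1),
    [[0, 1], [1, 0]] and [[0, e_j], [-e_j, 0]]. *)
Let N2e : N2 (mk2 0 1 0 0).
Proof.
have := @N2H (mk2 1 0 0 0); rewrite /is_herm !mk2E mk2M cl_conj0 => /(_ (And4 s1 s0 v0 erefl)).
by rewrite !(mulr0, mul0r, mulr1, mul1r, addr0, add0r).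
Qed.

Let N2f : N2 (mk2 0 0 1 0).
Proof.
have := @N2H (mk2 0 0 0 1); rewrite /is_herm !mk2E mk2M cl_conj0 => /(_ (And4 s0 s1 v0 erefl)) /N2N.
by rewrite !(mulr0, mul0r, mulr1, mul1r, addr0, add0r) mk2N !oppr0 opprK.
Qed.

Let N2d : N2 (mk2 1 0 0 (-1)).
Proof.
have := @N2H (mk2 0 1 1 0); rewrite /is_herm !mk2E mk2M cl_conj1 => /(_ (And4 s0 s0 v1 erefl)) /N2N.
by rewrite !(mulr0, mul0r, mulr1, mul1r, addr0, add0r) mk2N !oppr0 opprK.
Qed.

Let N2g j : N2 (cl_gen _ j)%:M.
Proof.
have := @N2H (mk2 0 (cl_gen _ j) (cl_conj (cl_gen _ j)) 0); rewrite /is_herm !mk2E mk2M.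
move=> /(_ (And4 s0 s0 (vg j) erefl)) /N2N.
rewrite /cl_conj cl_parity_gen cl_transpN cl_transp_gen.
rewrite !(mulr0, mul0r, mulr1, mul1r, mulrN1, addr0, add0r) mk2N !oppr0 opprK.
by congr N2; apply: mk2_ext; rewrite mk2E mxE.
Qed.

Lemma integral_sandwich X : N1 X.
Proof.
have pm a b c e : par (mk2 a b c e : 'M[O]_2) = mk2 (cl_parity a) (cl_parity b) (cl_parity c) (cl_parity e).
  by rewrite /par !mk2E.
have p1 := (cl_parityN, @cl_parity1 _ _ (fun j => (d j)%:Z), @cl_parity0 _ _ (fun j => (d j)%:Z)).
(* Untwisted products of the elements of [N2] give the four matrix units up to sign. *)
have e11 := N22 N2e N2f; have e22 := N22 N2f N2e.
have e12 := N1N (N22 N2e N2d); have e21 := N22 N2f N2d.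
rewrite pm !p1 ?oppr0 mk2M !(mulr0, mul0r, mulr1, mul1r, mulrN1, addr0, add0r) ?mk2N ?oppr0 ?opprK in e11 e12 e21 e22.
rewrite pm !p1 ?oppr0 mk2M !(mulr0, mul0r, mulr1, mul1r, mulrN1, addr0, add0r) ?mk2N ?oppr0 ?opprK in e12.
rewrite pm !p1 ?oppr0 mk2M !(mulr0, mul0r, mulr1, mul1r, mulrN1, addr0, add0r) ?mk2N ?oppr0 ?opprK in e21.
rewrite pm !p1 ?oppr0 mk2M !(mulr0, mul0r, mulr1, mul1r, mulrN1, addr0, add0r) ?mk2N ?oppr0 ?opprK in e22.
move: X; apply: (@matrix2_generation _ _ N1 _ N1D N1N N1M e12 e21) => [|j].
  by have := N1D e11 e22; rewrite mk2D !addr0 !add0r -mk2_1.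
(* The scalar e_j is recovered as e_j diag(1, -1) times diag(1, -1), the last factor being the
   difference of the diagonal matrix units. *)
have := N1M (N22 (N2g j) N2d) (N1D e11 (N1N e22)); rewrite pm !p1 ?oppr0.
congr N1; rewrite !mk2_scalar mk2N mk2D !mk2M.
by rewrite !(mulr0, mul0r, mulr1, mul1r, mulrN1, mulNr, mulrN, subr0, sub0r, oppr0, addr0, add0r, opprK).
Qed.

(** As diag(1, -1) lies in [N2] and squares to 1, [N2] absorbs every matrix; applying parity moves
    the twist from g^# to g. *)
Lemma integral_sandwich_par X : int2 (par g *m inclM X *m hash g).
Proof.
have h : N2 (par X).
  have -> : par X = par X *m mk2 1 0 0 (-1) *m mk2 1 0 0 (-1).
    rewrite -mulmxA mk2M !(mulr0, mul0r, mulr1, mul1r, mulrN1, opprK, oppr0, addr0, add0r) -mk2_1.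
    by rewrite mulmx1.
  apply: N12; [exact: integral_sandwich|exact: N2d].
have := integral_par h; rewrite !par_mul parK -inclM_par parK.
by [].
Qed.

(** Requiring the condition for y and its parity makes the bimodule stable under parity, which the
    projections on coordinates use. *)
Let Bm (y : 'M[C]_2) := forall Y, int2 (y *m inclM Y *m hash g) /\ int2 (par y *m inclM Y *m hash g).

Let Bm_g : Bm g.
Proof. by move=> Y; split; [exact: integral_sandwich|exact: integral_sandwich_par]. Qed.

Let Bm_par y : Bm y -> Bm (par y).
Proof. by move=> hy Y; rewrite parK; have [] := hy Y. Qed.

Let BmD x y : Bm x -> Bm y -> Bm (x + y).
Proof.
move=> hx hy Y; rewrite parD !mulmxDl; have [x1 x2] := hx Y; have [y1 y2] := hy Y.
by split; exact: integralD.
Qed.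

Let BmN x : Bm x -> Bm (- x).
Proof.
move=> hx Y; have -> : par (- x) = - par x.
  by apply: mk2_ext; rewrite /par !mxE /= ?cl_parityN.
by rewrite !mulNmx; have [x1 x2] := hx Y; split; exact: integralN.
Qed.

Let Bm_r y X : Bm y -> Bm (y *m inclM X).
Proof.
move=> hy Y; rewrite par_mul -inclM_par -2!(mulmxA _ (inclM _) (inclM Y)) -!inclM_mul.
by split; [have [] := hy (X *m Y)|have [] := hy (par X *m Y)].
Qed.

Let Bm_l y X : Bm y -> Bm (inclM X *m y).
Proof.
move=> hy Y; rewrite par_mul -inclM_par -!mulmxA.
have [h1 h2] := hy Y; split; apply: integralM; rewrite ?mulmxA //; by eexists.
Qed.

Let Bs (c : C) := Bm c%:M.

Let par_scalarC (c : C) : par c%:M = (cl_parity c)%:M.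
Proof. by apply: mk2_ext; rewrite /par !mk2E !mxE ?cl_parity0. Qed.

Let inclM_scalar (a : O) : inclM a%:M = (incl a)%:M.
Proof. by apply: mk2_ext; rewrite !mxE ?order_incl0. Qed.

Let Bs_par c : Bs c -> Bs (cl_parity c).
Proof. by move=> /Bm_par; rewrite par_scalarC. Qed.
Let BsD b c : Bs b -> Bs c -> Bs (b + c).
Proof. move=> hb hc; rewrite /Bs; have -> : (b + c)%:M = b%:M + c%:M :> 'M[C]_2 by exact: raddfD.
exact (BmD hb hc). Qed.
Let BsN c : Bs c -> Bs (- c).
Proof. move=> hc; rewrite /Bs; have -> : (- c)%:M = - c%:M :> 'M[C]_2 by exact: raddfN.
exact (BmN hc). Qed.
Let Bs_l a c : Bs c -> Bs (incl a * c).
Proof. by move=> hc; rewrite /Bs scalar_mxM -inclM_scalar; exact: Bm_l. Qed.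
Let Bs_r a c : Bs c -> Bs (c * incl a).
Proof. by move=> hc; rewrite /Bs scalar_mxM -inclM_scalar; exact: Bm_r. Qed.
Let BsZ (z : int) c : Bs c -> Bs (z%:~R *: c).
Proof. by move=> hc; rewrite -mulr_algl -(@order_incl_alg R m d); exact: Bs_l. Qed.

(** The scalar matrix of g_ik is the sum over a of E_ai g E_ka, with matrix units E. *)
Let Bs_entry i k : Bs (g i k).
Proof.
have -> : Bs (g i k) = Bm (\sum_a (inclM (delta_mx a i) *m g *m inclM (delta_mx k a))).
  congr Bm; apply/matrixP => r s; rewrite summxE mxE (bigD1 r) //= big1 => [|a ar].
    rewrite addr0 mxE (bigD1 k) //= big1 => [|l lk].
      rewrite addr0 mxE (bigD1 i) //= big1 => [|l li].
        rewrite !mxE !eqxx /= order_incl1 mul1r addr0 eq_sym; case: eqP => _ /=; first by rewrite order_incl1 mulr1.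
        by rewrite order_incl0 mulr0.
      by rewrite !mxE (negPf li) andbF order_incl0 mul0r.
    have -> : inclM (delta_mx k r) l s = 0 by rewrite !mxE (negPf lk) order_incl0.
    by rewrite mulr0.
  rewrite mxE big1 // => l _; rewrite mxE big1 ?mul0r // => l' _.
  by rewrite !mxE eq_sym (negPf ar) order_incl0 mul0r.
rewrite big_ord_recl big_ord1; apply: BmD; apply: Bm_r; exact: Bm_l.
Qed.

Let Bs_kill c j : Bs c -> Bs [ffun U : {set 'I_m} => if j \in U then 0 else (2 * (d j)%:R) * c U : R^o].
Proof.
move=> hc.
have : Bs ((d j)%:Z%:~R *: c + - (incl (cl_gen _ j) * cl_parity c * incl (cl_gen _ j))).
  by apply: BsD; [exact: BsZ|apply: BsN; apply: Bs_r; apply: Bs_l; exact: Bs_par].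
congr Bs; apply/ffunP => U; rewrite order_incl_gen -!scalerAl -scalerAr scalerA -expr2 sqr_sqrtr ?ler0n //.
move: (gen_parity_gen_coord c j U); set y := _ * _ * _; clearbody y => yE.
rewrite !ffunE yE; case: (j \in U) => /=; rewrite /GRing.scale /=.
  by rewrite expr1 opprK mul1r subrr.
by rewrite expr0 mulN1r mulrN opprK -[(d j)%:~R]/((d j)%:R) -mulrDl -mulr2n mulr_natl.
Qed.

Let Bs_filter (s : seq 'I_m) c : Bs c ->
  Bs [ffun U : {set 'I_m} => if has (mem U) s then 0 else (\prod_(j <- s) (2 * (d j)%:R)) * c U : R^o].
Proof.
move=> hc; elim: s => [|j s IH].
  by move: hc; congr Bs; apply/ffunP => U; rewrite ffunE big_nil mul1r.
have := Bs_kill j IH; congr Bs; apply/ffunP => U; rewrite !ffunE big_cons /=.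
by case: (j \in U) => //=; case: has; rewrite ?mulr0 // mulrA.
Qed.

Let Bs_scalar c : Bs c -> Bs (\prod_j (2 * (d j)%:R) * c finset.set0)%:A.
Proof.
move=> /(Bs_filter (index_enum _)); congr Bs; apply/ffunP => U; rewrite ffunE cl_algE.
case: eqP => [->|/eqP/set0Pn[j jU]].
  by rewrite ifN //; apply/hasPn => j _; rewrite /= inE.
by rewrite ifT //; apply/hasP; exists j => //; exact: mem_index_enum.
Qed.

Definition order_coord (x : C) (S : {set 'I_m}) : R := x S / @rootd R m d S.

(** The factors 2 d_j come from projecting to the constant coordinate; the further d_j come from
    squaring the scale sqrt(d_S) of a coordinate and completing the product over the complement of
    S. *)
Definition denominator : nat := (\prod_j (2 * d j * d j))%N.

Lemma denominatorE : denominator%:R = \prod_j (2 * (d j)%:R) * (\prod_j (d j)%:Z)%:~R :> R.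
Proof.
rewrite /denominator natr_prod [X in _ * X]rmorph_prod /= -big_split /=.
by apply: eq_bigr => j _; rewrite !natrM.
Qed.

Lemma denominator_gt0 : (0 < denominator)%N.
Proof. by rewrite prodn_gt0 // => j; rewrite !muln_gt0 d_gt0. Qed.

Lemma rscale_hash (a : R) (X : 'M[C]_2) : hash (rscale a X) = rscale a (hash X).
Proof.
by apply: mk2_ext; rewrite rscaleE /hash !mk2E !rscaleE ?cl_transpZ ?scalerN.
Qed.

(** Projecting g_ik times the order element e_S to its constant term isolates the coordinate at [S].
    A real scalar a in the bimodule makes a g^# integral, and hence a g. *)
Lemma coord_integral i k S : int2 (rscale (denominator%:R * order_coord (g i k) S) g).
Proof.
set x := g i k; set z := order_coord x S.
have : Bs (x * incl (cl_basis _ S)) by apply: Bs_r; exact: Bs_entry.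
have -> : incl (cl_basis _ S) = @rootd R m d S *: cl_basis _ S.
  apply/ffunP => U; rewrite order_inclE cl_basisE [RHS]ffunE cl_basisE; case: eqP => [->|_].
    by rewrite mul1r [RHS]mulr1.
  by rewrite mul0r [RHS]mulr0.
move=> /Bs_scalar; rewrite -scalerAr ffunE cl_basis_coord.
have [b ->] : exists b : bool, cl_coef (fun=> 1 : R) S S = (-1) ^+ b.
  rewrite /cl_coef prodrN big1 // mulr1 -exprD; set n := (_ + _)%N.
  by exists (odd n); rewrite signr_odd.
(* The sign cancels the one in e_S^2, and the product over the complement of [S] makes the constant
   independent of [S]. *)
move=> /(BsZ ((-1) ^+ b * \prod_(j in ~: S) (d j)%:Z)); rewrite scalerA.
have -> : ((-1) ^+ b * \prod_(j in ~: S) (d j)%:Z)%:~R * (\prod_j (2 * (d j)%:R) *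
    (@rootd R m d S *: ((-1) ^+ b * x S) : R^o)) = denominator%:R * z.
  have xS : x S = @rootd R m d S * z by rewrite mulrC divfK // rootd_neq0.
  rewrite xS rmorphM rmorphXn rmorphN1 /= [X in _ * (_ * X)](_ : _ = (-1) ^+ b * (@rootd R m d S * @rootd R m d S * z)); last first.
    by rewrite /GRing.scale /=; ring.
  rewrite rootd_sqr.
  have -> : denominator%:R = \prod_j (2 * (d j)%:R) * ((\prod_(j in ~: S) (d j)%:Z)%:~R * (\prod_(j in S) (d j)%:Z)%:~R) :> R.
    have bS : \prod_(j in ~: S) (d j)%:Z = \prod_(j | j \notin S) (d j)%:Z.
      by apply: eq_bigl => j; rewrite inE.
    rewrite -intrM [X in X%:~R]mulrC bS.
    have bI : \prod_j (d j)%:Z = \prod_(j in S) (d j)%:Z * \prod_(j | j \notin S) (d j)%:Z.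
      by rewrite (bigID (mem S)).
    by rewrite -bI; exact: denominatorE.
  have sq : (-1) ^+ b * (-1) ^+ b = 1 :> R by rewrite -expr2 sqrr_sign.
  transitivity ((-1) ^+ b * (-1) ^+ b * (\prod_j (2 * (d j)%:R) * ((\prod_(j in ~: S) (d j)%:Z)%:~R * (\prod_(j in S) (d j)%:Z)%:~R)) * z).
    by ring.
  by rewrite sq mul1r.
move=> /(_ 1%:M)[+ _]; rewrite inclM_1 mulmx1 => /integral_hash.
have -> : (denominator%:R * z)%:A%:M *m hash g = rscale (denominator%:R * z) (hash g) :> 'M[C]_2.
  by rewrite -[in RHS](mul1mx (hash g)) -rscale_mulmxl; congr (_ *m _); apply: mk2_ext; rewrite rscaleE !mxE ?scaler0.
by rewrite rscale_hash hashK.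
Qed.

End Denominators.

(** * Finiteness of the index *)

(** The sum is a greatest common divisor of the family, [c] its Bezout coefficients and [u] the
    quotients. *)
Lemma bezout_family (I : finType) (f : I -> int) :
  exists c u : I -> int, forall i, f i = u i * \sum_j c j * f j.
Proof.
suff [e [[c ec] de]] : exists e, (exists c : I -> int, e = \sum_j c j * f j) /\
    (forall i, i \in enum I -> (e %| f i)%Z).
  by exists c, (fun i => (f i %/ e)%Z) => i; rewrite -ec divzK // de // mem_enum.
elim: (enum I) => [|i s [e [[c ec] de]]].
  exists 0; split=> //; exists (fun=> 0); rewrite big1 // => j _; exact: mul0r.
have [a [b ab]] : exists a b : int, a * f i + b * e = gcdz (f i) e.
  by have [a [b ab]] := Bezoutz (f i) e; exists a, b.
exists (gcdz (f i) e); split.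
  exists (fun j => a * (j == i)%:R + b * c j); rewrite -ab ec mulr_sumr.
  under [RHS]eq_bigr do rewrite mulrDl -!mulrA.
  rewrite big_split /=; congr (_ + _); rewrite (bigD1 i) //= eqxx mul1r big1 ?addr0 // => j /negPf ->.
  by rewrite mul0r mulr0.
move=> j; rewrite inE => /orP[/eqP->|/de]; first exact: dvdz_gcdl.
exact/dvdz_trans/dvdz_gcdr.
Qed.

Section Reduction.
Variables (R : realType) (m : nat) (d : 'I_m -> nat).
Hypothesis d_gt0 : forall j, (0 < d j)%N.
Local Notation O := (clifford (fun j => (d j)%:Z)).
Local Notation C := (real_clifford R m).
Local Notation incl := (@order_incl R m d).
Local Notation inclM := (map_mx incl : 'M[O]_2 -> 'M[C]_2).
Local Notation int2 := (@integral R m d).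
Local Notation D := (denominator d).
Local Notation I := ('I_2 * 'I_2 * {set 'I_m})%type.

Lemma rscaleA (a b : R) (X : 'M[C]_2) : rscale a (rscale b X) = rscale (a * b) X.
Proof. by apply/matrixP => i j; rewrite !rscaleE scalerA. Qed.

Lemma rscaleDr (a : R) (X Y : 'M[C]_2) : rscale a (X + Y) = rscale a X + rscale a Y.
Proof. by apply/matrixP => i j; rewrite [RHS]mxE !rscaleE mxE scalerDr. Qed.

Lemma rscale1 (X : 'M[C]_2) : rscale 1 X = X.
Proof. by apply/matrixP => i j; rewrite !rscaleE scale1r. Qed.

Lemma rscaleN1 (a : R) (X : 'M[C]_2) : rscale (- a) X = - rscale a X.
Proof. by apply/matrixP => i j; rewrite [RHS]mxE !rscaleE scaleNr. Qed.

Let ent (g : 'M[C]_2) (al : I) : R := order_coord d (g al.1.1 al.1.2) al.2.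
Let entZ (U : 'M[O]_2) (al : I) : int := U al.1.1 al.1.2 al.2.

Let ent_incl U al : ent (inclM U) al = (entZ U al)%:~R.
Proof. by rewrite /ent /order_coord mxE order_inclE mulfK // rootd_neq0. Qed.

Let entZ_rscale a g al : ent (rscale a g) al = a * ent g al.
Proof. by rewrite /ent /order_coord rscaleE ffunE -mulrA. Qed.

Let ent_ext g h : (forall al, ent g al = ent h al) -> g = h.
Proof.
move=> e; apply/matrixP => i j; apply/ffunP => S; have := e (i, j, S).
by rewrite /ent /order_coord /= => /mulIf -> //; rewrite invr_eq0 rootd_neq0.
Qed.

(* [g] is integral up to the irrational factor [N^(-1/2)]. *)
Definition reduced (g : 'M[C]_2) (N : nat) (U : 'M[O]_2) : Prop :=
  (0 < N <= D)%N /\ exists2 mu : R, g = rscale mu (inclM U) & N%:R * mu ^+ 2 = 1.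

(** For a nonzero coordinate g_al0, the multiple D g_al0 g has integral coordinates. Dividing by
    their greatest common divisor e gives U, and mu = e / (D g_al0). *)
Lemma reduced_exists (g : 'M[C]_2) : hash g *m g = 1%:M ->
  (forall i k S, int2 (rscale (D%:R * order_coord d (g i k) S) g)) ->
  exists N U, reduced g N U.
Proof.
move=> Vg gD.
have DN0 : D%:R != 0 :> R by rewrite pnatr_eq0 -lt0n denominator_gt0.
have g0 : exists al, ent g al != 0.
  apply: contrapT => h; have g0 : g = 0.
    apply: ent_ext => al; transitivity (0 : R).
      by apply/eqP/negPn/negP => ne; apply: h; exists al.
    by rewrite /ent /order_coord mxE ffunE mul0r.
  have := congr1 (fun X : 'M[C]_2 => X 0 0) Vg; rewrite g0 mulmx0 !mxE => /esym/eqP.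
  by rewrite oner_eq0.
have [al0 ne0] := g0.
have gZ al be : D%:R * ent g al * ent g be \is a Num.int.
  have [Y YE] := gD al.1.1 al.1.2 al.2.
  by rewrite -[D%:R * _]/(D%:R * order_coord d (g al.1.1 al.1.2) al.2) -entZ_rscale YE ent_incl.
have kZ be : exists k : int, D%:R * ent g al0 * ent g be = k%:~R by apply/intrP.
have {kZ}[k kE] := choice kZ.
have [c [u uE]] := bezout_family k.
set e := \sum_j c j * k j in uE.
have e0 : e != 0.
  apply: contraNneq ne0 => e0; have := kE al0; rewrite uE e0 mulr0 => /eqP.
  by rewrite mulf_eq0 mulf_eq0 (negPf DN0) /= orbb.
pose mu : R := e%:~R / (D%:R * ent g al0).
have dn0 : D%:R * ent g al0 != 0 by rewrite mulf_neq0.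
have entE be : ent g be = mu * (u be)%:~R.
  apply: (mulfI dn0); rewrite kE uE intrM /mu mulrA [X in _ = X * _]mulrC divfK //.
  exact: mulrC.
have cu : \sum_j c j * u j = 1.
  apply: (mulIf e0); rewrite mul1r mulr_suml {2}/e; apply: eq_bigr => j _.
  by rewrite -mulrA -uE.
pose U : 'M[O]_2 := \matrix_(i, j) [ffun S => u (i, j, S) : int^o].
have gE : g = rscale mu (inclM U).
  apply: ent_ext => -[[i j] S]; rewrite entZ_rscale ent_incl entE; congr (_ * _%:~R).
  by rewrite /entZ mxE ffunE.
have muE : \sum_be (c be)%:~R * ent g be = mu.
  under eq_bigr do rewrite entE mulrCA -intrM.
  by rewrite -mulr_sumr -rmorph_sum /= cu mulr1.
(* By the Bezout relation, mu is an integral combination of coordinates of g, so D mu^2 is one of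
   the integers D g_al g_be. *)
have [M ME] : exists M : int, D%:R * mu ^+ 2 = M%:~R.
  apply/intrP; rewrite expr2 -{1}muE -muE mulr_suml mulr_sumr rpred_sum // => al _.
  rewrite mulr_sumr mulr_sumr rpred_sum // => be _.
  have -> : D%:R * ((c al)%:~R * ent g al * ((c be)%:~R * ent g be)) =
    (c al)%:~R * (c be)%:~R * (D%:R * ent g al * ent g be) by ring.
  by have /intrP[z ->] := gZ al be; rewrite -!intrM; exact: intr_int.
(* The constant term of an entry of g^# g = 1, written through U. *)
have [n nE] : exists n : int, n%:~R * mu ^+ 2 = 1.
  exists ((hash U *m U) 0 0 finset.set0).
  have := Vg; rewrite gE rscale_hash rscale_mulmxl rscale_mulmxr rscaleA -inclM_hash -inclM_mul.
  move=> /(congr1 (fun X : 'M[C]_2 => X 0 0 finset.set0)).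
  rewrite rscaleE ffunE [inclM _ _ _]mxE order_inclE /rootd big_set0 mulr1 !mxE ffunE eqxx.
  by rewrite /GRing.scale /= expr2 mulrC => ->.
have mu2 : 0 < mu ^+ 2.
  rewrite lt_def sqr_ge0 andbT; apply/eqP => mu0; move: nE; rewrite mu0 mulr0 => /esym/eqP.
  by rewrite oner_eq0.
have n0 : 0 < n by rewrite -(ltr0z R) -(pmulr_lgt0 _ mu2) nE.
have M0 : 0 < M by rewrite -(ltr0z R) -ME mulr_gt0 // ltr0n denominator_gt0.
have nM : n * M = D%:Z.
  apply: (@intr_inj R); rewrite intrM -ME mulrCA nE mulr1.
  by rewrite -[RHS]/(D%:R).
exists `|n|%N, U; split; last first.
  exists mu => //; rewrite -[(absz n)%:R]/((absz n)%:Z%:~R) gez0_abs ?ltW //.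
move: n0 M0 nM; clear; nia.
Qed.

(** N and the residues modulo N are at most D, which makes the set of classes finite. *)
Let cls (N : nat) (U : 'M[O]_2) : 'I_D.+1 * {ffun I -> 'I_D.+1} :=
  (inord N, [ffun al => inord `|(entZ U al %% N)%Z|%N]).

(** Equal N leave only the sign of mu open. If mu = mu' and U = U' + N T, then g'^# g = 1 + N mu^2
    U'^# T = 1 + U'^# T. *)
Lemma reduced_class g g' N N' U U' : hash g' *m g' = 1%:M ->
  reduced g N U -> reduced g' N' U' -> cls N U = cls N' U' -> int2 (hash g' *m g).
Proof.
move=> Vg' [/andP[N0 ND] [mu gE muN]] [/andP[N0' ND'] [mu' gE' muN']] [/(congr1 val)].
rewrite /= !inordK ?ltnS // => eN; rewrite -{}eN in muN' N0' ND' *; clear N'.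
move=> /ffunP eU.
have dvdU al : (N%:Z %| entZ U al - entZ U' al)%Z.
  have := congr1 val (eU al); rewrite !ffunE /=.
  have NZ : (N : int) != 0 by rewrite eqz_nat -lt0n.
  have lt x : (`|(x %% N)%Z| < D.+1)%N.
    rewrite ltnS (leq_trans _ ND) // ltnW // -ltz_nat gez0_abs ?modz_ge0 //.
    by rewrite ltz_pmod // ltz_nat.
  rewrite !inordK // => /(congr1 Posz); rewrite !gez0_abs ?modz_ge0 // => e.
  by rewrite -eqz_mod_dvd; apply/eqP.
pose T : 'M[O]_2 := \matrix_(i, j) [ffun S => ((entZ U (i, j, S) - entZ U' (i, j, S)) %/ N)%Z : int^o].
have UT : inclM U = inclM U' + rscale N%:R (inclM T).
  apply/matrixP => i j; rewrite [RHS]mxE rscaleE; apply/ffunP => S.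
  have := dvdU (i, j, S); rewrite !mxE !ffunE /= /entZ /= => /divzK e.
  set t := (_ %/ _)%Z in e *; clearbody t.
  have -> : U i j S = U' i j S + N%:Z * t by rewrite mulrC e addrC subrK.
  by rewrite rmorphD rmorphM /= mulrDl; congr (_ + _); rewrite -mulrA.
have main x : x = rscale mu' (inclM U) -> int2 (hash g' *m x).
  move=> ->; rewrite UT rscaleDr -gE' mulmxDr Vg'; apply: integralD; first exact: integral1.
  rewrite gE' rscale_hash rscaleA rscale_mulmxl rscale_mulmxr rscaleA.
  have -> : mu' * (mu' * N%:R) = N%:R * mu' ^+ 2 by ring.
  rewrite muN' rscale1.
  by exists (hash U' *m T); rewrite inclM_mul inclM_hash.
have : mu ^+ 2 = mu' ^+ 2.
  have NR : N%:R != 0 :> R by rewrite pnatr_eq0 -lt0n.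
  by apply: (mulfI NR); rewrite muN muN'.
move/eqP; rewrite eqf_sqr => /orP[]/eqP e; first by apply: main; rewrite gE e.
rewrite -[g]opprK mulmxN; apply: integralN; apply: main.
by rewrite gE e rscaleN1 opprK.
Qed.

Lemma reduction_classes : exists (T : finType) (c : nat -> 'M[O]_2 -> T),
  forall g g' N N' U U', hash g' *m g' = 1%:M ->
    reduced g N U -> reduced g' N' U' -> c N U = c N' U' -> int2 (hash g' *m g).
Proof. by eexists; exists cls; exact: reduced_class. Qed.

End Reduction.

Lemma int_mx_columns (K : numDomainType) p q (M : 'M[K]_(p, q)) :
  (forall u : 'cV[int]_q, exists w : 'cV[int]_p, M *m map_mx intr u = map_mx intr w) ->
  exists B : 'M[int]_(p, q), M = map_mx intr B.
Proof.
move=> hM; have {hM}[w wE] := choice hM.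
exists (\matrix_(i, j) w (delta_mx j 0) i 0); apply/matrixP => i j; rewrite !mxE.
have /matrixP/(_ i 0) := wE (delta_mx j 0); rewrite map_delta_mx -colE !mxE => <-.
by [].
Qed.

Lemma invmx_mulmx (K : comUnitRingType) n (A B : 'M[K]_n) : A \in unitmx -> B \in unitmx ->
  invmx (A *m B) = invmx B *m invmx A.
Proof.
move=> uA uB; apply: (can_inj (mulKmx (_ : A *m B \in unitmx))); first by rewrite unitmx_mul uA.
by rewrite mulmxV ?unitmx_mul ?uA // mulmxA mulmxK // mulmxV.
Qed.

Section IntegralOrthogonalGroup.
Variables (R : realType) (k : nat) (F : 'cV[R]_k -> R) (J : 'M[R]_k).
Hypotheses (FE : forall v, F v = (v^T *m J *m v) 0 0) (JT : J^T = J) (JU : J \in unitmx).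
Local Notation G := (orthogonal_group F).

Lemma integral_orthogonal_subgroup (h : G) : is_subgroup (integral_orthogonal h).
Proof.
have hU := orthogonal_unit h; split.
- by exists 1%:M; rewrite map_mx1 mulmx1 mulmxV.
- move=> A A' [B e] [B' e']; exists (B *m B'); rewrite -[val (A * A')%g]/(val A *m val A') e e'.
  by rewrite map_mxM !mulmxA mulmxKV.
- move=> A [B e]; exists (\det B *: \adj B).
  have dB : \det B * \det B = 1.
    apply: (@intr_inj R); rewrite intrM -det_map_mx.
    have dA : \det (val A) = \det (map_mx intr B : 'M[R]_k).
      rewrite e !det_mulmx det_inv mulrC mulKf //.
      by rewrite -unitfE; exact: hU.
    by have := det_orthogonal FE JT JU A; rewrite dA.
  have BV : B *m (\det B *: \adj B) = 1%:M by rewrite -scalemxAr mul_mx_adj scale_scalar_mx dB.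
  apply: (can_inj (mulKmx (orthogonal_unit A))); transitivity (1%:M : 'M[R]_k).
    exact: (mulmxV (orthogonal_unit A)).
  by rewrite e !mulmxA mulmxKV // -(mulmxA (val h)) -map_mxM BV map_mx1 mulmx1 mulmxV.
Qed.

End IntegralOrthogonalGroup.

(** * The image of SL_2(O) compared with the lattice stabilizer *)

Section Main.
Variables (R : realType) (m : nat) (d : 'I_m -> nat).
Hypothesis d_gt0 : forall j, (0 < d j)%N.
Local Notation O := (clifford (fun j => (d j)%:Z)).
Local Notation C := (real_clifford R m).
Local Notation incl := (@order_incl R m d).
Local Notation inclM := (map_mx incl : 'M[O]_2 -> 'M[C]_2).
Local Notation int2 := (@integral R m d).
Local Notation L := (orthogonal_group (@lorentz R m.+2)).
Local Notation G := (orthogonal_group (@form_Q R m d)).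
Local Notation S := (coord_mx R d : 'M[R]_m.+3).

Variables (phi : 'M[C]_2 -> L) (phi_iso : is_moebius_iso phi).
Variables (T : 'M[R]_(m.+3)) (T_unit : T \in unitmx)
  (T_isometry : forall v, form_Q d (T *m v) = - lorentz v).

Let SU : S \in unitmx. Proof. exact: coord_mx_unit. Qed.
Let SE u : lorentz (S *m u) = - form_Q d u. Proof. exact: lorentz_coordE. Qed.

Let hP : T *m S \in @orthogonal_set R m.+3 (@form_Q R m d).
Proof.
apply/mem_set; split; first by rewrite unitmx_mul T_unit.
by move=> v; rewrite -mulmxA T_isometry SE opprK.
Qed.

(** Each of [S] and [T] changes the sign of the form, so their product is an isometry of Q. It
    carries the standard lattice to the integral Hermitian matrices, transported by [T]. *)
Definition frame : G := exist (fun M => M \in @orthogonal_set R m.+3 (@form_Q R m d)) _ hP.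

Lemma val_frame : val frame = T *m S. Proof. by []. Qed.

Definition arith_image : set G := [set A : G | exists2 g : 'M[O]_2, SL2 g &
  val A = T *m val (phi (inclM g)) *m invmx T].

Let Lr (A : G) : invmx T *m val A *m T \in @orthogonal_set R m.+3 (@lorentz R m.+2).
Proof.
have [uA FA] := set_mem (valP A).
apply/mem_set; split; first by rewrite !unitmx_mul unitmx_inv T_unit uA.
move=> v; apply: oppr_inj; rewrite -!T_isometry -!mulmxA mulKVmx //; exact: FA.
Qed.

Definition to_lorentz (A : G) : L := exist (fun M => M \in @orthogonal_set R m.+3 (@lorentz R m.+2)) _ (Lr A).

Lemma val_to_lorentz A : val (to_lorentz A) = invmx T *m val A *m T. Proof. by []. Qed.

Lemma to_lorentzK A : val A = T *m val (to_lorentz A) *m invmx T.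
Proof. by rewrite val_to_lorentz !mulmxA mulmxV // mul1mx -mulmxA mulmxV // mulmx1. Qed.

Lemma to_lorentz_component A : identity_component A -> identity_component (to_lorentz A).
Proof.
have c : continuous to_lorentz.
  move=> B; apply: continuous_to_orthogonal.
  have cm p (M N : 'M[R]_p) : continuous (fun X : 'M[R]_p => M *m X *m N).
    have sm : smooth_mx setT (fun X : 'M[R]_p => M *m X *m N).
      apply: smooth_mxM; [exact: openT| |exact: smooth_mx_cst].
      apply: smooth_mxM; [exact: openT|exact: smooth_mx_cst|exact: smooth_mx_id].
    by move=> X; apply: continuous_mx => i j; exact: (smooth_mx_continuous sm).
  apply: (@continuous_comp _ _ _ (val : G -> 'M[R]_m.+3) (fun X => invmx T *m X *m T)).
    exact: orthogonal_val_continuous.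
  exact: cm.
move=> hA; apply: (@identity_component_sub L (to_lorentz @` @identity_component G)).
- exists 1%g; first exact: identity_component1.
  apply/val_inj; rewrite val_to_lorentz; transitivity (invmx T *m 1%:M *m T); first by [].
  by rewrite mulmx1 mulVmx.
- apply: connected_continuous_connected; first exact: component_connected.
  exact: continuous_subspaceT.
- by exists A.
Qed.

Lemma arith_image_integral : arith_image `<=` integral_orthogonal frame.
Proof.
move=> A [g sg e]; have sg' := (SL2_incl R d_gt0 g).2 sg.
have [B BE] : exists B : 'M[int]_m.+3, invmx S *m val (phi (inclM g)) *m S = map_mx intr B.
  apply: int_mx_columns => u.
  have /is_hermZP[w wE] : is_herm (g *m hermZ d u *m ctr g).
    by have [_ +] := (SL2P g).1 sg; apply; exact: hermZ_herm.
  exists w; apply: (can_inj (mulKmx SU)); rewrite !mulmxA mulmxV // mul1mx.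
  apply: hmx_inj; rewrite -inclM_hermZ -wE !inclM_mul inclM_hermZ inclM_ctr.
  by rewrite -!mulmxA (phi_hmx phi_iso sg') !mulmxA.
exists B; rewrite -BE val_frame e invmx_mulmx // ?mulmxA.
rewrite -(mulmxA _ S (invmx S)) mulmxV // mulmx1.
by rewrite -(mulmxA _ S (invmx S)) mulmxV // mulmx1.
Qed.

Lemma arith_image_subgroup : is_subgroup arith_image.
Proof.
have s2 (g : 'M[O]_2) : SL2 g -> SL2 (inclM g) by move/(SL2_incl R d_gt0).
split.
- exists 1%:M; first exact: SL2_1.
  rewrite inclM_1 (phi1 phi_iso); transitivity (T *m 1%:M *m invmx T); last by [].
  by rewrite mulmx1 mulmxV.
- move=> A A' [g sg e] [g' sg' e']; exists (g *m g'); first exact: SL2M.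
  rewrite inclM_mul (phiM phi_iso (s2 _ sg) (s2 _ sg')); transitivity (val A *m val A'); first by [].
  transitivity (T *m (val (phi (inclM g)) *m val (phi (inclM g'))) *m invmx T); last by [].
  by rewrite e e' !mulmxA -(mulmxA _ (invmx T) T) mulVmx // mulmx1.
- move=> A [g sg e]; have [sh _ eh] := SL2_hash phi_iso (s2 _ sg).
  exists (hash g); first by apply/(SL2_incl R d_gt0); rewrite inclM_hash.
  rewrite inclM_hash eh; transitivity (invmx (val A)); first by [].
  transitivity (T *m invmx (val (phi (inclM g))) *m invmx T); last by [].
  rewrite e; have pU := orthogonal_unit (phi (inclM g)).
  by rewrite !invmx_mulmx ?unitmx_mul ?unitmx_inv ?T_unit // invmxK mulmxA.
Qed.

(** An element of the component is the image of some real Clifford matrix g; its integrality is the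
    lattice condition under which g has a reduced form, and the class of that form is the finite
    invariant. *)
Lemma arith_image_finite_index :
  finite_index (arith_image `&` integral_orthogonal frame)
    (@identity_component G `&` integral_orthogonal frame).
Proof.
have [U [c cP]] := reduction_classes R d.
(* A relation rather than a function, since g is determined only up to sign and its reduced form
   involves choices. *)
pose data (A : G) (t : U) := exists g N X, [/\ SL2 g, val A = T *m val (phi g) *m invmx T,
  reduced g N X & c N X = t].
have hdata A : (@identity_component G `&` integral_orthogonal frame) A -> exists t, data A t.
  move=> [/to_lorentz_component/(phi_surj phi_iso)[g sg pg] [B BE]].
  have [_ hg _] := SL2_hash phi_iso sg.
  have gH u : int2 (g *m inclM (hermZ d u) *m ctr g).
    exists (hermZ d (B *m u)); rewrite !inclM_hermZ -(phi_hmx phi_iso sg) pg; congr hmx.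
    rewrite val_to_lorentz BE val_frame invmx_mulmx // !mulmxA mulVmx // mul1mx map_mxM.
    by rewrite -(mulmxA _ (invmx T) T) mulVmx // mulmx1 mulmxKV // !mulmxA.
  have [N [X rX]] := reduced_exists d_gt0 hg (coord_integral d_gt0 hg gH).
  by exists (c N X), g, N, X; split=> //; rewrite [LHS]to_lorentzK pg.
have t0 : U := c 0%N 0.
pose cl (A : G) : U := xget t0 (data A).
have clP A : (@identity_component G `&` integral_orthogonal frame) A -> data A (cl A).
  by move=> /hdata[t dt]; exact: (xgetI _ dt).
apply: (@finite_index_classes _ _ _ _ cl) => x y hx hy exy.
have [_ HM HV] := integral_orthogonal_subgroup (@form_gramE m R d) (@gram_sym m R d)
  (gram_unit (@form_gramE m R d) (@gram_sym m R d) T_isometry) frame.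
split; last by apply: HM; [apply: HV; exact: hy.2|exact: hx.2].
have [g [N [X [sg gx rX cx]]]] := clP x hx; have [g' [N' [X' [sg' gy rX' cy]]]] := clP y hy.
have [sh hg' ph] := SL2_hash phi_iso sg'.
have [Z ZE] : int2 (hash g' *m g) by apply: (cP _ _ N N' X X'); rewrite ?cx ?cy.
exists Z; first by apply/(SL2_incl R d_gt0); rewrite -ZE; exact: SL2M.
rewrite -ZE (phiM phi_iso sh sg) ph.
transitivity (invmx (val y) *m val x); first by [].
transitivity (T *m (invmx (val (phi g')) *m val (phi g)) *m invmx T); last by [].
rewrite gx gy; have pU := orthogonal_unit (phi g').
rewrite !invmx_mulmx ?unitmx_mul ?unitmx_inv ?T_unit // invmxK !mulmxA.
by rewrite -(mulmxA _ (invmx T) T) mulVmx // mulmx1.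
Qed.

(** The image lies in the stabilizer, so one index is 1; the other is bounded in two stages, through
    the intersection of the stabilizer with the identity component. *)
Lemma arith_image_arithmetic : arithmetic_subgroup R arith_image.
Proof.
have JU := gram_unit (@form_gramE m R d) (@gram_sym m R d) T_isometry.
have sub := integral_orthogonal_subgroup (@form_gramE m R d) (@gram_sym m R d) JU frame.
have ss := orthogonal_group_semisimple (@form_gramE m R d) (@gram_sym m R d) T_unit T_isometry.
apply: (@arithmetic_commensurable R G arith_image (integral_orthogonal frame)).
- exact: arith_image_subgroup.
- exact: (integral_orthogonal_arithmetic (@form_gramE m R d) (@gram_sym m R d) JU (@gramZE m R d)).
split.
  exists [:: 1%g] => A hA; exists 1%g; first exact: mem_head.
  by rewrite invg1 mul1g; split=> //; exact: arith_image_integral.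
apply: (finite_index_trans arith_image_finite_index).
exact: (identity_component_finite_index (@form_gramE m R d) (@gram_sym m R d) T_unit T_isometry sub).
Qed.

End Main.

(** Working with SL_2(O) gives the image of PSL_2(O), because [phi] identifies g and -g. *)
Theorem mainTheorem4 (R : realType) (m : nat) (d : 'I_m -> nat)
  (d_gt0 : forall j, (0 < d j)%N)
  (phi : 'M[real_clifford R m]_2 -> orthogonal_group (@lorentz R m.+2))
  (phi_iso : is_moebius_iso phi)
  (T : 'M[R]_(m.+3)) (T_unit : T \in unitmx)
  (T_isometry : forall v, form_Q d (T *m v) = - lorentz v) :
  arithmetic_subgroup R [set A : orthogonal_group (@form_Q R m d) |
    exists2 g : 'M[clifford (fun j => (d j)%:Z)]_2, SL2 g &
      \val A = T *m \val (phi (map_mx (@order_incl R m d) g)) *m invmx T].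
Proof. exact: (arith_image_arithmetic d_gt0 phi_iso T_unit T_isometry). Qed.
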